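(* Let $f\in\mathcal{F}$, where $\mathcal{F}$ is the class of close-to-convex functions with argument $0$ with respect to odd starlike functions, and let $\gamma_n$ ($n\ge 1$) denote the logarithmic coefficients of $f$, defined by $\log\frac{f(z)}{z}=2\sum_{n=1}^{\infty}\gamma_n z^n$ for $z\in\mathbb{D}$. Then $$|\gamma_1|\le \frac{1}{2},\qquad |\gamma_2|\le \frac{1}{2},\qquad |\gamma_3|\le \frac{1}{972}\left(95+23\sqrt{46}\right).$$ The inequalities are sharp; that is, for each of the three inequalities there exists a function $f\in\mathcal{F}$ for which equality holds.
   Context: Let $\mathbb{D}=\{z\in\mathbb{C}:|z|<1\}$. Let $\mathcal{A}$ be the class of analytic functions $f$ in $\mathbb{D}$ normalized by $f(0)=0$ and $f'(0)=1$, so that $f(z)=z+\sum_{n=2}^{\infty}a_nz^n$. Let $\mathcal{S}$ be the class of univalent (one-to-one) functions in $\mathcal{A}$. A function $g\in\mathcal{S}$ is called starlike, written $g\in\mathcal{S}^*$, if $g(\mathbb{D})$ is starlike with respect to the origin; for $g\in\mathcal{A}$, one has $g\in\mathcal{S}^*$ if and only if $\operatorname{Re}\left(zg'(z)/g(z)\right)>0$ for $z\in\mathbb{D}$. Let $\mathcal{S}_2^*$ denote the class of odd starlike functions, i.e. functions $g\in\mathcal{S}^*$ with $g(-z)=-g(z)$ for all $z\in\mathbb{D}$. The class $\mathcal{F}$ is $$\mathcal{F}=\left\{f\in\mathcal{A}:\ \operatorname{Re}\frac{zf'(z)}{g(z)}>0 \text{ for all } z\in\mathbb{D},\ \text{for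 some } g\in\mathcal{S}_2^*\right\},$$ where quotients such as $zf'(z)/g(z)$, $zg'(z)/g(z)$ and $f(z)/z$ are understood to take their limiting value $1$ at $z=0$. Every function in $\mathcal{F}$ is close-to-convex and hence univalent in $\mathbb{D}$, so $f(z)/z$ is non-vanishing in $\mathbb{D}$; $\log\frac{f(z)}{z}$ denotes the analytic branch of the logarithm on $\mathbb{D}$ that vanishes at $z=0$. *)

(* Defs.v *)
From Stdlib Require Import Reals.
From Coquelicot Require Import Coquelicot.
Open Scope C_scope.

Definition unit_disk (z : C) : Prop := (Cmod z < 1)%R.

(** Functions on the disk are total functions on [C]; only their values on
    [unit_disk] matter. *)
Definition analytic_on_disk (f : C -> C) : Prop :=
  forall z : C, unit_disk z -> @ex_derive C_AbsRing C_NormedModule f z.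

Definition class_A (f : C -> C) : Prop :=
  analytic_on_disk f /\ f 0 = 0 /\ C_derive f 0 = 1.

Definition univalent (f : C -> C) : Prop :=
  forall z w : C, unit_disk z -> unit_disk w -> f z = f w -> z = w.

Definition class_S (f : C -> C) : Prop := class_A f /\ univalent f.

Definition disk_image (f : C -> C) (w : C) : Prop :=
  exists z : C, unit_disk z /\ f z = w.

Definition starlike_wrt_origin (E : C -> Prop) : Prop :=
  forall (w : C) (t : R), E w -> (0 <= t <= 1)%R -> E (RtoC t * w).

Definition starlike (g : C -> C) : Prop :=
  class_S g /\ starlike_wrt_origin (disk_image g).

Definition odd_starlike (g : C -> C) : Prop :=
  starlike g /\ forall z : C, unit_disk z -> g (- z) = - g z.

(** The quotient [u z / v z], with the value [1] at [z = 0]; this is its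
    limiting value for the two quotients [z f'(z) / g(z)] and [f(z) / z]
    formed below with [f] and [g] in [class_A]. *)
Definition quot (u v : C -> C) (z : C) : C :=
  if Ceq_dec z 0 then 1 else u z / v z.

Definition class_F (f : C -> C) : Prop :=
  class_A f /\
  exists g : C -> C, odd_starlike g /\
    forall z : C, unit_disk z ->
      (0 < Re (quot (fun x => x * C_derive f x) g z)%C)%R.

Definition Cexp (z : C) : C :=
  ((exp (Re z) * cos (Im z))%R, (exp (Re z) * sin (Im z))%R).

(** [L] is the analytic branch of [log (f(z) / z)] on the disk vanishing
    at [0]; it is unique on the disk. *)
Definition is_log_branch (f L : C -> C) : Prop :=
  analytic_on_disk L /\ L 0 = 0 /\
  forall z : C, unit_disk z -> Cexp (L z) = quot f (fun x => x) z.

(** The sum starts at index [1]: the value [gamma 0] plays no role. *)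
Definition log_coefficients (f : C -> C) (gamma : nat -> C) : Prop :=
  exists L : C -> C, is_log_branch f L /\
    forall z : C, unit_disk z ->
      exists s : C,
        @is_series C_AbsRing C_NormedModule
          (fun n => gamma (S n) * z ^ (S n)) s /\
        L z = 2 * s.

(* Main.v *)
(** Write [z f' = g p] with [Re p > 0], and let [w1, w2, w3] be the coefficients of
    [w = (p - 1) / (p + 1)] and [b3] the third coefficient of [g].  Comparing coefficients gives
    [2 gamma_1 = w1], [6 gamma_2 = 2 w2 + w1^2 / 2 + b3] and
    [4 gamma_3 = w3 + (2/3) w1 w2 + (1/3) w1^3 + (1/3) w1 b3].

    Oddness and starlikeness give [|b3| <= 1]: for [0 < t < 1] the function [g^-1 (t g z) / z]
    is bounded by 1 and equals [t + (t - t^3) b3 z^2 + ...].  Its analyticity rests on an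
    open-mapping argument and on [g' <> 0], both from the mean value property of reciprocals.
    Schur's algorithm parametrises [w1, w2, w3], and
    [|w3 + (2/3) w1 w2 + (1/3) w1^3| <= 1 - (8/9) |w1|^2 + (2/9) |w1|^3]; the remaining cubic in
    [|w1|] is largest at [(8 - sqrt 46) / 6].

    Since [f] and [g] are only assumed complex differentiable, Cauchy's theory starts from
    Goursat's bisection, applied to [h (exp zeta)] on rectangles: integrals over concentric
    circles agree, even across a circle on which [h] is merely continuous.  The Cauchy formula is
    the resulting mean value property for the difference quotient of [h].

    For sharpness, [g = z / (1 - z^2)] and [f' = (1 + w) / ((1 - w) (1 - z^2))] with [w = z],
    [w = z^2], or a Blaschke product of degree 3. *)

Require Import Defs.
From Stdlib Require Import Reals Psatz Classical ClassicalEpsilon.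
From Coquelicot Require Import Coquelicot.
Open Scope C_scope.

(** * Limits and derivatives of complex functions *)

(** The third estimate adds two separate bounds, one for the part without b3 and one for |b3|. It is
    nevertheless sharp: both are equalities when b3 = 1, w1 = t >= 0 and the Schur parameters of w /
    z are t, t / (3 (1 + t)) and 1, and both parts are then nonnegative reals. The point t = (8 -
    sqrt 46) / 6 is the root in [0, 1] of 6 t^2 - 16 t + 3, which is the derivative of the cubic up
    to a factor. Two difficulties shape the rest. Schur's algorithm divides by 1 - |w1|^2, so in the
    boundary case it is applied to l h with l < 1, and l then tends to 1; this also stands in for
    the strict maximum principle. And the upper bounds receive a branch of log (f / z) along with
    the coefficients, whereas an extremal f is known only through its derivative: that f / z has no
    zero, hence has a logarithm, takes a close-to-convexity argument. *)

Ltac tc := typeclasses eauto.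

Lemma Cmod_minus_sym (a b : C) : Cmod (a - b) = Cmod (b - a).
Proof. rewrite <- Cmod_opp. f_equal. ring. Qed.

Lemma Cmod_rev_triangle (a b : C) : (Cmod a - Cmod b <= Cmod (a - b))%R.
Proof.
  assert (H := Cmod_triangle (a - b) b).
  replace (a - b + b) with a in H by ring. lra.
Qed.

Lemma im_le_Cmod (c : C) : (Rabs (Im c) <= Cmod c)%R.
Proof.
  eapply Rle_trans; [| apply Rmax_Cmod]. apply Rmax_r.
Qed.

Lemma C_eta (c : C) : c = RtoC (Re c) + Ci * RtoC (Im c).
Proof. destruct c; unfold Ci, Cplus, Cmult, RtoC; simpl. f_equal; ring. Qed.

Lemma Cmod_le_abs_parts (c : C) : (Cmod c <= Rabs (Re c) + Rabs (Im c))%R.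
Proof.
  rewrite (C_eta c) at 1.
  eapply Rle_trans; [apply Cmod_triangle|].
  rewrite Cmod_mult, Cmod_Ci, !Cmod_R. lra.
Qed.

Lemma Cmult_integral (a b : C) : a * b = 0 -> a = 0 \/ b = 0.
Proof.
  intros H. destruct (Ceq_dec a 0) as [Ha|Ha]; [now left|].
  destruct (Ceq_dec b 0) as [Hb|Hb]; [now right|].
  now destruct (Cmult_neq_0 a b Ha Hb).
Qed.

Lemma Cmult_reg_l (a b c : C) : a <> 0 -> a * b = a * c -> b = c.
Proof.
  intros Ha H. replace b with (/ a * (a * b)) by (field; auto).
  rewrite H. field; auto.
Qed.

Lemma Re_le_Cmod (c : C) : (Re c <= Cmod c)%R.
Proof. eapply Rle_trans; [apply Rle_abs | apply re_le_Cmod]. Qed.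

(** The uniform structure of the modulus, whose balls are discs. It is the one behind the domain
    filter of [is_derive] over [C_AbsRing]; the product structure on [C] has square balls. *)
Definition CU : UniformSpace := AbsRing_UniformSpace C_AbsRing.

(** The filter is arbitrary, so that limits in a real and in a complex variable share one set of
    rules. *)
Definition Clim {T : Type} (F : (T -> Prop) -> Prop) (f : T -> C) (l : C) : Prop :=
  forall eps : R, (0 < eps)%R -> F (fun t => (Cmod (f t - l) < eps)%R).

Section Limits.
Context {T : Type} (F : (T -> Prop) -> Prop) {FF : Filter F}.

Lemma Clim_const (c : C) : Clim F (fun _ => c) c.
Proof.
  intros e He. apply filter_forall. intros _.
  replace (c - c) with (RtoC 0) by ring. now rewrite Cmod_0.
Qed.

Lemma Clim_ext_loc (f g : T -> C) (l : C) :
  F (fun t => f t = g t) -> Clim F f l -> Clim F g l.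
Proof.
  intros H Hf e He. generalize (filter_and _ _ H (Hf e He)).
  apply filter_imp. intros t [-> Ht]; exact Ht.
Qed.

Lemma Clim_eq (f : T -> C) (l m : C) : l = m -> Clim F f l -> Clim F f m.
Proof. now intros <-. Qed.

Lemma Clim_plus (f g : T -> C) (l m : C) :
  Clim F f l -> Clim F g m -> Clim F (fun t => f t + g t) (l + m).
Proof.
  intros Hf Hg e He.
  assert (He2 : (0 < e/2)%R) by lra.
  generalize (filter_and _ _ (Hf _ He2) (Hg _ He2)).
  apply filter_imp. intros t [H1 H2].
  replace (f t + g t - (l + m)) with ((f t - l) + (g t - m)) by ring.
  eapply Rle_lt_trans; [apply Cmod_triangle|]. lra.
Qed.

Lemma Clim_bounded (f : T -> C) (l : C) :
  Clim F f l -> F (fun t => (Cmod (f t) < Cmod l + 1)%R).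
Proof.
  intros Hf. generalize (Hf 1%R Rlt_0_1). apply filter_imp. intros t Ht.
  assert (H := Cmod_rev_triangle (f t) l). lra.
Qed.

Lemma Clim_mult (f g : T -> C) (l m : C) :
  Clim F f l -> Clim F g m -> Clim F (fun t => f t * g t) (l * m).
Proof.
  intros Hf Hg e He.
  assert (Hl := Cmod_ge_0 l). assert (Hm := Cmod_ge_0 m).
  set (d := (e / (2 * (Cmod l + Cmod m + 1)))%R).
  assert (Hd : (0 < d)%R) by (apply Rdiv_lt_0_compat; lra).
  generalize (filter_and _ _ (Clim_bounded f l Hf)
               (filter_and _ _ (Hf d Hd) (Hg d Hd))).
  apply filter_imp. intros t [H0 [H1 H2]].
  replace (f t * g t - l * m) with (f t * (g t - m) + (f t - l) * m) by ring.
  eapply Rle_lt_trans; [apply Cmod_triangle|]. rewrite !Cmod_mult.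
  assert (E : (d * (2 * (Cmod l + Cmod m + 1)) = e)%R) by (unfold d; field; lra).
  assert (H3 := Cmod_ge_0 (f t)). assert (H4 := Cmod_ge_0 (g t - m)).
  assert (H5 := Cmod_ge_0 (f t - l)). nra.
Qed.

Lemma Clim_opp (f : T -> C) (l : C) :
  Clim F f l -> Clim F (fun t => - f t) (- l).
Proof.
  intros Hf e He. generalize (Hf e He). apply filter_imp. intros t Ht.
  replace (- f t - - l) with (- (f t - l)) by ring. now rewrite Cmod_opp.
Qed.

Lemma Clim_minus (f g : T -> C) (l m : C) :
  Clim F f l -> Clim F g m -> Clim F (fun t => f t - g t) (l - m).
Proof. intros Hf Hg. apply Clim_plus; auto. now apply Clim_opp. Qed.

Lemma Clim_neq0 (f : T -> C) (l : C) :
  l <> 0 -> Clim F f l -> F (fun t => (Cmod l / 2 < Cmod (f t))%R).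
Proof.
  intros Hl Hf. apply Cmod_gt_0 in Hl.
  assert (Hl2 : (0 < Cmod l / 2)%R) by lra. generalize (Hf _ Hl2). apply filter_imp. intros t Ht.
  assert (H := Cmod_rev_triangle l (f t)). rewrite Cmod_minus_sym in H. lra.
Qed.

Lemma Clim_inv (f : T -> C) (l : C) :
  l <> 0 -> Clim F f l -> Clim F (fun t => / f t) (/ l).
Proof.
  intros Hl Hf e He. assert (Hl' := Hl). apply Cmod_gt_0 in Hl'.
  assert (Hd : (0 < e * (Cmod l * Cmod l) / 2)%R).
  { apply Rdiv_lt_0_compat; [|lra]. repeat apply Rmult_lt_0_compat; lra. }
  generalize (filter_and _ _ (Clim_neq0 f l Hl Hf) (Hf _ Hd)).
  apply filter_imp. intros t [H1 H2].
  assert (Hft : f t <> 0) by (apply Cmod_gt_0; lra).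
  replace (/ f t - / l) with (- ((f t - l) * / (f t * l))) by (field; auto).
  rewrite Cmod_opp, Cmod_mult, Cmod_inv, Cmod_mult by (apply Cmult_neq_0; auto).
  apply (Rmult_lt_reg_r (Cmod (f t) * Cmod l)).
  { apply Rmult_lt_0_compat; lra. }
  rewrite Rmult_assoc, Rinv_l, Rmult_1_r by (apply Rgt_not_eq, Rmult_lt_0_compat; lra).
  eapply Rlt_trans; [exact H2|].
  assert (Cmod l / 2 * Cmod l < Cmod (f t) * Cmod l)%R by (apply Rmult_lt_compat_r; lra).
  nra.
Qed.

End Limits.

Lemma Clim_RtoC (x : R) : Clim (@locally R_UniformSpace x) RtoC x.
Proof.
  intros e He. exists (mkposreal e He). intros y Hy.
  rewrite <- RtoC_minus, Cmod_R. exact Hy.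
Qed.

Lemma Clim_id (z : C) : Clim (@locally CU z) (fun u => u) z.
Proof. intros e He. exists (mkposreal e He). intros y Hy. exact Hy. Qed.

Lemma Clim_comp {T : Type} (F : (T -> Prop) -> Prop) {FF : Filter F}
  (f : T -> C) (g : C -> C) (l : C) :
  Clim F f l -> Clim (@locally CU l) g (g l) -> Clim F (fun t => g (f t)) (g l).
Proof.
  intros Hf Hg e He. destruct (Hg e He) as [d Hd].
  generalize (Hf d (cond_pos d)). apply filter_imp. intros t Ht. now apply Hd.
Qed.

Lemma Clim_Cmod {T : Type} (F : (T -> Prop) -> Prop) {FF : Filter F} (f : T -> C) (l : C) :
  Clim F f l -> Clim F (fun t => RtoC (Cmod (f t))) (RtoC (Cmod l)).
Proof.
  intros Hf e He. generalize (Hf e He). apply filter_imp. intros t Ht.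
  rewrite <- RtoC_minus, Cmod_R.
  assert (H1 := Cmod_rev_triangle (f t) l).
  assert (H2 := Cmod_rev_triangle l (f t)). rewrite Cmod_minus_sym in H2.
  apply Rabs_def1; lra.
Qed.

Lemma Clim_ReIm (x : R) (f : R -> C) (l : C) :
  Clim (@locally R_UniformSpace x) f l ->
  filterlim (fun t => Re (f t)) (locally x) (locally (Re l)) /\
  filterlim (fun t => Im (f t)) (locally x) (locally (Im l)).
Proof.
  intros H. split; apply filterlim_locally; intros eps;
    generalize (H eps (cond_pos eps)); apply filter_imp; intros t Ht;
    (eapply Rle_lt_trans; [|exact Ht]).
  - apply (re_le_Cmod (f t - l)).
  - apply (im_le_Cmod (f t - l)).
Qed.

(** Carathéodory's form of differentiability, for functions of a real
    ([e = RtoC]) or complex ([e] the identity) variable. *)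
Definition der {T : UniformSpace} (e : T -> C) (f : T -> C) (t : T) (l : C) : Prop :=
  exists q : T -> C, Clim (locally t) q l /\ q t = l /\
    forall s, f s = f t + (e s - e t) * q s.

Section Derivation.
Context {T : UniformSpace} (e : T -> C) (t : T).
Hypothesis e_cont : Clim (locally t) e (e t).

Lemma der_const (c : C) : der e (fun _ => c) t 0.
Proof.
  exists (fun _ => RtoC 0). repeat split; [apply Clim_const; tc|].
  intros s. ring.
Qed.

Lemma der_param : der e e t 1.
Proof.
  exists (fun _ => RtoC 1). repeat split; [apply Clim_const; tc|].
  intros s. ring.
Qed.

Lemma der_cont (f : T -> C) (l : C) : der e f t l -> Clim (locally t) f (f t).
Proof.
  intros [q [Hq [Hl H]]].
  apply (Clim_ext_loc _ (fun s => f t + (e s - e t) * q s)).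
  - apply filter_forall. intros s. now rewrite <- H.
  - apply (Clim_eq _ _ (f t + (e t - e t) * l)); [ring|].
    apply Clim_plus; [tc| apply Clim_const; tc|].
    apply Clim_mult; [tc| |assumption].
    apply Clim_minus; [tc|assumption|apply Clim_const; tc].
Qed.

Lemma der_eq (f : T -> C) (l m : C) : der e f t l -> l = m -> der e f t m.
Proof. now intros H <-. Qed.

Lemma der_ext (f g : T -> C) (l : C) : (forall s, f s = g s) -> der e f t l -> der e g t l.
Proof.
  intros E [q [Hq [Hl H]]]. exists q. repeat split; auto.
  intros s. rewrite <- !E. apply H.
Qed.

Lemma der_plus (f g : T -> C) (l m : C) :
  der e f t l -> der e g t m -> der e (fun s => f s + g s) t (l + m).
Proof.
  intros [q [Hq [Hl H]]] [r [Hr [Hm K]]]. exists (fun s => q s + r s).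
  split; [apply Clim_plus; auto; tc|]. split; [now rewrite Hl, Hm|].
  intros s. rewrite (H s), (K s). ring.
Qed.

Lemma der_mult (f g : T -> C) (l m : C) :
  der e f t l -> der e g t m -> der e (fun s => f s * g s) t (l * g t + f t * m).
Proof.
  intros Df Dg. assert (Cg := der_cont g m Dg).
  destruct Df as [q [Hq [Hl H]]], Dg as [r [Hr [Hm K]]].
  exists (fun s => q s * g s + f t * r s).
  split; [|split; [now rewrite Hl, Hm|]].
  - apply Clim_plus; try tc; apply Clim_mult; auto; try tc.
    apply Clim_const; tc.
  - intros s. rewrite (H s), (K s). ring.
Qed.

Lemma der_comp (f : T -> C) (g : C -> C) (l m : C) :
  @der CU (fun u => u) g (f t) m -> der e f t l -> der e (fun s => g (f s)) t (m * l).
Proof.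
  intros [r [Hr [Hm K]]] Df. assert (Cf := der_cont f l Df).
  destruct Df as [q [Hq [Hl H]]].
  exists (fun s => r (f s) * q s).
  split; [|split; [now rewrite Hl, Hm|]].
  - apply Clim_mult; [tc| |assumption]. rewrite <- Hm.
    apply Clim_comp; [tc|assumption|]. now rewrite Hm.
  - intros s. rewrite (K (f s)) at 1. rewrite (H s) at 1. ring.
Qed.

Lemma der_opp (f : T -> C) (l : C) : der e f t l -> der e (fun s => - f s) t (- l).
Proof.
  intros [q [Hq [Hl H]]]. exists (fun s => - q s).
  split; [apply Clim_opp; auto; tc|]. split; [now rewrite Hl|].
  intros s. rewrite (H s). ring.
Qed.

Lemma der_minus (f g : T -> C) (l m : C) :
  der e f t l -> der e g t m -> der e (fun s => f s - g s) t (l - m).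
Proof. intros Hf Hg. apply der_plus; auto. now apply der_opp. Qed.

Lemma der_scal (c : C) (f : T -> C) (l : C) : der e f t l -> der e (fun s => c * f s) t (c * l).
Proof.
  intros H. eapply der_eq; [apply der_mult; [apply der_const|exact H]|]. cbv beta; ring.
Qed.

End Derivation.

Notation cder := (@der CU (fun u : C => u)).
Notation rder := (@der R_UniformSpace RtoC).
Definition ccont (f : C -> C) (z : C) : Prop := Clim (@locally CU z) f (f z).
Definition rcont (f : R -> C) (x : R) : Prop := Clim (@locally R_UniformSpace x) f (f x).

Lemma rcont_comp (g : R -> C) (f : C -> C) (x : R) :
  rcont g x -> ccont f (g x) -> rcont (fun t => f (g t)) x.
Proof. intros Hg Hf. exact (Clim_comp (locally x) g f (g x) Hg Hf). Qed.

Lemma ccont_comp (g f : C -> C) (z : C) :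
  ccont g z -> ccont f (g z) -> ccont (fun t => f (g t)) z.
Proof. intros Hg Hf. exact (Clim_comp (@locally CU z) g f (g z) Hg Hf). Qed.

Lemma cder_cont (f : C -> C) (z l : C) : cder f z l -> ccont f z.
Proof. apply der_cont. apply Clim_id. Qed.

Lemma rder_cont (f : R -> C) (x : R) (l : C) : rder f x l -> rcont f x.
Proof. apply der_cont. apply Clim_RtoC. Qed.

Definition cder_const := @der_const CU (fun u => u).
Definition cder_plus := @der_plus CU (fun u => u).
Definition cder_minus := @der_minus CU (fun u => u).
Definition cder_opp := @der_opp CU (fun u => u).
Definition cder_mult := fun z => @der_mult CU (fun u => u) z (Clim_id z).
Definition cder_scal := fun z => @der_scal CU (fun u => u) z (Clim_id z).
Definition cder_comp := fun z => @der_comp CU (fun u => u) z (Clim_id z).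
Definition rder_plus := @der_plus R_UniformSpace RtoC.
Definition rder_mult := fun x => @der_mult R_UniformSpace RtoC x (Clim_RtoC x).
Definition rder_scal := fun x => @der_scal R_UniformSpace RtoC x (Clim_RtoC x).
Definition rder_comp := fun x => @der_comp R_UniformSpace RtoC x (Clim_RtoC x).

Lemma cder_id (z : C) : cder (fun u => u) z 1.
Proof. apply der_param. Qed.

(** The witness is the difference quotient, completed by [l]. Injectivity of [e] settles the
    factorisation at points where the quotient is undefined. *)
Lemma der_of_lim {T : UniformSpace} (e f : T -> C) (t : T) (l : C) :
  (forall s, e s = e t -> s = t) ->
  (forall eps, (0 < eps)%R -> locally t (fun s =>
     (Cmod (f s - f t - (e s - e t) * l) <= eps * Cmod (e s - e t))%R)) ->
  der e f t l.
Proof.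
  intros Inj H.
  exists (fun s => if Ceq_dec (e s) (e t) then l else (f s - f t) / (e s - e t)).
  split; [|split].
  - intros eps Heps. assert (He2 : (0 < eps/2)%R) by lra. generalize (H _ He2). apply filter_imp.
    intros s Hs. destruct (Ceq_dec (e s) (e t)) as [E|E].
    + replace (l - l) with (RtoC 0) by ring. now rewrite Cmod_0.
    + apply Cminus_eq_contra in E.
      replace ((f s - f t) / (e s - e t) - l) with
        ((f s - f t - (e s - e t) * l) / (e s - e t)) by (field; auto).
      rewrite Cmod_div by auto. apply Cmod_gt_0 in E.
      apply (Rmult_lt_reg_r (Cmod (e s - e t))); [lra|].
      unfold Rdiv. rewrite Rmult_assoc, Rinv_l, Rmult_1_r by lra. nra.
  - destruct (Ceq_dec (e t) (e t)); congruence.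
  - intros s. destruct (Ceq_dec (e s) (e t)) as [E|E].
    + rewrite (Inj s E). ring.
    + apply Cminus_eq_contra in E. field. auto.
Qed.

Lemma cder_of_lim (f : C -> C) (z l : C) :
  (forall eps, (0 < eps)%R -> @locally CU z (fun s =>
     (Cmod (f s - f z - (s - z) * l) <= eps * Cmod (s - z))%R)) ->
  cder f z l.
Proof. apply der_of_lim. auto. Qed.

Lemma cder_lim (f : C -> C) (z l : C) : cder f z l ->
  forall eps, (0 < eps)%R -> @locally CU z (fun s =>
     (Cmod (f s - f z - (s - z) * l) <= eps * Cmod (s - z))%R).
Proof.
  intros [q [Hq [Hl H]]] eps He. generalize (Hq eps He). apply filter_imp.
  intros s Hs. rewrite (H s).
  replace (f z + (s - z) * q s - f z - (s - z) * l) with ((q s - l) * (s - z)) by ring.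
  rewrite Cmod_mult. apply Rmult_le_compat_r; [apply Cmod_ge_0|lra].
Qed.

Lemma is_derive_cder (f : C -> C) (z l : C) :
  @is_derive C_AbsRing C_NormedModule f z l <-> cder f z l.
Proof.
  split.
  - intros [_ H]. apply cder_of_lim. intros eps He.
    assert (H1 := H z (fun P HP => HP) (mkposreal eps He)).
    revert H1. apply filter_imp. intros s Hs. exact Hs.
  - intros H. split; [apply is_linear_scal_l|].
    intros x Hx.
    assert (x = z) as ->.
    { symmetry. apply (is_filter_lim_locally_unique (V:=AbsRing_NormedModule C_AbsRing) z x Hx). }
    intros eps. generalize (cder_lim f z l H eps (cond_pos eps)).
    apply filter_imp. intros s Hs. exact Hs.
Qed.

Lemma cder_ex (f : C -> C) (z : C) :
  @ex_derive C_AbsRing C_NormedModule f z <-> cder f z (C_derive f z).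
Proof.
  split.
  - intros H. apply is_derive_cder. apply C_derive_correct; auto.
  - intros H. exists (C_derive f z). now apply is_derive_cder.
Qed.

Lemma cder_ex_intro (f : C -> C) (z l : C) : cder f z l ->
  @ex_derive C_AbsRing C_NormedModule f z.
Proof. intros H. exists l. now apply is_derive_cder. Qed.

Lemma cder_C_derive (f : C -> C) (z l : C) : cder f z l -> C_derive f z = l.
Proof. intros H. apply is_derive_cder in H. now apply is_C_derive_unique. Qed.

Lemma cder_ext_loc (f g : C -> C) (z l : C) :
  @locally CU z (fun u => f u = g u) -> cder f z l -> cder g z l.
Proof.
  intros E H. apply cder_of_lim. intros eps He.
  assert (E0 : f z = g z).
  { destruct E as [d Hd]. apply Hd. apply ball_center. }
  generalize (filter_and _ _ E (cder_lim f z l H eps He)). apply filter_imp.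
  intros u [Hu Hl]. now rewrite <- Hu, <- E0.
Qed.

Lemma cder_inv (f : C -> C) (z l : C) : f z <> 0 -> cder f z l ->
  cder (fun u => / f u) z (- l / (f z * f z)).
Proof.
  intros Hz H. assert (Cf := cder_cont f z l H).
  destruct H as [q [Hq [Hl H]]].
  (* The quotient of 1 / f at z is - q u / (f u * f z). The factorisation holds only where f u is
     nonzero, that is, near z. *)
  assert (D : @locally CU z (fun u =>
     / f z + (u - z) * (- q u * / (f u * f z)) = / f u)).
  { generalize (Clim_neq0 _ f (f z) Hz Cf). apply filter_imp. intros u Hu.
    assert (f u <> 0).
    { apply Cmod_gt_0. assert (E := Cmod_ge_0 (f z)). lra. }
    assert (Q : (u - z) * q u = f u - f z) by (rewrite (H u); ring).
    transitivity (/ f z - (u - z) * q u * / (f u * f z)); [field; auto|].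
    rewrite Q. field. auto. }
  eapply cder_ext_loc; [exact D|].
  exists (fun u => - q u * / (f u * f z)).
  split; [|split].
  -    eapply (Clim_mult (@locally CU z)).
    + apply Clim_opp; [tc|exact Hq].
    + apply Clim_inv; [tc| now apply Cmult_neq_0|].
      apply Clim_mult; [tc|exact Cf|apply Clim_const; tc].
  - now rewrite Hl.
  - intros s. ring.
Qed.

Lemma cder_div (f g : C -> C) (z l m : C) : g z <> 0 -> cder f z l -> cder g z m ->
  cder (fun u => f u / g u) z ((l * g z - f z * m) / (g z * g z)).
Proof.
  intros Hz Hf Hg.
  eapply der_eq; [apply (der_mult (T:=CU)); [apply Clim_id|exact Hf|apply cder_inv; eauto]|].
  cbv beta. field. auto.
Qed.

Lemma locally_disk (z : C) : unit_disk z -> @locally CU z unit_disk.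
Proof.
  intros Hz. unfold unit_disk in *.
  assert (H : (0 < 1 - Cmod z)%R) by lra.
  exists (mkposreal _ H). intros y Hy. change (Cmod (y - z) < 1 - Cmod z)%R in Hy.
  assert (K := Cmod_rev_triangle y z). unfold unit_disk. lra.
Qed.

Definition hol (f : C -> C) : Prop := analytic_on_disk f.

Lemma hol_cder (f : C -> C) (z : C) : hol f -> unit_disk z -> cder f z (C_derive f z).
Proof. intros H Hz. apply cder_ex. now apply H. Qed.

Lemma hol_cont (f : C -> C) (z : C) : hol f -> unit_disk z -> ccont f z.
Proof. intros H Hz. eapply cder_cont. now apply hol_cder. Qed.

Lemma hol_intro (f : C -> C) : (forall z, unit_disk z -> exists l, cder f z l) -> hol f.
Proof. intros H z Hz. destruct (H z Hz) as [l Hl]. eapply cder_ex_intro; eauto. Qed.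

Lemma hol_ext (f g : C -> C) : (forall z, unit_disk z -> f z = g z) -> hol f -> hol g.
Proof.
  intros E H. apply hol_intro. intros z Hz. exists (C_derive f z).
  apply (cder_ext_loc f); [|now apply hol_cder].
  generalize (locally_disk z Hz). apply filter_imp. auto.
Qed.

Lemma C_derive_ext_disk (f g : C -> C) (z : C) : hol f ->
  (forall z, unit_disk z -> f z = g z) -> unit_disk z -> C_derive f z = C_derive g z.
Proof.
  intros H E Hz. symmetry. apply cder_C_derive. apply (cder_ext_loc f).
  - generalize (locally_disk z Hz). apply filter_imp. auto.
  - now apply hol_cder.
Qed.

Lemma hol_const (c : C) : hol (fun _ => c).
Proof. apply hol_intro. intros z _. exists 0. apply cder_const. Qed.

Lemma hol_id : hol (fun u => u).
Proof. apply hol_intro. intros z _. exists 1. apply cder_id. Qed.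

Lemma hol_plus (f g : C -> C) : hol f -> hol g -> hol (fun z => f z + g z).
Proof.
  intros Hf Hg. apply hol_intro. intros z Hz. eexists.
  apply cder_plus; apply hol_cder; auto.
Qed.

Lemma hol_minus (f g : C -> C) : hol f -> hol g -> hol (fun z => f z - g z).
Proof.
  intros Hf Hg. apply hol_intro. intros z Hz. eexists.
  apply cder_minus; apply hol_cder; auto.
Qed.

Lemma hol_opp (f : C -> C) : hol f -> hol (fun z => - f z).
Proof. intros Hf. apply hol_intro. intros z Hz. eexists. apply cder_opp; apply hol_cder; auto. Qed.

Lemma hol_mult (f g : C -> C) : hol f -> hol g -> hol (fun z => f z * g z).
Proof.
  intros Hf Hg. apply hol_intro. intros z Hz. eexists.
  apply cder_mult; apply hol_cder; auto.
Qed.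

Lemma hol_div (f g : C -> C) : (forall z, unit_disk z -> g z <> 0) ->
  hol f -> hol g -> hol (fun z => f z / g z).
Proof.
  intros Nz Hf Hg. apply hol_intro. intros z Hz. eexists.
  apply cder_div; [auto| |]; apply hol_cder; auto.
Qed.

Lemma hol_pow (f : C -> C) (n : nat) : hol f -> hol (fun z => f z ^ n).
Proof.
  intros H. induction n as [|n IH]; simpl; [apply hol_const|].
  now apply hol_mult.
Qed.

Lemma hol_comp (f g : C -> C) : (forall z, unit_disk z -> unit_disk (g z)) ->
  hol f -> hol g -> hol (fun z => f (g z)).
Proof.
  intros Hd Hf Hg. apply hol_intro. intros z Hz. eexists.
  apply cder_comp; [apply hol_cder; auto|apply hol_cder; auto].
Qed.

(** * The complex exponential and curves *)

Lemma cder_Cexp (z : C) : cder Cexp z (Cexp z).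
Proof.
  assert (E : forall u, Cexp u = exp (Re u) * (cos (Im u) + Ci * sin (Im u))).
  { intros u. unfold Cexp, Ci, RtoC, Cmult, Cplus. simpl. f_equal; ring. }
  apply cder_of_lim. intros eps He.
  set (x := Re z). set (y := Im z).
  assert (Dx : rder (fun s => RtoC (exp s)) x (RtoC (exp x))).
  { apply der_of_lim; [intros s; apply RtoC_inj|]. intros e He'.
    assert (D : is_derive exp x (exp x)) by apply is_derive_exp.
    destruct D as [_ D]. generalize (D x (fun P HP => HP) (mkposreal e He')).
    apply filter_imp. intros s Hs.
    rewrite <- !RtoC_minus, <- RtoC_mult, <- RtoC_minus, !Cmod_R. exact Hs. }
  assert (Dc : forall h dh : R -> R, is_derive h y (dh y) ->
     rder (fun s => RtoC (h s)) y (RtoC (dh y))).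
  { intros h dh [_ D]. apply der_of_lim; [intros s; apply RtoC_inj|]. intros e He'.
    generalize (D y (fun P HP => HP) (mkposreal e He')).
    apply filter_imp. intros s Hs.
    rewrite <- !RtoC_minus, <- RtoC_mult, <- RtoC_minus, !Cmod_R. exact Hs. }
  assert (Dy : rder (fun s => RtoC (cos s) + Ci * RtoC (sin s)) y (- sin y + Ci * cos y)).
  { apply rder_plus.
    - rewrite <- RtoC_opp. apply (Dc cos (fun s => - sin s)%R). apply is_derive_cos.
    - apply rder_scal. apply (Dc sin cos). apply is_derive_sin. }
  destruct Dx as [q [Hq [Hqx Q]]]. destruct Dy as [r [Hr [Hry Rr]]].
  assert (FRe : forall (P : R -> Prop), locally x P -> @locally CU z (fun u => P (Re u))).
  { intros P [d Hd]. exists d. intros u Hu. apply Hd.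
    eapply Rle_lt_trans; [apply (re_le_Cmod (u - z))|exact Hu]. }
  assert (FIm : forall (P : R -> Prop), locally y P -> @locally CU z (fun u => P (Im u))).
  { intros P [d Hd]. exists d. intros u Hu. apply Hd.
    eapply Rle_lt_trans; [apply (im_le_Cmod (u - z))|exact Hu]. }
  assert (L1 : Clim (@locally CU z) (fun u => q (Re u) * (cos (Im u) + Ci * sin (Im u))) (Cexp z)).
  { rewrite (E z). apply Clim_mult; [tc| |].
    - intros e0 He0. apply (FRe _ (Hq e0 He0)).
    - assert (K : rcont (fun s => RtoC (cos s) + Ci * RtoC (sin s)) y).
      { apply (rder_cont _ _ (- sin y + Ci * cos y)). exists r. auto. }
      intros e0 He0. apply (FIm _ (K e0 He0)). }
  assert (L2 : Clim (@locally CU z) (fun u => exp x * r (Im u)) (Ci * Cexp z)).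
  { rewrite (E z). replace (Ci * (exp (Re z) * (cos (Im z) + Ci * sin (Im z))))
      with (exp x * (- sin y + Ci * cos y)).
    - apply Clim_mult; [tc|apply Clim_const; tc|].
      intros e0 He0. apply (FIm _ (Hr e0 He0)).
    - fold x y. unfold Ci, Cmult, Cplus, RtoC, Copp; simpl. f_equal; ring. }
  assert (He2 : (0 < eps/2)%R) by lra. generalize (filter_and _ _ (L1 _ He2) (L2 _ He2)).
  apply filter_imp. intros u [H1 H2].
  assert (Eu : u - z = RtoC (Re u - x) + Ci * RtoC (Im u - y)).
  { unfold x, y. rewrite (C_eta u) at 1. rewrite (C_eta z) at 1. rewrite !RtoC_minus. ring. }
  (* The increment is a real step at height Im u followed by an imaginary step at abscissa x. By
     [L1] and [L2] the two quotients tend to [Cexp z] and [Ci * Cexp z]. *)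
  replace (Cexp u - Cexp z - (u - z) * Cexp z) with
    (RtoC (Re u - x) * (q (Re u) * (cos (Im u) + Ci * sin (Im u)) - Cexp z) +
     RtoC (Im u - y) * (exp x * r (Im u) - Ci * Cexp z)).
  2:{ rewrite Eu, !RtoC_minus. rewrite (E u) , (Q (Re u)).
      transitivity ((exp x + (Re u - x) * q (Re u)) * (cos (Im u) + Ci * sin (Im u)) - Cexp z
         - (Re u - x + Ci * (Im u - y)) * Cexp z); [|ring].
      assert (Ez : Cexp z = exp x * (cos y + Ci * sin y)) by apply E.
      set (w := Cexp z) at 1 2 4. rewrite Ez.
      transitivity ((Re u - x) * (q (Re u) * (cos (Im u) + Ci * sin (Im u)))
        + exp x * ((cos y + Ci * sin y) + (Im u - y) * r (Im u)) - exp x * (cos y + Ci * sin y)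
         - (Re u - x + Ci * (Im u - y)) * w); [ring|]. rewrite <- Rr. ring. }
  eapply Rle_trans; [apply Cmod_triangle|]. rewrite !Cmod_mult, !Cmod_R.
  assert (A1 : (Rabs (Re u - x) <= Cmod (u - z))%R) by apply (re_le_Cmod (u - z)).
  assert (A2 : (Rabs (Im u - y) <= Cmod (u - z))%R) by apply (im_le_Cmod (u - z)).
  assert (P1 := Rabs_pos (Re u - x)). assert (P2 := Rabs_pos (Im u - y)).
  assert (Q1 := Cmod_ge_0 (q (Re u) * (cos (Im u) + Ci * sin (Im u)) - Cexp z)).
  assert (Q2 := Cmod_ge_0 (exp x * r (Im u) - Ci * Cexp z)).
  nra.
Qed.

Lemma Cexp_plus (a b : C) : Cexp (a + b) = Cexp a * Cexp b.
Proof.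
  unfold Cexp, Cmult, Re, Im. simpl. rewrite exp_plus, cos_plus, sin_plus. f_equal; ring.
Qed.

Lemma Cexp_0 : Cexp 0 = 1.
Proof. unfold Cexp, RtoC. simpl. rewrite exp_0, cos_0, sin_0. f_equal; ring. Qed.

Lemma Cexp_nz (a : C) : Cexp a <> 0.
Proof.
  intros H. assert (K := Cexp_plus a (- a)). rewrite H in K.
  replace (a + - a) with (RtoC 0) in K by ring. rewrite Cexp_0, Cmult_0_l in K.
  now apply C1_nz.
Qed.

Lemma Cmod_Cexp (a : C) : Cmod (Cexp a) = exp (Re a).
Proof.
  unfold Cexp, Cmod. simpl.
  replace (exp (Re a) * cos (Im a) * (exp (Re a) * cos (Im a) * 1) +
    exp (Re a) * sin (Im a) * (exp (Re a) * sin (Im a) * 1))%R with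
    (exp (Re a) ^ 2 * (Rsqr (sin (Im a)) + Rsqr (cos (Im a))))%R by (unfold Rsqr; ring).
  rewrite sin2_cos2, Rmult_1_r. rewrite sqrt_pow2; [reflexivity|].
  left. apply exp_pos.
Qed.

Lemma rder_linear (a b : C) (t : R) : rder (fun s => a + s * b) t b.
Proof.
  exists (fun _ => b). repeat split; [apply Clim_const; tc|]. intros s. ring.
Qed.

Lemma rder_Re (f : R -> C) (x : R) (l : C) : rder f x l ->
  is_derive (fun t => Re (f t)) x (Re l) /\ is_derive (fun t => Im (f t)) x (Im l).
Proof.
  intros [q [Hq [Hl H]]].
  assert (K : forall eps : posreal, locally x (fun s =>
    (Cmod (f s - f x - (s - x) * l) <= eps * Rabs (s - x))%R)).
  { intros eps. generalize (Hq eps (cond_pos eps)). apply filter_imp. intros s Hs.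
    rewrite (H s). replace (f x + (s - x) * q s - f x - (s - x) * l) with ((q s - l) * (s - x)%R)
      by (rewrite RtoC_minus; ring).
    rewrite Cmod_mult, Cmod_R. apply Rmult_le_compat_r; [apply Rabs_pos|lra]. }
  split; (split; [apply is_linear_scal_l|]); intros x' Hx';
  assert (x' = x) as -> by (symmetry; apply (is_filter_lim_locally_unique x x' Hx'));
  intros eps; generalize (K eps); apply filter_imp; intros s Hs;
  (eapply Rle_trans; [|exact Hs]).
  - eapply Rle_trans; [|apply re_le_Cmod]. apply Req_le.
    change (Rabs (Re (f s) - Re (f x) - (s - x) * Re l) =
      Rabs (Re (f s - f x - (s - x) * l)))%R. f_equal.
    rewrite <- RtoC_minus. unfold Cminus, Cplus, Copp, Cmult, RtoC. simpl. unfold Re. ring.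
  - eapply Rle_trans; [|apply im_le_Cmod]. apply Req_le.
    change (Rabs (Im (f s) - Im (f x) - (s - x) * Im l) =
      Rabs (Im (f s - f x - (s - x) * l)))%R. f_equal.
    rewrite <- RtoC_minus. unfold Cminus, Cplus, Copp, Cmult, RtoC. simpl. unfold Im. ring.
Qed.

(** * Path integrals and Goursat's theorem on rectangles *)

Definition is_CI (f : R -> C) (a b : R) (l : C) : Prop :=
  is_RInt (fun t => Re (f t)) a b (Re l) /\ is_RInt (fun t => Im (f t)) a b (Im l).

Definition CI (f : R -> C) (a b : R) : C :=
  (RInt (fun t => Re (f t)) a b, RInt (fun t => Im (f t)) a b).

Definition rcont_on (f : R -> C) (a b : R) : Prop :=
  forall x, (a <= x <= b)%R -> rcont f x.

Lemma is_CI_unique (f : R -> C) (a b : R) (l : C) : is_CI f a b l -> CI f a b = l.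
Proof.
  intros [H1 H2]. unfold CI. apply injective_projections; simpl; now apply is_RInt_unique.
Qed.

Lemma CI_correct (f : R -> C) (a b : R) : (a <= b)%R -> rcont_on f a b ->
  is_CI f a b (CI f a b).
Proof.
  intros Hab H. split; simpl; apply (RInt_correct (V:=R_CompleteNormedModule));
    apply ex_RInt_continuous; rewrite Rmin_left, Rmax_right by lra;
    intros x Hx; destruct (Clim_ReIm _ _ _ (H x Hx)) as [H1 H2]; assumption.
Qed.

Lemma is_CI_plus (f g : R -> C) (a b : R) (l m : C) :
  is_CI f a b l -> is_CI g a b m -> is_CI (fun t => f t + g t) a b (l + m).
Proof.
  intros [H1 H2] [K1 K2]. split.
  - exact (is_RInt_plus _ _ _ _ _ _ H1 K1).
  - exact (is_RInt_plus _ _ _ _ _ _ H2 K2).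
Qed.

Lemma is_CI_scal (k : C) (f : R -> C) (a b : R) (l : C) :
  is_CI f a b l -> is_CI (fun t => k * f t) a b (k * l).
Proof.
  intros [H1 H2]. split.
  - exact (is_RInt_minus _ _ _ _ _ _ (is_RInt_scal _ _ _ (Re k) _ H1) (is_RInt_scal _ _ _ (Im k) _ H2)).
  - exact (is_RInt_plus _ _ _ _ _ _ (is_RInt_scal _ _ _ (Re k) _ H2) (is_RInt_scal _ _ _ (Im k) _ H1)).
Qed.

Lemma is_CI_opp (f : R -> C) (a b : R) (l : C) :
  is_CI f a b l -> is_CI (fun t => - f t) a b (- l).
Proof.
  intros [H1 H2]. split.
  - exact (is_RInt_opp _ _ _ _ H1).
  - exact (is_RInt_opp _ _ _ _ H2).
Qed.

Lemma is_CI_minus (f g : R -> C) (a b : R) (l m : C) :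
  is_CI f a b l -> is_CI g a b m -> is_CI (fun t => f t - g t) a b (l - m).
Proof. intros H K. apply is_CI_plus; auto. now apply is_CI_opp. Qed.

Lemma is_CI_const (c : C) (a b : R) : is_CI (fun _ => c) a b ((b - a)%R * c).
Proof.
  split.
  - rewrite re_scal_l. apply (is_RInt_const (V:=R_NormedModule)).
  - rewrite im_scal_l. apply (is_RInt_const (V:=R_NormedModule)).
Qed.

Lemma is_CI_ext (f g : R -> C) (a b : R) (l : C) : (a <= b)%R ->
  (forall t, (a <= t <= b)%R -> f t = g t) -> is_CI f a b l -> is_CI g a b l.
Proof.
  intros Hab E [H1 H2].
  split; [apply (is_RInt_ext (fun t => Re (f t)))|apply (is_RInt_ext (fun t => Im (f t)))];
    auto; rewrite Rmin_left, Rmax_right by lra; intros x Hx; rewrite E; auto; lra.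
Qed.

Lemma is_CI_Chasles (f : R -> C) (a b c : R) (l m : C) :
  is_CI f a b l -> is_CI f b c m -> is_CI f a c (l + m).
Proof.
  intros [H1 H2] [K1 K2]. split.
  - exact (is_RInt_Chasles _ _ _ _ _ _ H1 K1).
  - exact (is_RInt_Chasles _ _ _ _ _ _ H2 K2).
Qed.

(** The norm of the product module R x R is the modulus, so the vector-valued estimate has constant
    1; bounding real and imaginary parts separately would lose a factor, which [min_modulus_center]
    cannot afford. *)
Lemma is_CI_le (f : R -> C) (a b M : R) (l : C) : (a <= b)%R ->
  (forall t, (a <= t <= b)%R -> (Cmod (f t) <= M)%R) -> is_CI f a b l ->
  (Cmod l <= (b - a) * M)%R.
Proof.
  intros Hab HM [H1 H2]. rewrite Cmod_norm.
  apply (norm_RInt_le_const (V:=prod_NormedModule R_AbsRing R_NormedModule R_NormedModule) f); auto.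
  - intros x Hx. rewrite <- Cmod_norm. auto.
  - destruct l as [l1 l2].
    apply (is_RInt_fct_extend_pair (U:=R_NormedModule) (V:=R_NormedModule)); assumption.
Qed.

Lemma is_CI_derive (f df : R -> C) (a b : R) : (a <= b)%R ->
  (forall x, (a <= x <= b)%R -> rder f x (df x)) -> rcont_on df a b ->
  is_CI df a b (f b - f a).
Proof.
  intros Hab D Cd.
  split; apply (is_RInt_derive (V:=R_CompleteNormedModule)
     (fun t => _ (f t)) (fun t => _ (df t)));
    rewrite Rmin_left, Rmax_right by lra; intros x Hx;
    try (destruct (rder_Re _ _ _ (D x Hx)) as [H1 H2]; assumption);
    destruct (Clim_ReIm _ _ _ (Cd x Hx)) as [H1 H2]; assumption.
Qed.

(** * Repeated bisection of a rectangle *)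

Section Bisection.
Variable Phi : R -> R -> R -> R -> R.
Variables a0 b0 c0 d0 : R.
Hypothesis Hab : (a0 < b0)%R.
Hypothesis Hcd : (c0 < d0)%R.
Hypothesis split_x : forall a m b c d,
  (a0 <= a)%R -> (a < m < b)%R -> (b <= b0)%R -> (c0 <= c < d)%R -> (d <= d0)%R ->
  (Phi a b c d <= Phi a m c d + Phi m b c d)%R.
Hypothesis split_y : forall a b c m d,
  (a0 <= a < b)%R -> (b <= b0)%R -> (c0 <= c)%R -> (c < m < d)%R -> (d <= d0)%R ->
  (Phi a b c d <= Phi a b c m + Phi a b m d)%R.
Hypothesis local_small : forall x y eps, (a0 <= x <= b0)%R -> (c0 <= y <= d0)%R -> (0 < eps)%R ->
  exists delta, (0 < delta)%R /\ forall a b c d,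
    (a0 <= a < b)%R -> (b <= b0)%R -> (c0 <= c < d)%R -> (d <= d0)%R ->
    (a <= x <= b)%R -> (c <= y <= d)%R -> ((b - a) + (d - c) < delta)%R ->
    (Phi a b c d <= eps * ((b - a) + (d - c)) ^ 2)%R.

(** The half that is kept carries at least half of [Phi]: if the first half does not, subadditivity
    forces the second one to. *)
Definition halve_x (r : (R * R) * (R * R)) : (R * R) * (R * R) :=
  let '((a, b), (c, d)) := r in
  if Rle_dec (Phi a b c d / 2) (Phi a ((a + b) / 2) c d)
  then ((a, ((a + b) / 2)%R), (c, d)) else ((((a + b) / 2)%R, b), (c, d)).

Definition halve_y (r : (R * R) * (R * R)) : (R * R) * (R * R) :=
  let '((a, b), (c, d)) := r in
  if Rle_dec (Phi a b c d / 2) (Phi a b c ((c + d) / 2))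
  then ((a, b), (c, ((c + d) / 2)%R)) else ((a, b), (((c + d) / 2)%R, d)).

Fixpoint boxes (n : nat) : (R * R) * (R * R) :=
  match n with
  | O => ((a0, b0), (c0, d0))
  | S n => halve_y (halve_x (boxes n))
  end.

Let bA n := fst (fst (boxes n)).
Let bB n := snd (fst (boxes n)).
Let bC n := fst (snd (boxes n)).
Let bD n := snd (snd (boxes n)).

Lemma boxes_step (n : nat) :
  (a0 <= bA n < bB n)%R -> (bB n <= b0)%R -> (c0 <= bC n < bD n)%R -> (bD n <= d0)%R ->
  (bA n <= bA (S n) < bB (S n))%R /\ (bB (S n) <= bB n)%R /\
  (bC n <= bC (S n) < bD (S n))%R /\ (bD (S n) <= bD n)%R /\
  (bB (S n) - bA (S n) = (bB n - bA n) / 2)%R /\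
  (bD (S n) - bC (S n) = (bD n - bC n) / 2)%R /\
  (Phi (bA n) (bB n) (bC n) (bD n) / 4 <=
     Phi (bA (S n)) (bB (S n)) (bC (S n)) (bD (S n)))%R.
Proof.
  unfold bA, bB, bC, bD. simpl. destruct (boxes n) as [[a b] [c d]]. simpl.
  intros H1 H2 H3 H4.
  assert (Sx : (Phi a b c d <= Phi a ((a + b) / 2) c d + Phi ((a + b) / 2) b c d)%R)
    by (apply split_x; lra).
  destruct (Rle_dec (Phi a b c d / 2) (Phi a ((a + b) / 2) c d)) as [L|L]; simpl.
  - assert (Sy : forall u v, (a0 <= u < v)%R -> (v <= b0)%R ->
       (Phi u v c d <= Phi u v c ((c + d) / 2) + Phi u v ((c + d) / 2) d)%R)
      by (intros u v Hu Hv; apply split_y; lra).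
    specialize (Sy a ((a + b) / 2)%R ltac:(lra) ltac:(lra)).
    destruct (Rle_dec _ _) as [L'|L']; simpl; repeat split; lra.
  - assert (Sy : forall u v, (a0 <= u < v)%R -> (v <= b0)%R ->
       (Phi u v c d <= Phi u v c ((c + d) / 2) + Phi u v ((c + d) / 2) d)%R)
      by (intros u v Hu Hv; apply split_y; lra).
    specialize (Sy ((a + b) / 2)%R b ltac:(lra) ltac:(lra)).
    destruct (Rle_dec _ _) as [L'|L']; simpl; repeat split; lra.
Qed.

Lemma boxes_inv (n : nat) :
  (a0 <= bA n < bB n)%R /\ (bB n <= b0)%R /\ (c0 <= bC n < bD n)%R /\ (bD n <= d0)%R /\
  (bB n - bA n = (b0 - a0) / 2 ^ n)%R /\ (bD n - bC n = (d0 - c0) / 2 ^ n)%R /\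
  (Phi a0 b0 c0 d0 / 4 ^ n <= Phi (bA n) (bB n) (bC n) (bD n))%R.
Proof.
  induction n as [|n [I1 [I2 [I3 [I4 [I5 [I6 I7]]]]]]].
  - unfold bA, bB, bC, bD; simpl. repeat split; try lra.
  - destruct (boxes_step n I1 I2 I3 I4) as [J1 [J2 [J3 [J4 [J5 [J6 J7]]]]]].
    assert (P2 : (0 < 2 ^ n)%R) by (apply pow_lt; lra).
    assert (P4 : (0 < 4 ^ n)%R) by (apply pow_lt; lra).
    repeat split; try lra.
    + rewrite J5, I5. simpl. field. lra.
    + rewrite J6, I6. simpl. field. lra.
    + eapply Rle_trans; [|exact J7].
      replace (Phi a0 b0 c0 d0 / 4 ^ S n)%R with (Phi a0 b0 c0 d0 / 4 ^ n / 4)%R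
        by (simpl; field; lra). lra.
Qed.

Lemma nested_limit (u v : nat -> R) :
  (forall n, u n <= u (S n))%R -> (forall n, v (S n) <= v n)%R -> (forall n, u n <= v n)%R ->
  exists x, forall n, (u n <= x <= v n)%R.
Proof.
  intros Hu Hv Huv.
  assert (Mu : forall n k, (u n <= u (k + n)%nat)%R).
  { intros n k. induction k as [|k IH]; simpl; [lra|]. eapply Rle_trans; [exact IH|apply Hu]. }
  assert (Mv : forall n k, (v (k + n)%nat <= v n)%R).
  { intros n k. induction k as [|k IH]; simpl; [lra|]. eapply Rle_trans; [apply Hv|exact IH]. }
  assert (Bd : forall n m, (u n <= v m)%R).
  { intros n m. eapply Rle_trans; [apply (Mu n m)|]. eapply Rle_trans; [apply Huv|].
    rewrite Nat.add_comm. apply Mv. }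
  destruct (completeness (fun r => exists n, r = u n)) as [x [Hx1 Hx2]].
  - exists (v O). intros r [n ->]. apply Bd.
  - exists (u O). now exists O.
  - exists x. intros n. split.
    + apply Hx1. now exists n.
    + apply Hx2. intros r [m ->]. apply Bd.
Qed.

(** A positive value v would leave at least v / 4^n on the n-th box, whose half perimeter is L /
    2^n. At the common point of the boxes, [local_small] bounds the same quantity by eps (L /
    2^n)^2. *)
Lemma bisection : (Phi a0 b0 c0 d0 <= 0)%R.
Proof.
  destruct (Rle_or_lt (Phi a0 b0 c0 d0) 0) as [|Hv]; [assumption|exfalso].
  assert (St : forall n, _) by (intros n; destruct (boxes_inv n) as [I1 [I2 [I3 [I4 _]]]];
    exact (boxes_step n I1 I2 I3 I4)).
  destruct (nested_limit bA bB) as [x Hx].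
  { intros n. destruct (St n); lra. } { intros n. destruct (St n) as [_ [? _]]; lra. }
  { intros n. destruct (boxes_inv n); lra. }
  destruct (nested_limit bC bD) as [y Hy].
  { intros n. destruct (St n) as [_ [_ [? _]]]; lra. }
  { intros n. destruct (St n) as [_ [_ [_ [? _]]]]; lra. }
  { intros n. destruct (boxes_inv n) as [_ [_ [? _]]]; lra. }
  set (v := Phi a0 b0 c0 d0) in *. set (L := ((b0 - a0) + (d0 - c0))%R).
  assert (HL : (0 < L)%R) by (unfold L; lra).
  (* With this eps the local bound is v / (2 * 4^n), half of what the box must carry. *)
  assert (Heps : (0 < v / (2 * L ^ 2))%R).
  { apply Rdiv_lt_0_compat; [lra|]. simpl. nra. }
  destruct (local_small x y _ (Hx O) (Hy O) Heps) as [delta [Hd H]].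
  assert (Hhalf : (Rabs (/ 2) < 1)%R) by (rewrite Rabs_pos_eq; lra).
  assert (HdL : (0 < delta / L)%R) by (apply Rdiv_lt_0_compat; lra).
  destruct (pow_lt_1_zero (/ 2) Hhalf (delta / L) HdL) as [N HN].
  specialize (HN N (Nat.le_refl N)).
  destruct (boxes_inv N) as [I1 [I2 [I3 [I4 [I5 [I6 I7]]]]]].
  assert (P2 : (0 < 2 ^ N)%R) by (apply pow_lt; lra).
  assert (EL : ((bB N - bA N) + (bD N - bC N) = L / 2 ^ N)%R).
  { rewrite I5, I6. unfold L. field. lra. }
  specialize (H _ _ _ _ I1 I2 I3 I4 (Hx N) (Hy N)).
  rewrite EL in H. rewrite Rabs_pos_eq in HN by (left; apply pow_lt; lra).
  rewrite pow_inv in HN. fold v in I7.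
  assert (K : (L / 2 ^ N < delta)%R).
  { replace delta with (L * (delta / L))%R by (field; lra). unfold Rdiv at 1.
    apply Rmult_lt_compat_l; lra. }
  specialize (H K).
  replace (4 ^ N)%R with ((2 ^ N) ^ 2)%R in I7
    by (rewrite <- pow_mult, Nat.mul_comm, pow_mult; f_equal; lra).
  replace (v / (2 * L ^ 2) * (L / 2 ^ N) ^ 2)%R with (v / (2 ^ N) ^ 2 / 2)%R in H
    by (field; split; lra).
  assert (Pv : (0 < v / (2 ^ N) ^ 2)%R).
  { apply Rdiv_lt_0_compat; [lra|]. apply pow_lt; lra. }
  lra.
Qed.

End Bisection.

(** The integral of H dz along the counterclockwise boundary of [a, b] x [c, d]; dz = i dy on the
    vertical sides. *)
Definition rectI (H : C -> C) (a b c d : R) : C :=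
  CI (fun x => H (x, c)) a b - CI (fun x => H (x, d)) a b +
  Ci * (CI (fun y => H (b, y)) c d - CI (fun y => H (a, y)) c d).

Lemma pair_C (x y : R) : (x, y) = (0%R, y) + RtoC x * 1.
Proof. unfold Cplus, Cmult, RtoC. simpl. f_equal; ring. Qed.

Lemma pair_C' (x y : R) : (x, y) = (x, 0%R) + RtoC y * Ci.
Proof. unfold Cplus, Cmult, RtoC, Ci. simpl. f_equal; ring. Qed.

Lemma rder_hor (x y : R) : rder (fun t => (t, y)) x 1.
Proof.
  apply (@der_ext R_UniformSpace _ _ (fun t : R => (0%R, y) + t * 1)); [intros; now rewrite <- pair_C|].
  apply rder_linear.
Qed.

Lemma rder_ver (x y : R) : rder (fun t => (x, t)) y Ci.
Proof.
  apply (@der_ext R_UniformSpace _ _ (fun t : R => (x, 0%R) + t * Ci)); [intros; now rewrite <- pair_C'|].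
  apply rder_linear.
Qed.

Lemma rcont_hor (H : C -> C) (x y : R) : ccont H (x, y) -> rcont (fun t => H (t, y)) x.
Proof.
  intros K. apply (rcont_comp (fun t => (t, y)) H x); [|exact K].
  apply (rder_cont _ _ 1). apply rder_hor.
Qed.

Lemma rcont_ver (H : C -> C) (x y : R) : ccont H (x, y) -> rcont (fun t => H (x, t)) y.
Proof.
  intros K. apply (rcont_comp (fun t => (x, t)) H y); [|exact K].
  apply (rder_cont _ _ Ci). apply rder_ver.
Qed.

Definition ccont_rect (H : C -> C) (a b c d : R) : Prop :=
  forall x y, (a <= x <= b)%R -> (c <= y <= d)%R -> ccont H (x, y).

Lemma rectI_sides (H : C -> C) (a b c d : R) : (a <= b)%R -> (c <= d)%R -> ccont_rect H a b c d ->
  is_CI (fun x => H (x, c)) a b (CI (fun x => H (x, c)) a b) /\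
  is_CI (fun x => H (x, d)) a b (CI (fun x => H (x, d)) a b) /\
  is_CI (fun y => H (b, y)) c d (CI (fun y => H (b, y)) c d) /\
  is_CI (fun y => H (a, y)) c d (CI (fun y => H (a, y)) c d).
Proof.
  intros Hab Hcd K. split; [|split; [|split]]; apply CI_correct; auto; intros t Ht;
    (apply rcont_hor || apply rcont_ver); apply K; lra.
Qed.

Lemma rectI_plus (G H : C -> C) (a b c d : R) : (a <= b)%R -> (c <= d)%R ->
  ccont_rect G a b c d -> ccont_rect H a b c d ->
  rectI (fun z => G z + H z) a b c d = rectI G a b c d + rectI H a b c d.
Proof.
  intros Hab Hcd KG KH.
  destruct (rectI_sides G a b c d Hab Hcd KG) as [G1 [G2 [G3 G4]]].
  destruct (rectI_sides H a b c d Hab Hcd KH) as [H1 [H2 [H3 H4]]].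
  unfold rectI.
  rewrite (is_CI_unique _ _ _ _ (is_CI_plus _ _ _ _ _ _ G1 H1)).
  rewrite (is_CI_unique _ _ _ _ (is_CI_plus _ _ _ _ _ _ G2 H2)).
  rewrite (is_CI_unique _ _ _ _ (is_CI_plus _ _ _ _ _ _ G3 H3)).
  rewrite (is_CI_unique _ _ _ _ (is_CI_plus _ _ _ _ _ _ G4 H4)). ring.
Qed.

Lemma rectI_primitive (P H : C -> C) (a b c d : R) : (a <= b)%R -> (c <= d)%R ->
  (forall z, cder P z (H z)) -> (forall z, ccont H z) -> rectI H a b c d = 0.
Proof.
  intros Hab Hcd D Cd.
  assert (Hh : forall y, is_CI (fun x => H (x, y)) a b (P (b, y) - P (a, y))).
  { intros y. apply (is_CI_derive (fun x => P (x, y))); auto.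
    - intros x _. eapply der_eq; [apply rder_comp; [apply D|apply rder_hor]|]. ring.
    - intros x _. now apply rcont_hor. }
  assert (Hv : forall x, is_CI (fun y => Ci * H (x, y)) c d (P (x, d) - P (x, c))).
  { intros x. apply (is_CI_derive (fun y => P (x, y))); auto.
    - intros y _. eapply der_eq; [apply rder_comp; [apply D|apply rder_ver]|]. ring.
    - intros y _. apply Clim_mult; [tc|apply Clim_const; tc|]. now apply rcont_ver. }
  assert (Hv' : forall x, Ci * CI (fun y => H (x, y)) c d = P (x, d) - P (x, c)).
  { intros x. rewrite <- (is_CI_unique _ _ _ _ (Hv x)). symmetry. apply is_CI_unique.
    apply is_CI_scal. apply CI_correct; auto. intros y _. now apply rcont_ver. }
  unfold rectI. rewrite !(is_CI_unique _ _ _ _ (Hh _)).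
  transitivity (P (b, c) - P (a, c) - (P (b, d) - P (a, d)) +
    (Ci * CI (fun y => H (b, y)) c d - Ci * CI (fun y => H (a, y)) c d)); [ring|].
  rewrite !Hv'. ring.
Qed.

Lemma rectI_le (H : C -> C) (a b c d M : R) : (a <= b)%R -> (c <= d)%R ->
  ccont_rect H a b c d ->
  (forall x y, (a <= x <= b)%R -> (c <= y <= d)%R -> (Cmod (H (x, y)) <= M)%R) ->
  (Cmod (rectI H a b c d) <= 2 * ((b - a) + (d - c)) * M)%R.
Proof.
  intros Hab Hcd K HM.
  destruct (rectI_sides H a b c d Hab Hcd K) as [H1 [H2 [H3 H4]]].
  assert (L1 : (Cmod (CI (fun x => H (x, c)) a b) <= (b - a) * M)%R).
  { apply (is_CI_le (fun x => H (x, c))); auto. intros; apply HM; lra. }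
  assert (L2 : (Cmod (CI (fun x => H (x, d)) a b) <= (b - a) * M)%R).
  { apply (is_CI_le (fun x => H (x, d))); auto. intros; apply HM; lra. }
  assert (L3 : (Cmod (CI (fun y => H (b, y)) c d) <= (d - c) * M)%R).
  { apply (is_CI_le (fun y => H (b, y))); auto. intros; apply HM; lra. }
  assert (L4 : (Cmod (CI (fun y => H (a, y)) c d) <= (d - c) * M)%R).
  { apply (is_CI_le (fun y => H (a, y))); auto. intros; apply HM; lra. }
  unfold rectI, Cminus. repeat (eapply Rle_trans; [apply Cmod_triangle|]).
  rewrite Cmod_mult, Cmod_Ci.
  eapply Rle_trans.
  { apply Rplus_le_compat; [apply Cmod_triangle|]. apply Rmult_le_compat_l; [lra|apply Cmod_triangle]. }
  rewrite !Cmod_opp. lra.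
Qed.

Lemma rectI_split_x (H : C -> C) (a m b c d : R) : (a <= m <= b)%R -> (c <= d)%R ->
  ccont_rect H a b c d -> rectI H a b c d = rectI H a m c d + rectI H m b c d.
Proof.
  intros Hm Hcd K.
  destruct (rectI_sides H a m c d) as [G1 [G2 [G3 G4]]]; try lra.
  { intros x y Hx Hy. apply K; lra. }
  destruct (rectI_sides H m b c d) as [H1 [H2 [H3 H4]]]; try lra.
  { intros x y Hx Hy. apply K; lra. }
  unfold rectI.
  rewrite (is_CI_unique _ _ _ _ (is_CI_Chasles _ _ _ _ _ _ G1 H1)).
  rewrite (is_CI_unique _ _ _ _ (is_CI_Chasles _ _ _ _ _ _ G2 H2)). ring.
Qed.

Lemma rectI_split_y (H : C -> C) (a b c m d : R) : (a <= b)%R -> (c <= m <= d)%R ->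
  ccont_rect H a b c d -> rectI H a b c d = rectI H a b c m + rectI H a b m d.
Proof.
  intros Hab Hm K.
  destruct (rectI_sides H a b c m) as [G1 [G2 [G3 G4]]]; try lra.
  { intros x y Hx Hy. apply K; lra. }
  destruct (rectI_sides H a b m d) as [H1 [H2 [H3 H4]]]; try lra.
  { intros x y Hx Hy. apply K; lra. }
  unfold rectI.
  rewrite (is_CI_unique _ _ _ _ (is_CI_Chasles _ _ _ _ _ _ G3 H3)).
  rewrite (is_CI_unique _ _ _ _ (is_CI_Chasles _ _ _ _ _ _ G4 H4)). ring.
Qed.

(** Near a point, H is an affine function [A] up to an error eps |z - z0|. The affine part has the
    primitive [P] and integrates to 0, so only the error counts, and it is quadratic in the size of
    the rectangle. *)
Lemma goursat (H : C -> C) (a b c d : R) : (a < b)%R -> (c < d)%R ->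
  (forall x y, (a <= x <= b)%R -> (c <= y <= d)%R -> exists l, cder H (x, y) l) ->
  rectI H a b c d = 0.
Proof.
  intros Hab Hcd D.
  assert (K : ccont_rect H a b c d).
  { intros x y Hx Hy. destruct (D x y Hx Hy) as [l Hl]. eapply cder_cont; eauto. }
  apply Cmod_eq_0. apply Rle_antisym; [|apply Cmod_ge_0].
  apply (bisection (fun a b c d => Cmod (rectI H a b c d)) a b c d); auto.
  - intros a' m b' c' d' H1 H2 H3 H4 H5. rewrite (rectI_split_x H a' m b'); try lra.
    + apply Cmod_triangle.
    + intros x y Hx Hy. apply K; lra.
  - intros a' b' c' m d' H1 H2 H3 H4 H5. rewrite (rectI_split_y H a' b' c' m d'); try lra.
    + apply Cmod_triangle.
    + intros x y Hx Hy. apply K; lra.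
  - intros x y eps Hx Hy He. destruct (D x y Hx Hy) as [l Hl].
    assert (He2 : (0 < eps / 2)%R) by lra.
    destruct (cder_lim H (x, y) l Hl _ He2) as [delta Hd].
    exists delta. split; [apply cond_pos|].
    intros a' b' c' d' H1 H2 H3 H4 H5 H6 H7.
    set (z0 := (x, y) : C) in *. set (A := fun z => H z0 + (z - z0) * l).
    set (P := fun z => z * H z0 + (z - z0) * (z - z0) * (l / 2)).
    assert (DA : forall z, cder A z l).
    { intros z. unfold A. eapply der_eq.
      - apply cder_plus; [apply cder_const|]. apply cder_mult; [|apply cder_const].
        apply cder_minus; [apply cder_id|apply cder_const].
      - cbv beta; ring. }
    assert (DP : forall z, cder P z (A z)).
    { intros z. unfold P, A. eapply der_eq.
      - apply cder_plus; [apply cder_mult; [apply cder_id|apply cder_const]|].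
        apply cder_mult; [|apply cder_const].
        apply cder_mult; (apply cder_minus; [apply cder_id|apply cder_const]).
      - cbv beta; field. }
    assert (KA : forall z, ccont A z) by (intros z; eapply cder_cont; apply DA).
    assert (KH : ccont_rect H a' b' c' d') by (intros u v Hu Hv; apply K; lra).
    assert (KE : ccont_rect (fun z => H z - A z) a' b' c' d').
    { intros u v Hu Hv. apply Clim_minus; [tc|apply KH; auto|apply KA]. }
    assert (E : rectI H a' b' c' d' = rectI (fun z => H z - A z) a' b' c' d').
    { transitivity (rectI (fun z => (H z - A z) + A z) a' b' c' d').
      - unfold rectI. f_equal; [f_equal|f_equal; f_equal]; unfold CI; f_equal; apply RInt_ext; intros; f_equal; ring.
      - rewrite rectI_plus; try lra; auto; [|intros u v _ _; apply KA].
        rewrite (rectI_primitive P A); auto; try lra. ring. }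
    rewrite E.
    eapply Rle_trans.
    (* The perimeter is twice (b' - a') + (d' - c'), which turns eps / 2 into the eps required by
       [bisection]. *)
    { apply (rectI_le _ a' b' c' d' (eps / 2 * ((b' - a') + (d' - c')))); try lra; auto.
      intros u v Hu Hv. unfold A.
      assert (Hz : (Cmod ((u, v) - z0) <= (b' - a') + (d' - c'))%R).
      { eapply Rle_trans; [apply Cmod_le_abs_parts|]. unfold z0. simpl.
        apply Rplus_le_compat; apply Rabs_le; lra. }
      replace (H (u, v) - (H z0 + ((u, v) - z0) * l)) with (H (u, v) - H z0 - ((u, v) - z0) * l) by ring.
      eapply Rle_trans; [apply Hd|].
      - eapply Rle_lt_trans; [exact Hz|exact H7].
      - apply Rmult_le_compat_l; lra. }
    simpl. apply Req_le. field.
Qed.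

(** * The mean value property and the Cauchy formula *)

Lemma RtoC_neq (a b : R) : (a <> b)%R -> RtoC a <> RtoC b.
Proof. intros H E. now apply H, RtoC_inj. Qed.

Definition cis (t : R) : C := (cos t, sin t).

Lemma Cexp_pair (x y : R) : Cexp (x, y) = RtoC (exp x) * cis y.
Proof. unfold Cexp, cis, Cmult, RtoC. simpl. f_equal; ring. Qed.

Lemma Cmod_cis (t : R) : Cmod (cis t) = 1%R.
Proof.
  assert (E : cis t = Cexp (0%R, t)) by (rewrite Cexp_pair, exp_0; ring).
  rewrite E, Cmod_Cexp. apply exp_0.
Qed.

Lemma cis_nz (t : R) : cis t <> 0.
Proof. apply Cmod_gt_0. rewrite Cmod_cis. lra. Qed.

Lemma rder_cis (t : R) : rder cis t (Ci * cis t).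
Proof.
  apply (@der_ext R_UniformSpace _ _ (fun s : R => Cexp (0%R, s))).
  { intros s. rewrite Cexp_pair, exp_0. ring. }
  eapply der_eq; [apply rder_comp; [apply cder_Cexp|apply rder_ver]|].
  rewrite Cexp_pair, exp_0. ring.
Qed.

Lemma rcont_cis (t : R) : rcont cis t.
Proof. eapply rder_cont. apply rder_cis. Qed.

Lemma rcont_const (c : C) (x : R) : rcont (fun _ => c) x.
Proof. apply Clim_const. tc. Qed.

Lemma rcont_plus (f g : R -> C) (x : R) : rcont f x -> rcont g x -> rcont (fun t => f t + g t) x.
Proof. apply Clim_plus. tc. Qed.

Lemma rcont_minus (f g : R -> C) (x : R) : rcont f x -> rcont g x -> rcont (fun t => f t - g t) x.
Proof. apply Clim_minus. tc. Qed.

Lemma rcont_mult (f g : R -> C) (x : R) : rcont f x -> rcont g x -> rcont (fun t => f t * g t) x.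
Proof. apply Clim_mult. tc. Qed.

Lemma rcont_inv (f : R -> C) (x : R) : f x <> 0 -> rcont f x -> rcont (fun t => / f t) x.
Proof. apply Clim_inv. tc. Qed.

Lemma rcont_Cmod (f : R -> C) (x : R) : rcont f x -> continuity_pt (fun t => Cmod (f t)) x.
Proof.
  intros H. apply continuity_pt_filterlim.
  apply (Clim_ReIm x (fun t => RtoC (Cmod (f t))) (RtoC (Cmod (f x)))).
  apply Clim_Cmod; [tc|exact H].
Qed.

Lemma rcont_circle (r t : R) : rcont (fun s => r * cis s) t.
Proof. apply rcont_mult; [apply rcont_const|apply rcont_cis]. Qed.

Lemma Cmod_circle (r t : R) : (0 <= r)%R -> Cmod (r * cis t) = r.
Proof. intros H. rewrite Cmod_mult, Cmod_cis, Cmod_R, Rabs_pos_eq; lra. Qed.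

Lemma rcont_bounded (f : R -> C) (a b : R) : (a <= b)%R -> rcont_on f a b ->
  exists B, (0 < B)%R /\ forall t, (a <= t <= b)%R -> (Cmod (f t) <= B)%R.
Proof.
  intros Hab Hf.
  destruct (continuity_ab_maj (fun t => Cmod (f t)) a b Hab) as [m [Hm _]].
  { intros c Hc. now apply rcont_Cmod, Hf. }
  exists (Cmod (f m) + 1)%R. assert (K := Cmod_ge_0 (f m)). split; [lra|].
  intros t Ht. specialize (Hm t Ht). simpl in Hm. lra.
Qed.

Lemma rcont_bounded_below (f : R -> C) (a b : R) : (a <= b)%R -> rcont_on f a b ->
  (forall t, (a <= t <= b)%R -> f t <> 0) ->
  exists m, (0 < m)%R /\ forall t, (a <= t <= b)%R -> (m <= Cmod (f t))%R.
Proof.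
  intros Hab Hf Nz.
  destruct (continuity_ab_min (fun t => Cmod (f t)) a b Hab) as [m [Hm Im]].
  { intros c Hc. now apply rcont_Cmod, Hf. }
  exists (Cmod (f m)). split; [apply Cmod_gt_0; now apply Nz|]. intros t Ht. now apply Hm.
Qed.

Lemma TwoPI_pos : (0 < 2 * PI)%R.
Proof. assert (H := PI_RGT_0). lra. Qed.

(** Continuity at the points of a circle becomes uniform in the angle by compactness of [0, 2 PI];
    this makes circle integrals continuous in the radius. *)
Lemma circle_uniform (h : C -> C) (r eps : R) : (0 <= r)%R ->
  (forall z, (Cmod z = r)%R -> ccont h z) -> (0 < eps)%R ->
  exists d, (0 < d)%R /\ forall s t, (Rabs (s - r) < d)%R -> (0 <= t <= 2 * PI)%R ->
    (Cmod (h (s * cis t)%C - h (r * cis t)%C) < eps)%R.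
Proof.
  intros Hr Hh He.
  assert (L : forall t, exists d : posreal, forall s u, (Rabs (s - r) < d)%R -> (Rabs (u - t) < d)%R ->
    (Cmod (h (s * cis u)%C - h (r * cis t)%C) < eps / 2)%R).
  { intros t. assert (He2 : (0 < eps / 2)%R) by lra.
    destruct (Hh (r * cis t) (Cmod_circle r t Hr) _ He2) as [d1 Hd1].
    assert (Hd2 : (0 < d1 / (2 * (r + 1)))%R).
    { apply Rdiv_lt_0_compat; [apply cond_pos|lra]. }
    destruct (rcont_cis t _ Hd2) as [d2 Hd2'].
    assert (Hd1' : (0 < d1 / 2)%R) by (assert (K := cond_pos d1); lra).
    exists (mkposreal _ (Rmin_pos _ _ Hd1' (cond_pos d2))). simpl. intros s u Hs Hu.
    apply Hd1. change (Cmod (s * cis u - r * cis t) < d1)%R.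
    replace (s * cis u - r * cis t) with ((s - r)%R * cis u + r * (cis u - cis t))
      by (rewrite RtoC_minus; ring).
    eapply Rle_lt_trans; [apply Cmod_triangle|].
    rewrite !Cmod_mult, Cmod_cis, !Cmod_R, (Rabs_pos_eq r) by lra.
    assert (B1 := Rlt_le_trans _ _ _ Hs (Rmin_l _ _)).
    assert (B2 := Hd2' u (Rlt_le_trans _ _ _ Hu (Rmin_r _ _))). simpl in B2.
    assert (B3 : (r * Cmod (cis u - cis t) <= (r + 1) * (d1 / (2 * (r + 1))))%R).
    { apply Rmult_le_compat; try lra. apply Cmod_ge_0. }
    replace ((r + 1) * (d1 / (2 * (r + 1))))%R with (d1 / 2)%R in B3 by (field; lra). lra. }
  set (delta t := proj1_sig (constructive_indefinite_description _ (L t))).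
  assert (Hdelta : forall t s u, (Rabs (s - r) < delta t)%R -> (Rabs (u - t) < delta t)%R ->
    (Cmod (h (s * cis u)%C - h (r * cis t)%C) < eps / 2)%R).
  { intros t. unfold delta. destruct (constructive_indefinite_description _ (L t)). auto. }
  destruct (compactness_value_1d 0 (2 * PI) delta) as [d Hd].
  exists d. split; [apply cond_pos|]. intros s u Hs Hu.
  (* [compactness_value_1d] provides the centre t only under a double negation. *)
  apply NNPP. intros N. apply (Hd u Hu). intros [t [_ [H1 H2]]]. apply N.
  assert (K1 := Hdelta t s u ltac:(lra) H1).
  assert (K2 : (Cmod (h (r * cis u)%C - h (r * cis t)%C) < eps / 2)%R).
  { apply Hdelta; auto. rewrite Rminus_eq_0, Rabs_R0. apply cond_pos. }
  replace (h (s * cis u) - h (r * cis u)) with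
    ((h (s * cis u) - h (r * cis t)) + - (h (r * cis u) - h (r * cis t))) by ring.
  eapply Rle_lt_trans; [apply Cmod_triangle|]. rewrite Cmod_opp. lra.
Qed.

(** Integration is against dt = dz / (i z), so this is 2 PI times the mean of h on the circle. *)
Definition circle_int (h : C -> C) (r : R) : C := CI (fun t => h (r * cis t)) 0 (2 * PI).

Lemma circle_int_correct (h : C -> C) (r : R) : (0 <= r)%R ->
  (forall z, (Cmod z = r)%R -> ccont h z) ->
  is_CI (fun t => h (r * cis t)) 0 (2 * PI) (circle_int h r).
Proof.
  intros Hr Hh. assert (P := TwoPI_pos). apply CI_correct; [lra|].
  intros t _. apply rcont_comp; [apply rcont_circle|]. apply Hh. now apply Cmod_circle.
Qed.

Lemma circle_int_cont (h : C -> C) (rho r eps : R) : (0 <= r <= rho)%R ->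
  (forall z, (Cmod z <= rho)%R -> ccont h z) -> (0 < eps)%R ->
  exists d, (0 < d)%R /\ forall s, (0 <= s <= rho)%R -> (Rabs (s - r) < d)%R ->
    (Cmod (circle_int h s - circle_int h r) < eps)%R.
Proof.
  intros Hr Hh He. assert (P := TwoPI_pos).
  assert (He' : (0 < eps / (2 * (2 * PI)))%R) by (apply Rdiv_lt_0_compat; lra).
  destruct (circle_uniform h r _ (proj1 Hr) ltac:(intros z Hz; apply Hh; lra) He') as [d [Hd H]].
  exists d. split; [exact Hd|]. intros s Hs Hsr.
  assert (I : is_CI (fun t => h (s * cis t) - h (r * cis t)) 0 (2 * PI) (circle_int h s - circle_int h r)).
  { apply is_CI_minus; apply circle_int_correct; try lra; intros z Hz; apply Hh; lra. }
  eapply Rle_lt_trans.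
  { apply (is_CI_le _ 0 (2 * PI) (eps / (2 * (2 * PI)))) in I; [exact I|lra|].
    intros t Ht. left. now apply H. }
  replace ((2 * PI - 0) * (eps / (2 * (2 * PI))))%R with (eps / 2)%R by (field; lra). lra.
Qed.

(** The exponential maps [ln r, ln s] x [0, 2 PI] onto the annulus. The horizontal sides cancel by
    periodicity, and the vertical ones are the two circle integrals. *)
Lemma circle_int_annulus (h : C -> C) (r s : R) : (0 < r < s)%R ->
  (forall z, (r <= Cmod z <= s)%R -> exists l, cder h z l) ->
  circle_int h r = circle_int h s.
Proof.
  intros Hrs D. assert (P := TwoPI_pos).
  assert (G : rectI (fun z => h (Cexp z)) (ln r) (ln s) 0 (2 * PI) = 0).
  { apply goursat; [apply ln_increasing; lra|lra|].
    intros x y [Hx1 Hx2] _. destruct (D (Cexp (x, y))) as [l Hl].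
    - rewrite Cmod_Cexp. simpl.
      rewrite <- (exp_ln r), <- (exp_ln s) by lra. split.
      + destruct Hx1 as [Hx1|Hx1]; [left; now apply exp_increasing|right; now rewrite Hx1].
      + destruct Hx2 as [Hx2|Hx2]; [left; now apply exp_increasing|right; now rewrite Hx2].
    - eexists. apply cder_comp; [exact Hl|apply cder_Cexp]. }
  unfold rectI in G.
  assert (E1 : forall r, (0 < r)%R -> CI (fun y => h (Cexp (ln r, y))) 0 (2 * PI) = circle_int h r).
  { intros u Hu. unfold circle_int, CI. f_equal; apply RInt_ext; intros; now rewrite Cexp_pair, exp_ln. }
  rewrite !E1 in G by lra.
  assert (E2 : CI (fun x => h (Cexp (x, 0%R))) (ln r) (ln s) = CI (fun x => h (Cexp (x, (2 * PI)%R))) (ln r) (ln s)).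
  { assert (E : forall x : R, Cexp (x, 0%R) = Cexp (x, (2 * PI)%R)).
    { intros x. rewrite !Cexp_pair. unfold cis. now rewrite cos_2PI, sin_2PI, cos_0, sin_0. }
    unfold CI. f_equal; apply RInt_ext; intros; now rewrite E. }
  rewrite E2 in G.
  replace (CI (fun x => h (Cexp (x, (2 * PI)%R))) (ln r) (ln s) - CI (fun x => h (Cexp (x, (2 * PI)%R))) (ln r) (ln s)
     + Ci * (circle_int h s - circle_int h r)) with (Ci * (circle_int h s - circle_int h r)) in G by ring.
  apply Cmult_integral in G. destruct G as [G|G]; [now apply Ci_nz in G|].
  symmetry. now apply Ceq_minus.
Qed.

Lemma Ceq_of_eps (a b : C) : (forall eps, (0 < eps)%R -> (Cmod (a - b) < eps)%R) -> a = b.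
Proof.
  intros H. apply Ceq_minus. apply Cmod_eq_0.
  destruct (Rle_lt_or_eq_dec _ _ (Cmod_ge_0 (a - b))) as [L|L]; [|now symmetry].
  specialize (H _ L). lra.
Qed.

(** Differentiability may fail on the circle of radius [r0]: continuity of the
    circle integral in its radius bridges it. *)
Lemma mean_value (h : C -> C) (rho r0 : R) : (0 < rho)%R -> (r0 < rho)%R ->
  (forall z, (Cmod z <= rho)%R -> ccont h z) ->
  (forall z, (0 < Cmod z <= rho)%R -> Cmod z <> r0 -> exists l, cder h z l) ->
  circle_int h rho = (2 * PI)%R * h 0.
Proof.
  intros Hrho Hr0 Hc D. assert (P := TwoPI_pos).
  assert (S1 : forall r, (0 < r <= rho)%R -> (r0 < r)%R -> circle_int h r = circle_int h rho).
  { intros r Hr Hr'. destruct (Rle_lt_or_eq_dec r rho (proj2 Hr)) as [L| ->]; [|reflexivity].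
    apply circle_int_annulus; [lra|]. intros z Hz. apply D; lra. }
  assert (S2 : forall r, (0 < r <= rho)%R -> circle_int h r = circle_int h rho).
  { intros r Hr. destruct (Rlt_or_le r0 r) as [L|L]; [now apply S1|].
    assert (S3 : circle_int h r0 = circle_int h rho).
    { apply Ceq_of_eps. intros eps He.
      destruct (circle_int_cont h rho r0 eps) as [d [Hd H]]; auto; [lra|].
      set (s := Rmin rho (r0 + d / 2)%R).
      assert (Hs : (r0 < s <= rho)%R).
      { unfold s. split; [apply Rmin_glb_lt; lra|apply Rmin_l]. }
      assert (Hs2 : (s <= r0 + d / 2)%R) by apply Rmin_r.
      rewrite <- (S1 s) by lra. rewrite Cmod_minus_sym. apply H; [lra|].
      rewrite Rabs_pos_eq; lra. }
    destruct L as [L| ->]; [|exact S3].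
    rewrite <- S3. apply Ceq_of_eps. intros eps He.
    destruct (circle_int_cont h rho r0 eps) as [d [Hd H]]; auto; [lra|].
    set (s := Rmax r (r0 - d / 2)%R).
    assert (Hs : (r <= s < r0)%R).
    { unfold s. split; [apply Rmax_l|apply Rmax_lub_lt; lra]. }
    assert (Hs2 : (r0 - d / 2 <= s)%R) by apply Rmax_r.
    replace (circle_int h r) with (circle_int h s).
    - apply H; [lra|]. rewrite Rabs_left1; lra.
    - destruct (Rle_lt_or_eq_dec r s (proj1 Hs)) as [L'|<-]; [|reflexivity].
      symmetry. apply circle_int_annulus; [lra|]. intros z Hz. apply D; lra. }
  (* At radius 0 the integrand is constant; continuity in the radius carries this value to all
     circles. *)
  assert (S0 : circle_int h 0 = (2 * PI)%R * h 0).
  { apply is_CI_unique. replace (2 * PI)%R with (2 * PI - 0)%R at 2 by ring.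
    eapply is_CI_ext; [lra| |apply is_CI_const]. intros t _. cbv beta. f_equal. ring. }
  rewrite <- S0. apply Ceq_of_eps. intros eps He.
  destruct (circle_int_cont h rho 0 eps) as [d [Hd H]]; auto; [lra|].
  set (s := Rmin rho (d / 2)%R).
  assert (Hs : (0 < s <= rho)%R).
  { unfold s. split; [apply Rmin_glb_lt; lra|apply Rmin_l]. }
  assert (Hs2 : (s <= d / 2)%R) by apply Rmin_r.
  rewrite <- (S2 s) by lra. apply H; [lra|]. rewrite Rabs_pos_eq; lra.
Qed.

Lemma is_CI_conj (f : R -> C) (a b : R) (l : C) :
  is_CI f a b l -> is_CI (fun t => Cconj (f t)) a b (Cconj l).
Proof.
  intros [H1 H2]. split; [exact H1|].
  exact (is_RInt_opp _ _ _ _ H2).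
Qed.

Lemma circle_minus_nz (rho t : R) (z : C) : (Cmod z < rho)%R -> rho * cis t - z <> 0.
Proof.
  intros Hz. assert (K := Cmod_ge_0 z). apply Cmod_gt_0.
  assert (H := Cmod_rev_triangle (rho * cis t) z). rewrite Cmod_circle in H by lra. lra.
Qed.

(** On the circle the kernel is the conjugate of u(x) = 1 / (1 - conj(z) x / rho^2), which is
    differentiable on the whole closed disc and equals 1 at 0, so the mean value property applies to
    u. *)
Lemma cauchy_kernel_int (rho : R) (z : C) : (Cmod z < rho)%R ->
  is_CI (fun t => rho * cis t / (rho * cis t - z)) 0 (2 * PI) (2 * PI)%R.
Proof.
  intros Hz. assert (K := Cmod_ge_0 z). assert (P := TwoPI_pos).
  set (u := fun x => / (1 - Cconj z * x / (rho * rho)%R)).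
  assert (Nr : RtoC rho <> 0) by (apply RtoC_neq; lra).
  assert (Nz : forall x, (Cmod x <= rho)%R -> 1 - Cconj z * x / (rho * rho)%R <> 0).
  { intros x Hx E. apply Ceq_minus in E. apply (f_equal Cmod) in E.
    rewrite Cmod_1, Cmod_div, Cmod_mult, Cmod_conj, Cmod_R, Rabs_pos_eq in E;
      [|nra|rewrite RtoC_mult; now apply Cmult_neq_0].
    assert (L : (Cmod z * Cmod x < rho * rho)%R) by (assert (K' := Cmod_ge_0 x); nra).
    apply (Rdiv_lt_1 _ (rho * rho)) in L; [lra|nra]. }
  assert (D : forall x, (Cmod x <= rho)%R -> exists l, cder u x l).
  { intros x Hx. eexists. unfold u. apply cder_inv; [now apply Nz|].
    apply cder_minus; [apply cder_const|]. apply cder_mult; [|apply cder_const].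
    apply cder_mult; [apply cder_const|apply cder_id]. }
  assert (M : circle_int u rho = (2 * PI)%R * u 0).
  { apply (mean_value u rho (-1)); try lra.
    - intros x Hx. destruct (D x Hx) as [l Hl]. eapply cder_cont; eauto.
    - intros x Hx _. apply D. lra. }
  assert (I : is_CI (fun t => u (rho * cis t)) 0 (2 * PI) (circle_int u rho)).
  { apply circle_int_correct; [lra|]. intros x Hx. destruct (D x) as [l Hl]; [lra|]. eapply cder_cont; eauto. }
  rewrite M in I. apply is_CI_conj in I.
  replace (Cconj ((2 * PI)%R * u 0)) with (RtoC (2 * PI)%R) in I.
  2:{ unfold u. replace (1 - Cconj z * 0 / (rho * rho)%R) with (RtoC 1).
      - unfold Cinv, Cconj, Cmult, RtoC; simpl. f_equal; field.
      - unfold Cdiv. ring. }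
  revert I. apply is_CI_ext; [lra|]. intros t _. unfold u.
  assert (Ec : Cconj (cis t) * cis t = 1).
  { unfold cis, Cconj, Cmult, RtoC. simpl. assert (S := sin2_cos2 t). unfold Rsqr in S. f_equal; lra. }
  rewrite Cinv_conj by (apply Nz; rewrite Cmod_circle; lra).
  unfold Cdiv. rewrite Cminus_conj, !Cmult_conj, Cconj_conj.
  assert (Rc : forall r : R, Cconj (RtoC r) = r) by (intros r; unfold Cconj, RtoC; simpl; f_equal; ring).
  rewrite Cinv_conj by (rewrite RtoC_mult; now apply Cmult_neq_0).
  rewrite !Rc, RtoC_mult.
  assert (N1 := circle_minus_nz rho t z Hz). assert (N2 := cis_nz t).
  assert (Ec' : Cconj (cis t) = / cis t).
  { apply (Cmult_reg_l (cis t)); auto. rewrite Cmult_comm, Ec. field. auto. }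
  rewrite Ec'. field. repeat split; auto.
Qed.

(** The integrand splits as x q(x) + g(z) x / (x - z), where q is the difference quotient of g at z.
    The first term vanishes at 0 and may fail to be differentiable only at z, hence on the circle
    through z that [mean_value] allows; the second is the kernel integral. *)
Lemma cauchy_formula (g : C -> C) (rho : R) (z : C) : (Cmod z < rho)%R ->
  (forall w, (Cmod w <= rho)%R -> exists l, cder g w l) ->
  is_CI (fun t => g (rho * cis t) * (rho * cis t) / (rho * cis t - z)) 0 (2 * PI)
    ((2 * PI)%R * g z).
Proof.
  intros Hz D. assert (K := Cmod_ge_0 z). assert (P := TwoPI_pos).
  destruct (D z) as [l [q [Hq [Hl H]]]]; [lra|].
  set (k := fun x => x * q x).
  assert (Dk : forall w, (Cmod w <= rho)%R -> w <> z -> exists l, cder k w l).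
  { intros w Hw Hwz. destruct (D w Hw) as [m Hm]. eexists.
    apply cder_mult; [apply cder_id|].
    apply (cder_ext_loc (fun x => (g x - g z) / (x - z))).
    - apply Cminus_eq_contra in Hwz.
      assert (L := Clim_neq0 (@locally CU w) (fun x => x - z) (w - z) Hwz).
      generalize (L (Clim_minus _ _ _ _ _ (Clim_id w) (Clim_const _ z))). apply filter_imp.
      intros x Hx. rewrite (H x).
      assert (x - z <> 0).
      { apply Cmod_gt_0. assert (K' := Cmod_ge_0 (w - z)). lra. }
      field. auto.
    - apply cder_div; [now apply Cminus_eq_contra| |].
      + apply cder_minus; [exact Hm|apply cder_const].
      + apply cder_minus; [apply cder_id|apply cder_const]. }
  assert (Ck : forall w, (Cmod w <= rho)%R -> ccont k w).
  { intros w Hw. destruct (Ceq_dec w z) as [-> |N].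
    - unfold k. apply Clim_mult; [tc|apply Clim_id|]. now rewrite Hl.
    - destruct (Dk w Hw N) as [m Hm]. eapply cder_cont; eauto. }
  assert (M : circle_int k rho = (2 * PI)%R * k 0).
  { apply (mean_value k rho (Cmod z)); auto; try lra.
    intros w Hw N. apply Dk; [lra|]. intros ->. now apply N. }
  assert (I : is_CI (fun t => k (rho * cis t)) 0 (2 * PI) 0).
  { replace (RtoC 0) with (circle_int k rho); [apply circle_int_correct; [lra|intros; apply Ck; lra]|].
    rewrite M. unfold k. ring. }
  assert (J := is_CI_plus _ _ _ _ _ _ I (is_CI_scal (g z) _ _ _ _ (cauchy_kernel_int rho z Hz))).
  replace (0 + g z * (2 * PI)%R) with ((2 * PI)%R * g z) in J by ring.
  revert J. apply is_CI_ext; [lra|]. intros t _.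
  assert (N := circle_minus_nz rho t z Hz). unfold k. rewrite (H (rho * cis t)). field. auto.
Qed.

(** A quadratic Taylor remainder that is uniform in t can be integrated, which avoids any limit
    theorem for integrals. *)
Lemma cder_under_integral (G : R -> C -> C) (G' : R -> C) (a b B d : R) (z0 : C) :
  (a <= b)%R -> (0 < d)%R ->
  (forall z, (Cmod (z - z0) < d)%R -> rcont_on (fun t => G t z) a b) -> rcont_on G' a b ->
  (forall t z, (a <= t <= b)%R -> (Cmod (z - z0) < d)%R ->
     (Cmod (G t z - G t z0 - (z - z0) * G' t) <= B * (Cmod (z - z0) * Cmod (z - z0)))%R) ->
  cder (fun z => CI (fun t => G t z) a b) z0 (CI G' a b).
Proof.
  intros Hab Hd CG CG' HB. apply cder_of_lim. intros eps He.
  set (B' := ((b - a) * Rabs B + 1)%R).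
  assert (HB' : (0 < B')%R).
  { unfold B'. assert (K := Rabs_pos B). assert (0 <= (b - a) * Rabs B)%R by (apply Rmult_le_pos; lra). lra. }
  assert (Hd' : (0 < Rmin d (eps / B'))%R) by (apply Rmin_pos; [lra|apply Rdiv_lt_0_compat; lra]).
  exists (mkposreal _ Hd'). intros z Hz. change (Cmod (z - z0) < Rmin d (eps / B'))%R in Hz.
  assert (Hz1 := Rlt_le_trans _ _ _ Hz (Rmin_l _ _)).
  assert (Hz2 := Rlt_le_trans _ _ _ Hz (Rmin_r _ _)).
  assert (Z0 : (Cmod (z0 - z0) < d)%R).
  { replace (z0 - z0) with (RtoC 0) by ring. rewrite Cmod_0. lra. }
  assert (I : is_CI (fun t => G t z - G t z0 - (z - z0) * G' t) a b
     (CI (fun t => G t z) a b - CI (fun t => G t z0) a b - (z - z0) * CI G' a b)).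
  { repeat apply is_CI_minus; [| |apply is_CI_scal]; apply CI_correct; auto. }
  apply (is_CI_le _ a b (Rabs B * (Cmod (z - z0) * Cmod (z - z0)))) in I; auto.
  - eapply Rle_trans; [exact I|].
    assert (K := Cmod_ge_0 (z - z0)).
    replace ((b - a) * (Rabs B * (Cmod (z - z0) * Cmod (z - z0))))%R with
      ((b - a) * Rabs B * Cmod (z - z0) * Cmod (z - z0))%R by ring.
    apply Rmult_le_compat_r; [exact K|].
    assert (L : (B' * Cmod (z - z0) <= B' * (eps / B'))%R) by (apply Rmult_le_compat_l; lra).
    replace (B' * (eps / B'))%R with eps in L by (field; lra). unfold B' in L. lra.
  - intros t Ht. eapply Rle_trans; [now apply HB|].
    apply Rmult_le_compat_r; [|apply Rle_abs].
    apply Rmult_le_pos; apply Cmod_ge_0.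
Qed.

(** A Cauchy-type integral. The density absorbs the factor rho * cis t coming from dz, and the
    factor 1 / (2 PI) is left out. *)
Definition cauchyT (phi : R -> C) (rho : R) (n : nat) (z : C) : C :=
  CI (fun t => phi t / (rho * cis t - z) ^ n) 0 (2 * PI).

Lemma rcont_pow (f : R -> C) (n : nat) (x : R) : rcont f x -> rcont (fun t => f t ^ n) x.
Proof.
  intros H. induction n as [|n IH]; simpl; [apply rcont_const|]. now apply rcont_mult.
Qed.

Lemma rcont_cauchy (phi : R -> C) (rho : R) (n : nat) (z : C) : (Cmod z < rho)%R ->
  rcont_on phi 0 (2 * PI) -> rcont_on (fun t => phi t / (rho * cis t - z) ^ n) 0 (2 * PI).
Proof.
  intros Hz Hphi t Ht. apply rcont_mult; [now apply Hphi|].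
  apply rcont_inv; [apply Cpow_nz; now apply circle_minus_nz|].
  apply rcont_pow. apply rcont_minus; [apply rcont_circle|apply rcont_const].
Qed.

Lemma circle_dist (rho t : R) (z : C) : (Cmod z < rho)%R ->
  (rho - Cmod z <= Cmod (rho * cis t - z))%R.
Proof.
  intros Hz. assert (K := Cmod_ge_0 z).
  assert (H := Cmod_rev_triangle (rho * cis t) z). rewrite Cmod_circle in H by lra. lra.
Qed.

Lemma kernel_taylor1 (x z z0 : C) (d : R) : (0 < d)%R -> (d <= Cmod (x - z))%R -> (d <= Cmod (x - z0))%R ->
  (Cmod (/ (x - z) - / (x - z0) - (z - z0) * / (x - z0) ^ 2)
    <= / d ^ 3 * (Cmod (z - z0) * Cmod (z - z0)))%R.
Proof.
  intros Hd H1 H2.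
  assert (N1 : x - z <> 0) by (apply Cmod_gt_0; lra).
  assert (N2 : x - z0 <> 0) by (apply Cmod_gt_0; lra).
  replace (/ (x - z) - / (x - z0) - (z - z0) * / (x - z0) ^ 2) with
    ((z - z0) * (z - z0) * / ((x - z) * (x - z0) ^ 2)) by (field; auto).
  rewrite Cmod_mult, Cmod_inv, !Cmod_mult, Cmod_pow
    by (apply Cmult_neq_0; [auto|now apply Cpow_nz]).
  rewrite Rmult_comm. apply Rmult_le_compat_r; [apply Rmult_le_pos; apply Cmod_ge_0|].
  apply Rinv_le_contravar; [now apply pow_lt|]. simpl.
  apply Rmult_le_compat; [lra| |lra|]; [nra|].
  apply Rmult_le_compat; lra.
Qed.

Lemma kernel_taylor2 (x z z0 : C) (d : R) : (0 < d)%R -> (d <= Cmod (x - z))%R -> (d <= Cmod (x - z0))%R ->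
  (Cmod x <= 1)%R -> (Cmod z <= 1)%R -> (Cmod z0 <= 1)%R ->
  (Cmod (/ (x - z) ^ 2 - / (x - z0) ^ 2 - (z - z0) * (2 * / (x - z0) ^ 3))
    <= 10 / d ^ 5 * (Cmod (z - z0) * Cmod (z - z0)))%R.
Proof.
  intros Hd H1 H2 B1 B2 B3.
  assert (N1 : x - z <> 0) by (apply Cmod_gt_0; lra).
  assert (N2 : x - z0 <> 0) by (apply Cmod_gt_0; lra).
  replace (/ (x - z) ^ 2 - / (x - z0) ^ 2 - (z - z0) * (2 * / (x - z0) ^ 3)) with
    ((3 * (x - z0) - 2 * (z - z0)) * ((z - z0) * (z - z0)) * / ((x - z) ^ 2 * (x - z0) ^ 3)) by (field; auto).
  rewrite !(Cmod_mult _ (/ _)), Cmod_inv, !Cmod_mult, !Cmod_pow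
    by (apply Cmult_neq_0; now apply Cpow_nz).
  (* The numerator is 3 x - z0 - 2 z, so any constant from 6 upwards would serve. *)
  assert (T : (Cmod (3 * (x - z0) - 2 * (z - z0)) <= 10)%R).
  { replace (3 * (x - z0) - 2 * (z - z0)) with (3 * x + (- (1) * z0 + - (2) * z)) by ring.
    eapply Rle_trans; [apply Cmod_triangle|].
    eapply Rle_trans; [apply Rplus_le_compat_l; apply Cmod_triangle|].
    rewrite !Cmod_mult, !Cmod_opp, !Cmod_R, !Rabs_pos_eq by lra. lra. }
  assert (I : (/ (Cmod (x - z) ^ 2 * Cmod (x - z0) ^ 3) <= / d ^ 5)%R).
  { apply Rinv_le_contravar; [now apply pow_lt|].
    replace (d ^ 5)%R with (d ^ 2 * d ^ 3)%R by ring.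
    apply Rmult_le_compat; try (apply pow_le; lra); apply pow_incr; lra. }
  assert (I' : (0 < / (Cmod (x - z) ^ 2 * Cmod (x - z0) ^ 3))%R).
  { apply Rinv_0_lt_compat. apply Rmult_lt_0_compat; apply pow_lt; lra. }
  assert (S : (0 <= Cmod (z - z0) * Cmod (z - z0))%R) by (apply Rmult_le_pos; apply Cmod_ge_0).
  unfold Rdiv. set (s := (Cmod (z - z0) * Cmod (z - z0))%R) in *.
  set (i := (/ (Cmod (x - z) ^ 2 * Cmod (x - z0) ^ 3))%R) in *.
  set (T0 := Cmod (3 * (x - z0) - 2 * (z - z0))) in *.
  replace (T0 * s * i)%R with (T0 * i * s)%R by ring.
  apply Rmult_le_compat_r; [exact S|]. assert (0 <= T0)%R by apply Cmod_ge_0.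
  apply Rmult_le_compat; lra.
Qed.

Lemma cder_cauchyT1 (phi : R -> C) (rho : R) (z0 : C) : (Cmod z0 < rho)%R ->
  rcont_on phi 0 (2 * PI) -> cder (cauchyT phi rho 1) z0 (cauchyT phi rho 2 z0).
Proof.
  intros Hz Hphi. assert (P := TwoPI_pos).
  destruct (rcont_bounded phi 0 (2 * PI) ltac:(lra) Hphi) as [B [HB Hb]].
  set (d := ((rho - Cmod z0) / 2)%R). assert (Hd : (0 < d)%R) by (unfold d; lra).
  assert (near : forall z, (Cmod (z - z0) < d)%R -> (Cmod z + d < rho)%R).
  { intros z Hzz. assert (K := Cmod_rev_triangle z z0). unfold d in *. lra. }
  apply (cder_under_integral (fun t z => phi t / (rho * cis t - z) ^ 1) _ 0 (2 * PI) (B * / d ^ 3) d); try lra.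
  - intros z Hzz. apply near in Hzz. apply rcont_cauchy; auto. lra.
  - now apply rcont_cauchy.
  - intros t z Ht Hzz. apply near in Hzz.
    assert (D1 := circle_dist rho t z ltac:(lra)). assert (D2 := circle_dist rho t z0 Hz).
    replace (phi t / (rho * cis t - z) ^ 1 - phi t / (rho * cis t - z0) ^ 1 - (z - z0) * (phi t / (rho * cis t - z0) ^ 2))
      with (phi t * (/ (rho * cis t - z) - / (rho * cis t - z0) - (z - z0) * / (rho * cis t - z0) ^ 2)).
    + rewrite Cmod_mult, Rmult_assoc. apply Rmult_le_compat; try apply Cmod_ge_0; [now apply Hb|].
      apply kernel_taylor1; auto; unfold d in *; lra.
    + assert (N1 : rho * cis t - z <> 0) by (apply circle_minus_nz; lra).
      assert (N2 : rho * cis t - z0 <> 0) by now apply circle_minus_nz.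
      field. auto.
Qed.

Lemma cder_cauchyT2 (phi : R -> C) (rho : R) (z0 : C) : (Cmod z0 < rho <= 1)%R ->
  rcont_on phi 0 (2 * PI) -> exists l, cder (cauchyT phi rho 2) z0 l.
Proof.
  intros Hz Hphi. assert (P := TwoPI_pos).
  destruct (rcont_bounded phi 0 (2 * PI) ltac:(lra) Hphi) as [B [HB Hb]].
  set (d := ((rho - Cmod z0) / 2)%R). assert (Hd : (0 < d)%R) by (unfold d; lra).
  assert (near : forall z, (Cmod (z - z0) < d)%R -> (Cmod z + d < rho)%R).
  { intros z Hzz. assert (K := Cmod_rev_triangle z z0). unfold d in *. lra. }
  eexists.
  apply (cder_under_integral (fun t z => phi t / (rho * cis t - z) ^ 2)
    (fun t => 2 * (phi t / (rho * cis t - z0) ^ 3)) 0 (2 * PI) (B * (10 / d ^ 5)) d); try lra.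
  - intros z Hzz. apply near in Hzz. apply rcont_cauchy; auto. lra.
  - intros t Ht. apply rcont_mult; [apply rcont_const|]. apply rcont_cauchy; auto. lra.
  - intros t z Ht Hzz. apply near in Hzz.
    assert (D1 := circle_dist rho t z ltac:(lra)). assert (D2 := circle_dist rho t z0 ltac:(lra)).
    replace (phi t / (rho * cis t - z) ^ 2 - phi t / (rho * cis t - z0) ^ 2 - (z - z0) * (2 * (phi t / (rho * cis t - z0) ^ 3)))
      with (phi t * (/ (rho * cis t - z) ^ 2 - / (rho * cis t - z0) ^ 2 - (z - z0) * (2 * / (rho * cis t - z0) ^ 3))).
    + rewrite Cmod_mult, Rmult_assoc. apply Rmult_le_compat; try apply Cmod_ge_0; [now apply Hb|].
      assert (K0 := Cmod_ge_0 z0).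
      apply kernel_taylor2; auto; try (unfold d in *; lra).
      rewrite Cmod_circle; lra.
    + assert (N1 : rho * cis t - z <> 0) by (apply circle_minus_nz; lra).
      assert (N2 : rho * cis t - z0 <> 0) by (apply circle_minus_nz; lra).
      field. auto.
Qed.

(** * Taylor coefficients, maximum modulus and primitives *)

Lemma unit_disk_0 : unit_disk 0.
Proof. unfold unit_disk. rewrite Cmod_0. lra. Qed.

Lemma ccont_hol_rcont (f : C -> C) (rho t : R) : hol f -> (0 <= rho < 1)%R ->
  rcont (fun s => f (rho * cis s)) t.
Proof.
  intros Hf Hr. apply rcont_comp; [apply rcont_circle|]. apply hol_cont; auto.
  unfold unit_disk. rewrite Cmod_circle; lra.
Qed.

Lemma TwoPI_nz : RtoC (2 * PI)%R <> 0.
Proof. apply RtoC_neq. assert (P := TwoPI_pos). lra. Qed.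

Lemma CI_ext (f g : R -> C) (a b : R) : (forall t, f t = g t) -> CI f a b = CI g a b.
Proof. intros E. unfold CI. f_equal; apply RInt_ext; intros; now rewrite E. Qed.

Lemma cauchy_rep (f : C -> C) (rho : R) (z : C) : hol f -> (rho < 1)%R -> (Cmod z < rho)%R ->
  (2 * PI)%R * f z = cauchyT (fun t => f (rho * cis t) * (rho * cis t)) rho 1 z.
Proof.
  intros Hf Hr Hz. symmetry. unfold cauchyT.
  transitivity (CI (fun t => f (rho * cis t) * (rho * cis t) / (rho * cis t - z)) 0 (2 * PI)).
  - apply CI_ext. intros t. simpl. now rewrite Cmult_1_r.
  - apply is_CI_unique. apply cauchy_formula; auto. intros w Hw. exists (C_derive f w).
    apply hol_cder; auto. unfold unit_disk. lra.
Qed.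

(** The density is any [phi] representing g, not necessarily the one built from boundary values of
    g, so that the lemma also covers difference quotients. *)
Lemma rep_cder (g : C -> C) (phi : R -> C) (rho : R) : rcont_on phi 0 (2 * PI) ->
  (forall z, (Cmod z < rho)%R -> (2 * PI)%R * g z = cauchyT phi rho 1 z) ->
  forall z, (Cmod z < rho)%R -> cder g z (/ (2 * PI)%R * cauchyT phi rho 2 z).
Proof.
  intros Hphi H z Hz. apply (cder_ext_loc (fun w => / (2 * PI)%R * cauchyT phi rho 1 w)).
  - assert (Hd : (0 < rho - Cmod z)%R) by lra. exists (mkposreal _ Hd).
    intros w Hw. change (Cmod (w - z) < rho - Cmod z)%R in Hw.
    assert (K := Cmod_rev_triangle w z). rewrite <- H by lra.
    assert (N := TwoPI_nz). field. auto.
  - apply cder_scal. now apply cder_cauchyT1.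
Qed.

Lemma hol_C_derive (f : C -> C) : hol f -> hol (C_derive f).
Proof.
  intros Hf. apply hol_intro. intros z Hz. unfold unit_disk in Hz.
  assert (K := Cmod_ge_0 z).
  set (rho := ((Cmod z + 1) / 2)%R). assert (Hr : (Cmod z < rho < 1)%R) by (unfold rho; lra).
  set (phi := fun t => f (rho * cis t) * (rho * cis t)).
  assert (Hphi : rcont_on phi 0 (2 * PI)).
  { intros t _. apply rcont_mult; [apply ccont_hol_rcont; auto; lra|apply rcont_circle]. }
  assert (Rep : forall w, (Cmod w < rho)%R -> C_derive f w = / (2 * PI)%R * cauchyT phi rho 2 w).
  { intros w Hw. apply cder_C_derive. apply (rep_cder f phi rho); auto.
    intros u Hu. apply cauchy_rep; auto. lra. }
  destruct (cder_cauchyT2 phi rho z ltac:(lra) Hphi) as [l Hl].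
  eexists. apply (cder_ext_loc (fun w => / (2 * PI)%R * cauchyT phi rho 2 w)).
  - assert (Hd : (0 < rho - Cmod z)%R) by lra. exists (mkposreal _ Hd).
    intros w Hw. change (Cmod (w - z) < rho - Cmod z)%R in Hw.
    assert (K' := Cmod_rev_triangle w z). symmetry. apply Rep. lra.
  - apply cder_scal. exact Hl.
Qed.

(** The difference quotient at [0], i.e. the left shift of the Taylor coefficients. *)
Definition dq (f : C -> C) (z : C) : C :=
  if Ceq_dec z 0 then C_derive f 0 else (f z - f 0) / z.

Lemma dq_eq (f : C -> C) (z : C) : f z = f 0 + z * dq f z.
Proof.
  unfold dq. destruct (Ceq_dec z 0) as [->|N]; [ring|]. field. auto.
Qed.

(** Since (1 / (x - z) - 1 / x) / z = 1 / (x (x - z)), passing to the difference quotient at 0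
    divides the density by x = rho * cis t. *)
Lemma dq_rep (g : C -> C) (phi : R -> C) (rho : R) : rcont_on phi 0 (2 * PI) ->
  (forall z, (Cmod z < rho)%R -> (2 * PI)%R * g z = cauchyT phi rho 1 z) ->
  forall z, (Cmod z < rho)%R ->
    (2 * PI)%R * dq g z = cauchyT (fun t => phi t / (rho * cis t)) rho 1 z.
Proof.
  intros Hphi H z Hz. assert (K := Cmod_ge_0 z). assert (N2 := TwoPI_nz). assert (P := TwoPI_pos).
  assert (Nc : forall t, rho * cis t <> 0).
  { intros t. apply Cmult_neq_0; [apply RtoC_neq; lra|apply cis_nz]. }
  unfold dq. destruct (Ceq_dec z 0) as [->|N].
  - rewrite (cder_C_derive _ _ _ (rep_cder g phi rho Hphi H 0 Hz)).
    transitivity (cauchyT phi rho 2 0); [field; auto|].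
    unfold cauchyT. apply CI_ext. intros t. specialize (Nc t).
    replace (rho * cis t - 0) with (rho * cis t) by ring.
    revert Nc. generalize (rho * cis t). intros x Nc. field. auto.
  - assert (I0 := CI_correct _ 0 (2 * PI) ltac:(lra) (rcont_cauchy phi rho 1 0 ltac:(rewrite Cmod_0; lra) Hphi)).
    assert (Iz := CI_correct _ 0 (2 * PI) ltac:(lra) (rcont_cauchy phi rho 1 z Hz Hphi)).
    fold (cauchyT phi rho 1 0) in I0. fold (cauchyT phi rho 1 z) in Iz.
    rewrite <- H in I0 by (rewrite Cmod_0; lra). rewrite <- H in Iz by auto.
    symmetry. unfold cauchyT. apply is_CI_unique.
    assert (J := is_CI_scal (/ z) _ _ _ _ (is_CI_minus _ _ _ _ _ _ Iz I0)).
    replace ((2 * PI)%R * ((g z - g 0) / z)) with (/ z * ((2 * PI)%R * g z - (2 * PI)%R * g 0)) by (field; auto).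
    revert J. apply is_CI_ext; [lra|]. intros t _.
    assert (N1 := circle_minus_nz rho t z Hz). specialize (Nc t).
    replace (rho * cis t - 0) with (rho * cis t) by ring.
    revert N1 Nc. generalize (rho * cis t). intros x N1 Nc. field. auto.
Qed.

(** The singularity at 0 is removable because the difference quotient is itself a Cauchy
    integral. *)
Lemma hol_dq (f : C -> C) : hol f -> hol (dq f).
Proof.
  intros Hf. apply hol_intro. intros z Hz.
  assert (K := Cmod_ge_0 z).
  set (rho := ((Cmod z + 1) / 2)%R).
  assert (Hr : (Cmod z < rho < 1)%R) by (unfold unit_disk in Hz; unfold rho; lra).
  set (phi := fun t => f (rho * cis t) * (rho * cis t)).
  assert (Hphi : rcont_on phi 0 (2 * PI)).
  { intros t _. apply rcont_mult; [apply ccont_hol_rcont; auto; lra|apply rcont_circle]. }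
  eexists. apply (rep_cder _ (fun t => phi t / (rho * cis t)) rho); [| |lra].
  - intros t Ht. apply rcont_mult; [auto|]. apply rcont_inv; [|apply rcont_circle].
    apply Cmult_neq_0; [apply RtoC_neq; lra|apply cis_nz].
  - apply dq_rep; auto. intros w Hw. apply cauchy_rep; auto. lra.
Qed.

Lemma cauchyT_le (phi : R -> C) (rho B : R) (z : C) : (Cmod z < rho)%R ->
  rcont_on phi 0 (2 * PI) -> (forall t, (Cmod (phi t) <= B)%R) ->
  (Cmod (cauchyT phi rho 1 z) <= (2 * PI) * (B / (rho - Cmod z)))%R.
Proof.
  intros Hz Hphi HB. assert (P := TwoPI_pos).
  replace (2 * PI)%R with (2 * PI - 0)%R at 1 by ring.
  apply (is_CI_le (fun t => phi t / (rho * cis t - z) ^ 1)); [lra| |].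
  - intros t _. unfold Cdiv. rewrite Cmod_mult. simpl. rewrite Cmult_1_r.
    rewrite Cmod_inv by now apply circle_minus_nz.
    apply Rmult_le_compat; auto using Cmod_ge_0.
    + left. apply Rinv_0_lt_compat. apply Cmod_gt_0. now apply circle_minus_nz.
    + apply Rinv_le_contravar; [lra|]. now apply circle_dist.
  - apply CI_correct; [lra|]. now apply rcont_cauchy.
Qed.

Lemma cauchy_estimate (f : C -> C) (rho B : R) (z : C) : hol f -> (rho < 1)%R -> (Cmod z < rho)%R ->
  (forall t, (Cmod (f (rho * cis t)%C) <= B)%R) ->
  (Cmod (f z) <= B * (rho / (rho - Cmod z)))%R.
Proof.
  intros Hf Hr Hz HB. assert (P := TwoPI_pos). assert (K := Cmod_ge_0 z).
  assert (E := cauchy_rep f rho z Hf Hr Hz).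
  assert (L : (Cmod (cauchyT (fun t => f (rho * cis t) * (rho * cis t))%C rho 1 z) <=
     (2 * PI) * (B * rho / (rho - Cmod z)))%R).
  { apply cauchyT_le; auto.
    - intros t _. apply rcont_mult; [apply ccont_hol_rcont; auto; lra|apply rcont_circle].
    - intros t. rewrite Cmod_mult, Cmod_circle by lra. apply Rmult_le_compat_r; [lra|apply HB]. }
  rewrite <- E, Cmod_mult, Cmod_R, Rabs_pos_eq in L by lra.
  apply Rmult_le_reg_l in L; [|lra]. unfold Rdiv in *. lra.
Qed.

Lemma pow_bounded_le1 (q A : R) : (0 <= q)%R -> (forall n, q ^ n <= A)%R -> (q <= 1)%R.
Proof.
  intros Hq H. destruct (Rle_or_lt q 1) as [|L]; [assumption|exfalso].
  destruct (Pow_x_infinity q ltac:(rewrite Rabs_pos_eq; lra) (A + 1)%R) as [N HN].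
  specialize (HN N (Nat.le_refl N)). rewrite Rabs_pos_eq in HN by now apply pow_le.
  specialize (H N). lra.
Qed.

(** The Cauchy estimate for all powers of [f] removes its constant. *)
Lemma max_modulus (f : C -> C) (rho B : R) (z : C) : hol f -> (rho < 1)%R -> (Cmod z < rho)%R ->
  (0 < B)%R -> (forall t, (Cmod (f (rho * cis t)%C) <= B)%R) -> (Cmod (f z) <= B)%R.
Proof.
  intros Hf Hr Hz HB Hb. assert (K := Cmod_ge_0 z).
  assert (Q : (Cmod (f z) / B <= 1)%R).
  { apply (pow_bounded_le1 _ (rho / (rho - Cmod z))).
    - apply Rmult_le_pos; [apply Cmod_ge_0|]. left. now apply Rinv_0_lt_compat.
    - intros n.
      assert (H := cauchy_estimate (fun w => f w ^ n) rho (B ^ n) z (hol_pow f n Hf) Hr Hz).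
      assert (H' : (Cmod (f z ^ n) <= B ^ n * (rho / (rho - Cmod z)))%R).
      { apply H. intros t. rewrite Cmod_pow. apply pow_incr. split; [apply Cmod_ge_0|apply Hb]. }
      rewrite Cmod_pow in H'. unfold Rdiv at 1. rewrite Rpow_mult_distr, pow_inv.
      assert (PB : (0 < B ^ n)%R) by now apply pow_lt.
      apply (Rmult_le_reg_l (B ^ n)); [exact PB|].
      replace (B ^ n * (Cmod (f z) ^ n * / B ^ n))%R with (Cmod (f z) ^ n)%R by (field; lra).
      exact H'. }
  apply (Rmult_le_compat_r B) in Q; [|lra].
  unfold Rdiv in Q. rewrite Rmult_assoc, Rinv_l in Q; lra.
Qed.

(** The Schwarz lemma: on the circle of radius rho the hypothesis gives |f| <= 1 / rho, the maximum
    principle carries this inside, and rho tends to 1. *)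
Lemma schwarz_quotient (f : C -> C) : hol f ->
  (forall z, unit_disk z -> (Cmod z * Cmod (f z) <= 1)%R) ->
  forall z, unit_disk z -> (Cmod (f z) <= 1)%R.
Proof.
  intros Hf H z Hz. unfold unit_disk in Hz. assert (K := Cmod_ge_0 z).
  apply le_epsilon. intros eps He.
  (* The first entry keeps z inside the circle, the second gives 1 / rho <= 1 + eps. *)
  set (rho := Rmax ((Cmod z + 1) / 2) (/ (1 + eps))).
  assert (I : (/ (1 + eps) < 1)%R) by (rewrite <- Rinv_1 at 2; apply Rinv_lt_contravar; lra).
  assert (I0 : (0 < / (1 + eps))%R) by (apply Rinv_0_lt_compat; lra).
  assert (R1 : ((Cmod z + 1) / 2 <= rho)%R) by apply Rmax_l.
  assert (R2 : (/ (1 + eps) <= rho)%R) by apply Rmax_r.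
  assert (R3 : (rho < 1)%R) by (apply Rmax_lub_lt; lra).
  apply (max_modulus f rho); auto; try lra.
  intros t. assert (L := H (rho * cis t)).
  unfold unit_disk in L. rewrite Cmod_circle in L by lra. specialize (L R3).
  apply (Rmult_le_reg_l rho); [lra|].
  apply (Rmult_le_compat_r (1 + eps)) in R2; [|lra]. rewrite Rinv_l in R2; lra.
Qed.

Lemma disk_scale (l : R) (z : C) : (0 <= l <= 1)%R -> unit_disk z -> unit_disk (l * z).
Proof.
  unfold unit_disk. intros Hl Hz. rewrite Cmod_mult, Cmod_R, Rabs_pos_eq by lra.
  assert (K := Cmod_ge_0 z). nra.
Qed.

Fixpoint dqn (n : nat) (f : C -> C) : C -> C :=
  match n with O => f | S n => dq (dqn n f) end.

Lemma hol_dqn (n : nat) (f : C -> C) : hol f -> hol (dqn n f).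
Proof. intros Hf. induction n as [|n IH]; simpl; auto. now apply hol_dq. Qed.

(** The remainder before index n is exactly z^n * dqn n f z. The density of [dqn n f] is that of f
    divided by (rho * cis t)^n, so the remainder is O((|z| / rho)^n). *)
Lemma taylor_series (f : C -> C) (z : C) : hol f -> unit_disk z ->
  @is_series C_AbsRing C_NormedModule (fun n => dqn n f 0 * z ^ n) (f z).
Proof.
  intros Hf Hz. assert (K := Cmod_ge_0 z). assert (P := TwoPI_pos).
  set (rho := ((Cmod z + 1) / 2)%R).
  assert (Hr : (Cmod z < rho < 1)%R) by (unfold unit_disk in Hz; unfold rho; lra).
  assert (Nc : forall t, rho * cis t <> 0).
  { intros t. apply Cmult_neq_0; [apply RtoC_neq; lra|apply cis_nz]. }
  set (phi := fun n t => f (rho * cis t) * (rho * cis t) / (rho * cis t) ^ n).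
  assert (Hphi : forall n, rcont_on (phi n) 0 (2 * PI)).
  { intros n t _. apply rcont_mult; [apply rcont_mult; [apply ccont_hol_rcont; auto; lra|apply rcont_circle]|].
    apply rcont_inv; [now apply Cpow_nz|]. apply rcont_pow. apply rcont_circle. }
  assert (Rep : forall n w, (Cmod w < rho)%R -> (2 * PI)%R * dqn n f w = cauchyT (phi n) rho 1 w).
  { induction n as [|n IH]; intros w Hw; simpl.
    - rewrite (cauchy_rep f rho) by (auto; lra). apply CI_ext. intros t. unfold phi. simpl.
      assert (N := circle_minus_nz rho t w Hw). field. auto.
    - rewrite (dq_rep _ (phi n) rho) by auto. apply CI_ext. intros t. unfold phi.
      assert (N := circle_minus_nz rho t w Hw). specialize (Nc t). simpl.
      revert N Nc. generalize (f (rho * cis t)). generalize (rho * cis t). intros x y N Nc.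
      assert (Nn := Cpow_nz x n Nc). field. auto. }
  destruct (rcont_bounded (fun t => f (rho * cis t) * (rho * cis t)) 0 (2 * PI)) as [B0 [HB0 Hb0]]; [lra| |].
  { intros t _. apply rcont_mult; [apply ccont_hol_rcont; auto; lra|apply rcont_circle]. }
  set (A := (B0 / (rho - Cmod z))%R).
  assert (HA : (0 < A)%R) by (apply Rdiv_lt_0_compat; lra).
  assert (Bd : forall n, (Cmod (z ^ n * dqn n f z) <= A * (Cmod z / rho) ^ n)%R).
  { intros n.
    assert (I : is_CI (fun t => phi n t / (rho * cis t - z)) 0 (2 * PI) ((2 * PI)%R * dqn n f z)).
    { rewrite Rep by lra. eapply is_CI_ext; [lra| |apply (CI_correct (fun t => phi n t / (rho * cis t - z) ^ 1)); [lra|apply rcont_cauchy; [lra|auto]]].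
      intros t _. simpl. now rewrite Cmult_1_r. }
    apply (is_CI_le _ 0 (2 * PI) (A * / rho ^ n)) in I; [|lra|].
    - rewrite Cmod_mult, Cmod_R, Rabs_pos_eq, Rminus_0_r in I by lra.
      apply Rmult_le_reg_l in I; [|lra].
      rewrite Cmod_mult, Cmod_pow. unfold Rdiv at 1. rewrite Rpow_mult_distr, pow_inv.
      assert (0 <= Cmod z ^ n)%R by now apply pow_le.
      replace (A * (Cmod z ^ n * / rho ^ n))%R with (Cmod z ^ n * (A * / rho ^ n))%R by ring.
      now apply Rmult_le_compat_l.
    - intros t Ht. unfold phi, Cdiv. rewrite !(Cmod_mult _ (/ _)).
      rewrite !Cmod_inv by (try apply Cpow_nz; auto; apply circle_minus_nz; lra).
      rewrite Cmod_pow, Cmod_circle by lra.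
      unfold A, Rdiv. rewrite Rmult_assoc, (Rmult_comm (/ rho ^ n)), <- Rmult_assoc.
      apply Rmult_le_compat_r; [left; apply Rinv_0_lt_compat, pow_lt; lra|].
      apply Rmult_le_compat; [apply Cmod_ge_0| |apply Hb0; lra|].
      + left. apply Rinv_0_lt_compat, Cmod_gt_0. apply circle_minus_nz; lra.
      + apply Rinv_le_contravar; [lra|]. apply circle_dist. lra. }
  assert (Sum : forall n, @sum_n C_AbelianMonoid (fun n => dqn n f 0 * z ^ n) n = f z - z ^ S n * dqn (S n) f z).
  { induction n as [|n IH].
    - rewrite sum_O. simpl. rewrite (dq_eq f z) at 1. ring.
    - rewrite sum_Sn, IH. simpl. rewrite (dq_eq (dq (dqn n f)) z) at 1.
      change (f z - z * z ^ n * (dq (dqn n f) 0 + z * dq (dq (dqn n f)) z) + dq (dqn n f) 0 * (z * z ^ n)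
       = f z - z * (z * z ^ n) * dq (dq (dqn n f)) z). ring. }
  apply (filterlim_locally (U := C_UniformSpace)).
  intros eps.
  assert (Hq : (Rabs (Cmod z / rho) < 1)%R).
  { rewrite Rabs_pos_eq; [apply Rlt_div_l; lra|]. apply Rmult_le_pos; [lra|]. left. apply Rinv_0_lt_compat. lra. }
  destruct (pow_lt_1_zero _ Hq (eps / A)%R ltac:(apply Rdiv_lt_0_compat; [apply cond_pos|lra])) as [N HN].
  exists N. intros n Hn.
  assert (Hsm : (Cmod (@sum_n C_AbelianMonoid (fun n => dqn n f 0 * z ^ n)%C n - f z) < eps)%R).
  { rewrite Sum.
    replace (f z - z ^ S n * dqn (S n) f z - f z) with (- (z ^ S n * dqn (S n) f z)) by ring.
    rewrite Cmod_opp. eapply Rle_lt_trans; [apply Bd|].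
    specialize (HN (S n) ltac:(lia)). apply (Rmult_lt_compat_l A) in HN; [|lra].
    replace (A * (eps / A))%R with (pos eps) in HN by (field; lra).
    eapply Rle_lt_trans; [|exact HN]. apply Rmult_le_compat_l; [lra|apply Rle_abs]. }
  split; (eapply Rle_lt_trans; [|exact Hsm]).
  - apply (re_le_Cmod (_ - _)).
  - apply (im_le_Cmod (_ - _)).
Qed.

(** Integration runs along the radius from 0 to z. Differentiating under the integral sign gives h(s
    z) + s z h'(s z), the derivative of s h(s z) in s, whose integral over [0, 1] is h(z). *)
Lemma hol_primitive (h : C -> C) : hol h ->
  exists H : C -> C, H 0 = 0 /\ forall z, unit_disk z -> cder H z (h z).
Proof.
  intros Hh. exists (fun z => CI (fun s => z * h (s * z)) 0 1).
  assert (Sg : forall z s, unit_disk z -> (0 <= s <= 1)%R -> unit_disk (s * z)) by (intros; now apply disk_scale).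
  assert (Dl : forall z s, rder (fun u : R => u * z) s z).
  { intros z s. apply (@der_ext R_UniformSpace _ _ (fun u : R => 0 + u * z)); [intros; ring|].
    apply rder_linear. }
  split.
  - apply is_CI_unique. replace (RtoC 0) with ((1 - 0)%R * 0) by ring.
    eapply is_CI_ext; [lra| |apply is_CI_const]. intros t _. cbv beta. ring.
  - intros z0 Hz0. assert (K0 := Cmod_ge_0 z0).
    set (G' := fun s : R => h (s * z0) + s * (C_derive h (s * z0) * z0)).
    assert (C1 : forall z, unit_disk z -> rcont_on (fun s => h (s * z)) 0 1).
    { intros z Hz s Hs. apply rcont_comp; [eapply rder_cont; apply Dl|]. apply hol_cont; auto. }
    assert (CG' : rcont_on G' 0 1).
    { intros s Hs. apply rcont_plus; [now apply C1|]. apply rcont_mult; [apply Clim_RtoC|].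
      apply rcont_mult; [|apply rcont_const].
      apply rcont_comp; [eapply rder_cont; apply Dl|]. apply hol_cont; auto. now apply hol_C_derive. }
    assert (IG' : CI G' 0 1 = h z0).
    { apply is_CI_unique. replace (h z0) with (1 * h (1 * z0) - 0 * h (0 * z0)) by (rewrite !Cmult_1_l; ring).
      apply (is_CI_derive (fun s => s * h (s * z0))); auto; [lra|].
      intros s Hs. eapply der_eq; [apply rder_mult; [apply der_param|]|].
      - apply rder_comp; [apply hol_cder; auto|apply Dl].
      - unfold G'. cbv beta. ring. }
    rewrite <- IG'.
    set (rho := ((Cmod z0 + 1) / 2)%R).
    assert (Hr : (Cmod z0 < rho < 1)%R) by (unfold unit_disk in Hz0; unfold rho; lra).
    set (phi := fun t => h (rho * cis t) * (rho * cis t)).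
    assert (Hphi : rcont_on phi 0 (2 * PI)).
    { intros t _. apply rcont_mult; [apply ccont_hol_rcont; auto; lra|apply rcont_circle]. }
    assert (P := TwoPI_pos).
    destruct (rcont_bounded phi 0 (2 * PI) ltac:(lra) Hphi) as [B [HB Hb]].
    set (d := ((rho - Cmod z0) / 2)%R). assert (Hd : (0 < d)%R) by (unfold d; lra).
    assert (near : forall z, (Cmod (z - z0) < d)%R -> (Cmod z + d < rho)%R).
    { intros z Hzz. assert (K := Cmod_rev_triangle z z0). unfold d in *. lra. }
    (* A second-order Taylor bound for h, uniform on a smaller disc, read off from the Cauchy
       kernel. *)
    assert (T2 : forall u v, (Cmod u + d <= rho)%R -> (Cmod v + d <= rho)%R ->
       (Cmod (h v - h u - (v - u) * C_derive h u) <= B * / d ^ 3 * (Cmod (v - u) * Cmod (v - u)))%R).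
    { intros u v Hu Hv.
      assert (Rp : forall w, (Cmod w < rho)%R -> is_CI (fun t => phi t / (rho * cis t - w) ^ 1) 0 (2 * PI) ((2 * PI)%R * h w)).
      { intros w Hw. rewrite (cauchy_rep h rho w Hh) by lra. apply CI_correct; [lra|]. now apply rcont_cauchy. }
      assert (Rd : is_CI (fun t => phi t / (rho * cis t - u) ^ 2) 0 (2 * PI) ((2 * PI)%R * C_derive h u)).
      { rewrite (cder_C_derive _ _ _ (rep_cder h phi rho Hphi (fun w Hw => cauchy_rep h rho w Hh (proj2 Hr) Hw) u ltac:(lra))).
        replace ((2 * PI)%R * (/ (2 * PI)%R * cauchyT phi rho 2 u)) with (cauchyT phi rho 2 u)
          by (field; apply TwoPI_nz).
        apply CI_correct; [lra|]. apply rcont_cauchy; auto. lra. }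
      assert (I := is_CI_minus _ _ _ _ _ _ (is_CI_minus _ _ _ _ _ _ (Rp v ltac:(lra)) (Rp u ltac:(lra)))
         (is_CI_scal (v - u) _ _ _ _ Rd)).
      apply (is_CI_le _ 0 (2 * PI) (B * / d ^ 3 * (Cmod (v - u) * Cmod (v - u)))) in I; [|lra|].
      - replace ((2 * PI)%R * h v - (2 * PI)%R * h u - (v - u) * ((2 * PI)%R * C_derive h u)) with
          ((2 * PI)%R * (h v - h u - (v - u) * C_derive h u)) in I by ring.
        rewrite Cmod_mult, Cmod_R, Rabs_pos_eq, Rminus_0_r in I by lra.
        now apply Rmult_le_reg_l in I; [|lra].
      - intros t Ht.
        assert (D1 := circle_dist rho t u ltac:(lra)). assert (D2 := circle_dist rho t v ltac:(lra)).
        replace (phi t / (rho * cis t - v) ^ 1 - phi t / (rho * cis t - u) ^ 1 - (v - u) * (phi t / (rho * cis t - u) ^ 2))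
          with (phi t * (/ (rho * cis t - v) - / (rho * cis t - u) - (v - u) * / (rho * cis t - u) ^ 2)).
        + rewrite Cmod_mult, Rmult_assoc. apply Rmult_le_compat; try apply Cmod_ge_0; [now apply Hb|].
          apply kernel_taylor1; auto; lra.
        + assert (N1 : rho * cis t - v <> 0) by (apply circle_minus_nz; lra).
          assert (N2 : rho * cis t - u <> 0) by (apply circle_minus_nz; lra).
          field. auto. }
    assert (Bh : exists D, (0 < D)%R /\ forall s, (0 <= s <= 1)%R -> (Cmod (C_derive h (s * z0)%C) <= D)%R).
    { apply (rcont_bounded (fun s => C_derive h (s * z0)) 0 1); [lra|]. intros s Hs.
      apply rcont_comp; [eapply rder_cont; apply Dl|]. apply hol_cont; auto. now apply hol_C_derive. }
    destruct Bh as [D [HD Hbd]].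
    apply (cder_under_integral (fun s z => z * h (s * z)) G' 0 1 (B * / d ^ 3 + D) d); auto; [lra| |].
    + intros z Hz s Hs. apply near in Hz. apply rcont_mult; [apply rcont_const|]. apply C1; auto.
      unfold unit_disk. lra.
    + intros s z Hs Hz. apply near in Hz.
      set (x := Cmod (z - z0)). assert (Hx : (0 <= x)%R) by apply Cmod_ge_0.
      assert (Kz := Cmod_ge_0 z).
      assert (L := T2 (s * z0) (s * z)).
      rewrite !Cmod_mult, !Cmod_R, !Rabs_pos_eq in L by lra.
      specialize (L ltac:(unfold d in *; nra) ltac:(nra)).
      replace (s * z - s * z0) with (s * (z - z0)) in L by ring.
      rewrite !Cmod_mult, !Cmod_R, !Rabs_pos_eq in L by lra. fold x in L.
      assert (Bp : (0 < B * / d ^ 3)%R) by (apply Rmult_lt_0_compat; [lra|apply Rinv_0_lt_compat, pow_lt; lra]).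
      replace (z * h (s * z) - z0 * h (s * z0) - (z - z0) * G' s) with
        (z * (h (s * z) - h (s * z0) - s * (z - z0) * C_derive h (s * z0)) +
         s * ((z - z0) * (z - z0)) * C_derive h (s * z0)) by (unfold G'; ring).
      eapply Rle_trans; [apply Cmod_triangle|]. rewrite !Cmod_mult, !Cmod_R, !Rabs_pos_eq by lra.
      fold x. rewrite Rmult_plus_distr_r. specialize (Hbd s Hs).
      apply Rplus_le_compat.
      * rewrite <- (Rmult_1_l (B * / d ^ 3 * (x * x))%R).
        apply Rmult_le_compat; [lra|apply Cmod_ge_0|lra|].
        eapply Rle_trans; [exact L|]. apply Rmult_le_compat_l; [lra|].
        assert (s * x <= x)%R by nra. assert (0 <= s * x)%R by nra. nra.
      * rewrite Rmult_comm. apply Rmult_le_compat; [apply Cmod_ge_0|nra|exact Hbd|nra].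
Qed.

(** * Coefficients of bounded functions: Schur's algorithm *)

(** A relation rather than a computed list of coefficients: being unique and compatible with sums,
    products and equality on the disc, it turns comparisons of coefficients into ring identities. *)
Definition jet3 (f : C -> C) (a0 a1 a2 a3 : C) : Prop :=
  exists k, hol k /\ forall z, unit_disk z ->
    f z = a0 + a1 * z + a2 * z ^ 2 + a3 * z ^ 3 + z ^ 4 * k z.

Lemma hol_jet3 (f : C -> C) : hol f -> jet3 f (f 0) (dqn 1 f 0) (dqn 2 f 0) (dqn 3 f 0).
Proof.
  intros Hf. exists (dqn 4 f). split; [now apply hol_dqn|]. intros z _.
  rewrite (dq_eq f z) at 1. rewrite (dq_eq (dq f) z) at 1.
  rewrite (dq_eq (dq (dq f)) z) at 1. rewrite (dq_eq (dq (dq (dq f))) z) at 1.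
  simpl. ring.
Qed.

Lemma hol_jet3_ex (f : C -> C) : hol f -> exists a1 a2 a3, jet3 f (f 0) a1 a2 a3.
Proof. intros Hf. do 3 eexists. now apply hol_jet3. Qed.

(** Away from 0 the factor z cancels; at 0 continuity decides. *)
Lemma hol_zero_factor (u : C -> C) : hol u -> (forall z, unit_disk z -> z * u z = 0) ->
  forall z, unit_disk z -> u z = 0.
Proof.
  intros Hu H.
  assert (N : forall z, unit_disk z -> z <> 0 -> u z = 0).
  { intros z Hz Nz. destruct (Cmult_integral _ _ (H z Hz)); [contradiction|auto]. }
  intros z Hz. destruct (Ceq_dec z 0) as [->|Nz]; [|auto].
  apply Ceq_of_eps. intros eps He.
  destruct (hol_cont u 0 Hu unit_disk_0 eps He) as [d Hd].
  set (x := (Rmin (d / 2) (1 / 2))%R).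
  assert (Hx : (0 < x)%R) by (apply Rmin_pos; [assert (K := cond_pos d)|]; lra).
  assert (Hx1 : (x <= d / 2)%R) by apply Rmin_l. assert (Hx2 : (x <= 1 / 2)%R) by apply Rmin_r.
  assert (K := cond_pos d).
  assert (Cx : Cmod x = x) by (rewrite Cmod_R; apply Rabs_pos_eq; lra).
  specialize (Hd (RtoC x)). rewrite (N x) in Hd.
  - rewrite Cmod_minus_sym. apply Hd. change (Cmod (x - 0) < d)%R.
    replace (x - 0) with (RtoC x) by ring. lra.
  - unfold unit_disk. lra.
  - apply RtoC_neq. lra.
Qed.

Lemma jet3_unique (f : C -> C) (a0 a1 a2 a3 b0 b1 b2 b3 : C) :
  jet3 f a0 a1 a2 a3 -> jet3 f b0 b1 b2 b3 -> a0 = b0 /\ a1 = b1 /\ a2 = b2 /\ a3 = b3.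
Proof.
  intros [k [Hk Ek]] [m [Hm Em]].
  assert (Hkm : hol (fun z => k z - m z)) by now apply hol_minus.
  set (u3 := fun z => (a3 - b3) + z * (k z - m z)).
  set (u2 := fun z => (a2 - b2) + z * u3 z).
  set (u1 := fun z => (a1 - b1) + z * u2 z).
  assert (H3 : hol u3) by (apply hol_plus; [apply hol_const|]; apply hol_mult; [apply hol_id|auto]).
  assert (H2 : hol u2) by (apply hol_plus; [apply hol_const|]; apply hol_mult; [apply hol_id|auto]).
  assert (H1 : hol u1) by (apply hol_plus; [apply hol_const|]; apply hol_mult; [apply hol_id|auto]).
  assert (E0 : forall z, unit_disk z -> (a0 - b0) + z * u1 z = 0).
  { intros z Hz. transitivity (f z - f z); [|ring]. rewrite (Ek z Hz) at 1. rewrite (Em z Hz).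
    unfold u1, u2, u3. ring. }
  assert (A0 : a0 - b0 = 0) by (rewrite <- (E0 0 unit_disk_0); ring).
  assert (Z1 : forall z, unit_disk z -> u1 z = 0).
  { apply hol_zero_factor; auto. intros z Hz. rewrite <- (E0 z Hz), A0. ring. }
  assert (A1 : a1 - b1 = 0) by (rewrite <- (Z1 0 unit_disk_0); unfold u1; ring).
  assert (Z2 : forall z, unit_disk z -> u2 z = 0).
  { apply hol_zero_factor; auto. intros z Hz. rewrite <- (Z1 z Hz). unfold u1. rewrite A1. ring. }
  assert (A2 : a2 - b2 = 0) by (rewrite <- (Z2 0 unit_disk_0); unfold u2; ring).
  assert (Z3 : forall z, unit_disk z -> u3 z = 0).
  { apply hol_zero_factor; auto. intros z Hz. rewrite <- (Z2 z Hz). unfold u2. rewrite A2. ring. }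
  assert (A3 : a3 - b3 = 0) by (rewrite <- (Z3 0 unit_disk_0); unfold u3; ring).
  repeat split; now apply Ceq_minus.
Qed.

Lemma jet3_ext (f g : C -> C) (a0 a1 a2 a3 : C) : (forall z, unit_disk z -> f z = g z) ->
  jet3 f a0 a1 a2 a3 -> jet3 g a0 a1 a2 a3.
Proof. intros E [k [Hk Ek]]. exists k. split; auto. intros z Hz. rewrite <- E; auto. Qed.

Lemma jet3_eq (f : C -> C) (a0 a1 a2 a3 b0 b1 b2 b3 : C) : jet3 f a0 a1 a2 a3 ->
  a0 = b0 -> a1 = b1 -> a2 = b2 -> a3 = b3 -> jet3 f b0 b1 b2 b3.
Proof. now intros H -> -> -> ->. Qed.

Lemma jet3_const (c : C) : jet3 (fun _ => c) c 0 0 0.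
Proof. exists (fun _ => RtoC 0). split; [apply hol_const|]. intros z _. ring. Qed.

Lemma jet3_id : jet3 (fun z => z) 0 1 0 0.
Proof. exists (fun _ => RtoC 0). split; [apply hol_const|]. intros z _. ring. Qed.

Lemma jet3_plus (f g : C -> C) (a0 a1 a2 a3 b0 b1 b2 b3 : C) :
  jet3 f a0 a1 a2 a3 -> jet3 g b0 b1 b2 b3 ->
  jet3 (fun z => f z + g z) (a0 + b0) (a1 + b1) (a2 + b2) (a3 + b3).
Proof.
  intros [k [Hk Ek]] [m [Hm Em]]. exists (fun z => k z + m z). split; [now apply hol_plus|].
  intros z Hz. rewrite (Ek z Hz), (Em z Hz). ring.
Qed.

Lemma jet3_mult (f g : C -> C) (a0 a1 a2 a3 b0 b1 b2 b3 : C) :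
  jet3 f a0 a1 a2 a3 -> jet3 g b0 b1 b2 b3 ->
  jet3 (fun z => f z * g z) (a0 * b0) (a0 * b1 + a1 * b0) (a0 * b2 + a1 * b1 + a2 * b0)
    (a0 * b3 + a1 * b2 + a2 * b1 + a3 * b0).
Proof.
  intros [k [Hk Ek]] [m [Hm Em]].
  assert (PH : forall c0 c1 c2 c3, hol (fun z => c0 + c1 * z + c2 * z ^ 2 + c3 * z ^ 3)).
  { intros c0 c1 c2 c3.
    assert (M : forall c n, hol (fun z => c * z ^ n)).
    { intros c n. apply hol_mult; [apply hol_const|apply hol_pow, hol_id]. }
    apply (hol_plus (fun z => c0 + c1 * z + c2 * z ^ 2)); [|apply M].
    apply (hol_plus (fun z => c0 + c1 * z)); [|apply M].
    apply (hol_plus (fun z => c0)); [apply hol_const|].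
    apply hol_mult; [apply hol_const|apply hol_id]. }
  (* First the terms of degree 4 to 6 in the product of the two cubics, then those containing a
     remainder. The summand 0 * z ^ 3 only gives the shape expected by [PH]. *)
  exists (fun z => (a1 * b3 + a2 * b2 + a3 * b1 + (a2 * b3 + a3 * b2) * z + a3 * b3 * z ^ 2 + 0 * z ^ 3)
    + ((a0 + a1 * z + a2 * z ^ 2 + a3 * z ^ 3) * m z + ((b0 + b1 * z + b2 * z ^ 2 + b3 * z ^ 3) * k z
    + z ^ 4 * (k z * m z)))).
  split.
  - apply hol_plus; [apply PH|]. apply hol_plus; [now apply hol_mult|].
    apply hol_plus; [now apply hol_mult|]. apply hol_mult; [apply hol_pow, hol_id|now apply hol_mult].
  - intros z Hz. rewrite (Ek z Hz), (Em z Hz). ring.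
Qed.

Lemma jet3_scal (c : C) (f : C -> C) (a0 a1 a2 a3 : C) : jet3 f a0 a1 a2 a3 ->
  jet3 (fun z => c * f z) (c * a0) (c * a1) (c * a2) (c * a3).
Proof.
  intros H. eapply jet3_eq; [apply jet3_mult; [apply jet3_const|exact H]| | | |]; ring.
Qed.

Lemma jet3_shift (f : C -> C) (a0 a1 a2 a3 : C) : jet3 f a0 a1 a2 a3 ->
  jet3 (fun z => z * f z) 0 a0 a1 a2.
Proof.
  intros H. eapply jet3_eq; [apply jet3_mult; [apply jet3_id|exact H]| | | |]; ring.
Qed.

Lemma cder_monomial (c : C) (n : nat) (z : C) : cder (fun u => c * u ^ S n) z (c * (INR (S n) * z ^ n)).
Proof.
  apply cder_scal. induction n as [|n IH].
  - simpl. eapply der_eq; [apply cder_mult; [apply cder_id|apply cder_const]|]. cbv beta. ring.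
  - eapply der_eq; [apply (cder_mult _ (fun u => u) (fun u => u ^ S n)); [apply cder_id|exact IH]|].
    rewrite (S_INR (S n)), RtoC_plus. simpl Cpow. ring.
Qed.

(** The last coefficient comes from the fourth coefficient of f, which sits in the remainder as k 0;
    hence the existential. *)
Lemma jet3_derive (f : C -> C) (a0 a1 a2 a3 : C) : jet3 f a0 a1 a2 a3 ->
  exists a4, jet3 (C_derive f) a1 (2 * a2) (3 * a3) a4.
Proof.
  intros [k [Hk Ek]]. exists (4 * k 0).
  assert (Hk' := hol_C_derive k Hk).
  exists (fun z => 4 * dq k z + C_derive k z). split.
  - apply hol_plus; auto. apply hol_mult; [apply hol_const|now apply hol_dq].
  - intros z Hz. apply cder_C_derive.
    apply (cder_ext_loc (fun z => a0 + a1 * z ^ 1 + a2 * z ^ 2 + a3 * z ^ 3 + 1 * z ^ 4 * k z)).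
    + generalize (locally_disk z Hz). apply filter_imp. intros u Hu. rewrite (Ek u Hu). ring.
    + eapply der_eq.
      * apply cder_plus; [apply cder_plus; [apply cder_plus; [apply cder_plus|]|]|];
          [apply cder_const|apply cder_monomial..|].
        apply cder_mult; [apply cder_monomial|now apply hol_cder].
      * rewrite !S_INR. simpl INR. rewrite !RtoC_plus. rewrite (dq_eq k z) at 1. simpl. ring.
Qed.

Lemma disk_bound_denominator (h : C -> C) : (forall z, unit_disk z -> (Cmod (h z) <= 1)%R) ->
  (Cmod (h 0) < 1)%R -> forall z, unit_disk z -> 1 - Cconj (h 0) * h z <> 0.
Proof.
  intros Hb H0 z Hz E. apply Ceq_minus in E. apply (f_equal Cmod) in E.
  rewrite Cmod_1, Cmod_mult, Cmod_conj in E. specialize (Hb z Hz).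
  assert (K := Cmod_ge_0 (h z)). assert (K' := Cmod_ge_0 (h 0)). nra.
Qed.

Lemma Cmod_sqr (z : C) : (Cmod z * Cmod z = Re z * Re z + Im z * Im z)%R.
Proof. assert (H := Cmod2_alt z). simpl in H. lra. Qed.

Lemma Cmod_le_sqr (a b : C) : (Cmod a * Cmod a <= Cmod b * Cmod b)%R -> (Cmod a <= Cmod b)%R.
Proof. intros H. apply Rsqr_incr_0_var; [exact H|apply Cmod_ge_0]. Qed.

(** The squares differ by (1 - |a|^2) (1 - |w|^2). *)
Lemma moebius_le (a w : C) : (Cmod a <= 1)%R -> (Cmod w <= 1)%R ->
  (Cmod (w - a) <= Cmod (1 - Cconj a * w))%R.
Proof.
  intros Ha Hw. apply Cmod_le_sqr.
  assert (A := Cmod_sqr a). assert (W := Cmod_sqr w).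
  rewrite !Cmod_sqr. destruct a as [a1 a2], w as [w1 w2].
  unfold Cconj, Cminus, Cplus, Copp, Cmult, RtoC, Re, Im in *. simpl in *.
  set (ca := Cmod (a1, a2)) in *. set (cw := Cmod (w1, w2)) in *.
  assert (Pa : (0 <= ca)%R) by apply Cmod_ge_0. assert (Pw : (0 <= cw)%R) by apply Cmod_ge_0.
  assert ((a1 * a1 + a2 * a2 <= 1)%R) by nra. assert ((w1 * w1 + w2 * w2 <= 1)%R) by nra.
  assert (0 <= (1 - (a1 * a1 + a2 * a2)) * (1 - (w1 * w1 + w2 * w2)))%R by (apply Rmult_le_pos; lra).
  lra.
Qed.

(** The Schur transform: the disc automorphism that sends h 0 to 0 is applied to h, and the zero at
    the origin is divided out through [dq]. *)
Definition schur_step (h : C -> C) (z : C) : C := dq h z / (1 - Cconj (h 0) * h z).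

Lemma hol_schur_step (h : C -> C) : hol h -> (forall z, unit_disk z -> (Cmod (h z) <= 1)%R) ->
  (Cmod (h 0) < 1)%R -> hol (schur_step h).
Proof.
  intros Hh Hb H0. apply hol_div; [now apply disk_bound_denominator|now apply hol_dq|].
  apply hol_minus; [apply hol_const|]. apply hol_mult; [apply hol_const|auto].
Qed.

Lemma schur_step_le (h : C -> C) : hol h -> (forall z, unit_disk z -> (Cmod (h z) <= 1)%R) ->
  (Cmod (h 0) < 1)%R -> forall z, unit_disk z -> (Cmod (schur_step h z) <= 1)%R.
Proof.
  intros Hh Hb H0. apply schwarz_quotient; [now apply hol_schur_step|].
  intros z Hz. rewrite <- Cmod_mult. unfold schur_step.
  assert (N := disk_bound_denominator h Hb H0 z Hz).
  replace (z * (dq h z / (1 - Cconj (h 0) * h z))) with ((h z - h 0) / (1 - Cconj (h 0) * h z))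
    by (rewrite (dq_eq h z) at 1; field; auto).
  rewrite Cmod_div by auto. apply Cmod_gt_0 in N.
  apply (Rmult_le_reg_r (Cmod (1 - Cconj (h 0) * h z))); [auto|].
  unfold Rdiv. rewrite Rmult_assoc, Rinv_l, Rmult_1_r, Rmult_1_l by lra.
  apply moebius_le; [lra|auto].
Qed.

Lemma schur_step_jet (h : C -> C) (a0 a1 a2 a3 : C) : hol h -> (forall z, unit_disk z -> (Cmod (h z) <= 1)%R) ->
  (Cmod a0 < 1)%R -> jet3 h a0 a1 a2 a3 ->
  exists x0 x1 x2 x3, jet3 (schur_step h) x0 x1 x2 x3 /\
    a1 = x0 * (1 - Cconj a0 * a0) /\ a2 = x1 * (1 - Cconj a0 * a0) - x0 * Cconj a0 * a1.
Proof.
  intros Hh Hb H0 J.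
  destruct (jet3_unique _ _ _ _ _ _ _ _ _ J (hol_jet3 h Hh)) as [E0 [E1 [E2 E3]]].
  rewrite E0 in *.
  assert (HS := hol_schur_step h Hh Hb H0).
  destruct (hol_jet3_ex _ HS) as [x1 [x2 [x3 JS]]].
  exists (schur_step h 0), x1, x2, x3. split; [exact JS|].
  assert (JQ := hol_jet3 (dq h) (hol_dq h Hh)).
  assert (JD : jet3 (fun z => 1 + - Cconj (h 0) * h z) (1 + - Cconj (h 0) * h 0) (0 + - Cconj (h 0) * a1)
     (0 + - Cconj (h 0) * a2) (0 + - Cconj (h 0) * a3)).
  { apply jet3_plus; [apply jet3_const|]. now apply jet3_scal. }
  assert (JP := jet3_mult _ _ _ _ _ _ _ _ _ _ JS JD).
  apply (jet3_ext _ (dq h)) in JP.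
  - destruct (jet3_unique _ _ _ _ _ _ _ _ _ JP JQ) as [F0 [F1 _]].
    split; [rewrite E1; change (dqn 1 h 0) with (dq h 0); rewrite <- F0; ring|].
    rewrite E2. change (dqn 2 h 0) with (dqn 1 (dq h) 0). rewrite <- F1. ring.
  - intros z Hz. unfold schur_step. assert (N := disk_bound_denominator h Hb H0 z Hz).
    replace (1 + - Cconj (h 0) * h z) with (1 - Cconj (h 0) * h z) by ring. field. auto.
Qed.

Lemma conj_mult_self (a : C) : Cconj a * a = RtoC (Cmod a * Cmod a)%R.
Proof.
  rewrite Cmod_sqr. destruct a as [x y]. unfold Cconj, Cmult, RtoC, Re, Im. simpl. f_equal; ring.
Qed.

(** Shrinking by l < 1 makes |a0| < 1 strict, which is the condition for a Schur step. *)
Lemma jet3_scaled (l : R) (h : C -> C) (a0 a1 a2 a3 : C) : (0 <= l < 1)%R -> hol h ->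
  (forall z, unit_disk z -> (Cmod (h z) <= 1)%R) -> jet3 h a0 a1 a2 a3 ->
  hol (fun z => l * h z) /\ (forall z, unit_disk z -> (Cmod (l * h z) <= 1)%R) /\
  jet3 (fun z => l * h z) (l * a0) (l * a1) (l * a2) (l * a3) /\ (Cmod (l * a0) < 1)%R.
Proof.
  intros Hl Hh Hb J. split; [apply hol_mult; [apply hol_const|auto]|].
  assert (B : forall z, unit_disk z -> (Cmod (l * h z) <= l)%R).
  { intros z Hz. rewrite Cmod_mult, Cmod_R, Rabs_pos_eq by lra. specialize (Hb z Hz). nra. }
  split; [intros z Hz; specialize (B z Hz); lra|]. split; [now apply jet3_scal|].
  destruct (jet3_unique _ _ _ _ _ _ _ _ _ J (hol_jet3 h Hh)) as [-> _].
  specialize (B 0 unit_disk_0). lra.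
Qed.

Lemma jet3_at_0 (h : C -> C) (a0 a1 a2 a3 : C) : hol h -> jet3 h a0 a1 a2 a3 -> a0 = h 0.
Proof. intros Hh J. now destruct (jet3_unique _ _ _ _ _ _ _ _ _ J (hol_jet3 h Hh)). Qed.

Lemma schur1_lt (h : C -> C) (a0 a1 a2 a3 : C) : hol h -> (forall z, unit_disk z -> (Cmod (h z) <= 1)%R) ->
  jet3 h a0 a1 a2 a3 -> (Cmod a0 < 1)%R -> (Cmod a1 <= 1 - Cmod a0 * Cmod a0)%R.
Proof.
  intros Hh Hb J H0.
  assert (E0 := jet3_at_0 _ _ _ _ _ Hh J).
  destruct (schur_step_jet h a0 a1 a2 a3 Hh Hb H0 J) as [x0 [x1 [x2 [x3 [JS [E1 _]]]]]].
  rewrite E0 in H0.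
  assert (HS := hol_schur_step h Hh Hb H0).
  assert (X := schur_step_le h Hh Hb H0 0 unit_disk_0). rewrite <- (jet3_at_0 _ _ _ _ _ HS JS) in X.
  rewrite <- E0 in H0.
  assert (K := Cmod_ge_0 a0).
  rewrite E1, conj_mult_self, <- RtoC_minus, Cmod_mult, Cmod_R.
  assert (P : (0 <= 1 - Cmod a0 * Cmod a0)%R) by nra.
  rewrite Rabs_pos_eq by exact P. nra.
Qed.

(** The passage l -> 1, with an error term linear in 1 - l. *)
Lemma le_of_scaled (a b c : R) : (0 <= a)%R ->
  (forall l, (0 <= l < 1)%R -> (l * a <= b + c * (1 - l))%R) -> (a <= b)%R.
Proof.
  intros Ha H. apply le_epsilon. intros eps He.
  set (M := (a + Rabs c + eps)%R).
  assert (HM : (0 < M)%R) by (unfold M; assert (K := Rabs_pos c); lra).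
  assert (Hr : (0 < eps / M <= 1)%R).
  { split; [now apply Rdiv_lt_0_compat|]. apply Rle_div_l; [lra|]. unfold M. assert (K := Rabs_pos c). lra. }
  specialize (H (1 - eps / M)%R ltac:(lra)).
  assert (E : (eps / M * M = eps)%R) by (field; lra).
  assert (K := Rabs_pos c). assert (K2 := Rle_abs c). unfold M in E at 2.
  assert (eps / M * c <= eps / M * Rabs c)%R by (apply Rmult_le_compat_l; lra).
  assert (0 <= eps / M * eps)%R by (apply Rmult_le_pos; lra). nra.
Qed.

Lemma schur1 (h : C -> C) (a0 a1 a2 a3 : C) : hol h -> (forall z, unit_disk z -> (Cmod (h z) <= 1)%R) ->
  jet3 h a0 a1 a2 a3 -> (Cmod a0 <= 1)%R /\ (Cmod a1 <= 1 - Cmod a0 * Cmod a0)%R.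
Proof.
  intros Hh Hb J.
  assert (A : (Cmod a0 <= 1)%R) by (rewrite (jet3_at_0 _ _ _ _ _ Hh J); apply Hb, unit_disk_0).
  split; [exact A|].
  (* The bound for l h is 1 - l^2 |a0|^2, and 1 - l^2 <= 2 (1 - l). *)
  apply (le_of_scaled _ _ (2 * (Cmod a0 * Cmod a0))); [apply Cmod_ge_0|]. intros l Hl.
  destruct (jet3_scaled l h a0 a1 a2 a3 Hl Hh Hb J) as [H1 [H2 [H3 H4]]].
  assert (S := schur1_lt _ _ _ _ _ H1 H2 H3 H4).
  rewrite !Cmod_mult, !Cmod_R, !Rabs_pos_eq in S by lra.
  assert (K := Cmod_ge_0 a0). assert (0 <= Cmod a0 * Cmod a0)%R by nra.
  set (q := (Cmod a0 * Cmod a0)%R) in *.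
  replace (l * Cmod a0 * (l * Cmod a0))%R with (l * l * q)%R in S by (unfold q; ring).
  assert (0 <= q * ((1 - l) * (1 - l)))%R by (apply Rmult_le_pos; [lra|apply Rle_0_sqr]). lra.
Qed.

(** The parameters x and y are the first two coefficients of the Schur transform of h, to which
    [schur1] applies. *)
Lemma schur2 (h : C -> C) (a0 a1 a2 a3 : C) : hol h -> (forall z, unit_disk z -> (Cmod (h z) <= 1)%R) ->
  jet3 h a0 a1 a2 a3 -> (Cmod a0 < 1)%R ->
  exists x y, a1 = (1 - Cmod a0 * Cmod a0)%R * x /\
    a2 = (1 - Cmod a0 * Cmod a0)%R * (y - Cconj a0 * (x * x)) /\
    (Cmod x <= 1)%R /\ (Cmod y <= 1 - Cmod x * Cmod x)%R.
Proof.
  intros Hh Hb J H0.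
  assert (E0 := jet3_at_0 _ _ _ _ _ Hh J).
  destruct (schur_step_jet h a0 a1 a2 a3 Hh Hb H0 J) as [x0 [x1 [x2 [x3 [JS [E1 E2]]]]]].
  exists x0, x1.
  rewrite conj_mult_self, <- RtoC_minus in E1, E2.
  split; [rewrite E1; ring|]. split; [rewrite E2, E1; ring|].
  rewrite E0 in H0.
  apply (schur1 (schur_step h) x0 x1 x2 x3); auto; [now apply hol_schur_step|now apply schur_step_le].
Qed.

(** A substitute for the strict maximum principle. Since a1 = 0, the parameter x of l h vanishes, so
    l |a2| <= 1 - l^2 <= 2 (1 - l). *)
Lemma schur2_extreme (h : C -> C) (a0 a1 a2 a3 : C) : hol h -> (forall z, unit_disk z -> (Cmod (h z) <= 1)%R) ->
  jet3 h a0 a1 a2 a3 -> Cmod a0 = 1%R -> a1 = 0 /\ a2 = 0.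
Proof.
  intros Hh Hb J H0.
  assert (A1 : a1 = 0).
  { apply Cmod_eq_0. destruct (schur1 h a0 a1 a2 a3 Hh Hb J) as [_ S]. rewrite H0 in S.
    assert (K := Cmod_ge_0 a1). lra. }
  split; [exact A1|]. apply Cmod_eq_0. apply Rle_antisym; [|apply Cmod_ge_0].
  apply (le_of_scaled _ _ 2); [apply Cmod_ge_0|]. intros l Hl.
  destruct (jet3_scaled l h a0 a1 a2 a3 Hl Hh Hb J) as [H1 [H2 [H3 H4]]].
  destruct (schur2 _ _ _ _ _ H1 H2 H3 H4) as [x [y [Ex [Ey [Hx Hy]]]]].
  rewrite Cmod_mult, Cmod_R, H0, Rabs_pos_eq, Rmult_1_r in Ex, Ey by lra.
  rewrite A1, Cmult_0_r in Ex.
  assert (X : x = 0).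
  { destruct (Cmult_integral _ _ (eq_sym Ex)) as [Z|]; [|auto].
    apply RtoC_inj in Z. assert (l * l < 1)%R by nra. lra. }
  rewrite X in Ey. replace (y - Cconj (l * a0) * (0 * 0)) with y in Ey by ring.
  apply (f_equal Cmod) in Ey. rewrite !Cmod_mult, !Cmod_R, !Rabs_pos_eq in Ey by nra.
  assert (Y : (Cmod y <= 1)%R) by (assert (K := Cmod_ge_0 x); nra).
  rewrite Ey. assert (P : (0 <= 1 - l * l)%R) by nra.
  apply (Rmult_le_compat_l _ _ _ P) in Y. nra.
Qed.

Lemma Rle_of_sqr (a b : R) : (0 <= b)%R -> (a * a <= b * b)%R -> (a <= b)%R.
Proof. intros Hb H. destruct (Rle_or_lt a b); [assumption|]. nra. Qed.

(* With [rho = |x|^2] and [u = Re x], the difference of the squares of both sides is a convex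
   quadratic in [(rho, u)] minimised over [rho >= u^2] at [u = t / (3 (1 + t))], [rho = u^2],
   with value 0 and multiplier [4 s t^3 (1 - t) / 9]. *)
Lemma quadratic_modulus_le (t : R) (x : C) : (0 <= t <= 1)%R ->
  (t * Cmod (RtoC (- (1 - t * t)) * (x * x) + RtoC (2 / 3 * (1 - t * t)) * x + RtoC (t * t / 3)) <=
   t * t / 9 + 2 * (t * t * t) / 9 + (1 - t * t) * (Cmod x * Cmod x))%R.
Proof.
  intros Ht.
  assert (X := Cmod_sqr x).
  set (y := (RtoC (- (1 - t * t)) * (x * x) + RtoC (2 / 3 * (1 - t * t)) * x + RtoC (t * t / 3))%C).
  assert (Y := Cmod_sqr y).
  set (rho := (Cmod x * Cmod x)%R) in *.
  set (u := Re x) in *. set (v := Im x) in *.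
  assert (Ry : (Re y = - (1 - t * t) * (u * u - v * v) + 2 / 3 * (1 - t * t) * u + t * t / 3)%R).
  { unfold y, u, v, Cplus, Cmult, RtoC, Re, Im. simpl. ring. }
  assert (Iy : (Im y = - (1 - t * t) * (2 * u * v) + 2 / 3 * (1 - t * t) * v)%R).
  { unfold y, u, v, Cplus, Cmult, RtoC, Re, Im. simpl. ring. }
  rewrite Ry, Iy in Y.
  assert (Hrho : (0 <= rho)%R) by (unfold rho; apply Rmult_le_pos; apply Cmod_ge_0).
  assert (Hs : (0 <= 1 - t * t)%R) by nra.
  assert (Ht3 : (0 <= t * t * t)%R) by (repeat apply Rmult_le_pos; lra).
  apply Rle_of_sqr.
  { assert (0 <= (1 - t * t) * rho)%R by now apply Rmult_le_pos. nra. }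
  replace (t * Cmod y * (t * Cmod y))%R with (t * t * (Cmod y * Cmod y))%R by ring.
  rewrite Y. apply Rminus_le_0.
  set (p := (rho - t * t / (9 * ((1 + t) * (1 + t))))%R).
  set (q := (u - t / (3 * (1 + t)))%R).
  match goal with |- (0 <= ?D)%R => replace D with
    ((1 - t * t) * (4 / 9 * (t * t * t) * (1 - t) * (v * v) +
       ((1 - t * t) * p + 2 / 3 * (t * t) * q) * ((1 - t * t) * p + 2 / 3 * (t * t) * q) +
       (8 / 9 * (t * t * t) * t + 4 / 9 * (t * t * t) * (1 - t)) * (q * q)))%R end.
  - apply Rmult_le_pos; [exact Hs|].
    assert (0 <= v * v)%R by apply Rle_0_sqr. assert (0 <= q * q)%R by apply Rle_0_sqr.
    repeat apply Rplus_le_le_0_compat.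
    + apply Rmult_le_pos; [|lra]. apply Rmult_le_pos; lra.
    + apply Rle_0_sqr.
    + apply Rmult_le_pos; [|lra]. apply Rplus_le_le_0_compat; apply Rmult_le_pos; lra.
  - unfold p, q. rewrite X. field. lra.
Qed.

(** Writing x = w1^2 xi / |w1|^2 extracts the phase of w1^3 and leaves a quadratic in xi with real
    coefficients. The term (1 - t^2) |x|^2 in its bound is exactly what |y| <= 1 - |x|^2
    compensates. *)
Lemma third_coeff_le (w1 x y : C) : (Cmod w1 <= 1)%R -> (Cmod y <= 1 - Cmod x * Cmod x)%R ->
  (Cmod ((1 - Cmod w1 * Cmod w1)%R * (y - Cconj w1 * (x * x)) +
     RtoC (2 / 3) * w1 * ((1 - Cmod w1 * Cmod w1)%R * x) + RtoC (1 / 3) * (w1 * w1 * w1)) <=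
   1 - 8 / 9 * (Cmod w1 * Cmod w1) + 2 / 9 * (Cmod w1 * Cmod w1 * Cmod w1))%R.
Proof.
  intros Hw Hy. set (t := Cmod w1) in *. set (s := (1 - t * t)%R).
  assert (Ht : (0 <= t)%R) by apply Cmod_ge_0.
  assert (Hs : (0 <= s)%R) by (unfold s; nra).
  assert (Hx := Cmod_ge_0 x).
  assert (A : (Cmod (RtoC (- s) * (Cconj w1 * (x * x)) + RtoC (2 / 3 * s) * (w1 * x) + RtoC (1 / 3) * (w1 * w1 * w1)) <=
    t * t / 9 + 2 * (t * t * t) / 9 + s * (Cmod x * Cmod x))%R).
  { destruct (Ceq_dec w1 0) as [Z|Nz].
    - assert (T0 : t = 0%R) by (unfold t; rewrite Z; apply Cmod_0).
      replace (RtoC (- s) * (Cconj w1 * (x * x)) + RtoC (2 / 3 * s) * (w1 * x) + RtoC (1 / 3) * (w1 * w1 * w1))%C with (RtoC 0).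
      + rewrite Cmod_0, T0. assert (0 <= s * (Cmod x * Cmod x))%R by (apply Rmult_le_pos; [lra|nra]). lra.
      + rewrite Z. replace (Cconj 0) with (RtoC 0) by (unfold Cconj, RtoC; simpl; f_equal; ring). ring.
    - assert (Tp : (0 < t)%R) by now apply Cmod_gt_0.
      assert (Tn : RtoC t <> 0) by (apply RtoC_neq; lra).
      assert (Ec : Cconj w1 * w1 = RtoC t * RtoC t) by (rewrite conj_mult_self; apply RtoC_mult).
      set (xi := Cconj w1 * Cconj w1 * x / (t * t)).
      assert (Ex : x = w1 * w1 * xi / (t * t)).
      { unfold xi. transitivity ((Cconj w1 * w1) * (Cconj w1 * w1) * x / (t * t) / (t * t)); [|field; auto].
        rewrite Ec. field. auto. }
      assert (Mx : Cmod xi = Cmod x).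
      { unfold xi. rewrite Cmod_div, !Cmod_mult, Cmod_conj, Cmod_R, Rabs_pos_eq by (auto; now apply Cmult_neq_0).
        fold t. field. lra. }
      assert (L := quadratic_modulus_le t xi ltac:(lra)). rewrite Mx in L. fold s in L.
      eapply Rle_trans; [|exact L]. apply Req_le.
      replace (RtoC (- s) * (Cconj w1 * (x * x)) + RtoC (2 / 3 * s) * (w1 * x) + RtoC (1 / 3) * (w1 * w1 * w1))%C with
        (w1 * w1 * w1 / (t * t) * (RtoC (- s) * (xi * xi) + RtoC (2 / 3 * s) * xi + RtoC (t * t / 3)))%C.
      + rewrite (Cmod_mult (w1 * w1 * w1 / (t * t))). f_equal.
        rewrite Cmod_div, !Cmod_mult, Cmod_R, Rabs_pos_eq by (auto; now apply Cmult_neq_0).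
        fold t. field. lra.
      + replace (Cconj w1 * (x * x))%C with (w1 * w1 * w1 * (Cconj w1 * w1) * (xi * xi) / (t * t * (t * t)))%C
          by (rewrite Ex; field; auto).
        rewrite Ec. rewrite Ex at 1.
        replace (RtoC (t * t / 3)) with (RtoC t * RtoC t * RtoC (1 / 3)) by (rewrite <- !RtoC_mult; f_equal; field).
        field. auto. }
  replace (RtoC s * (y - Cconj w1 * (x * x)) + RtoC (2 / 3) * w1 * (s * x) + RtoC (1 / 3) * (w1 * w1 * w1))%C with
    (RtoC s * y + (RtoC (- s) * (Cconj w1 * (x * x)) + RtoC (2 / 3 * s) * (w1 * x) + RtoC (1 / 3) * (w1 * w1 * w1)))%C
    by (rewrite RtoC_opp, (RtoC_mult (2 / 3) s); ring).
  eapply Rle_trans; [apply Cmod_triangle|].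
  rewrite Cmod_mult, Cmod_R, Rabs_pos_eq by exact Hs.
  assert (s * Cmod y <= s * (1 - Cmod x * Cmod x))%R by (apply Rmult_le_compat_l; lra).
  unfold s in *. lra.
Qed.

(** Here h is w / z for a Schwarz function w, so its coefficients start with w1. If |w1| = 1 only
    w1^3 / 3 survives, and 1 - 8/9 + 2/9 = 1/3. *)
Lemma schwarz_coeff_bounds (h : C -> C) (w1 w2 w3 w4 : C) : hol h ->
  (forall z, unit_disk z -> (Cmod (h z) <= 1)%R) -> jet3 h w1 w2 w3 w4 ->
  (Cmod w1 <= 1)%R /\ (Cmod w2 <= 1 - Cmod w1 * Cmod w1)%R /\
  (Cmod (w3 + RtoC (2 / 3) * w1 * w2 + RtoC (1 / 3) * (w1 * w1 * w1)) <=
   1 - 8 / 9 * (Cmod w1 * Cmod w1) + 2 / 9 * (Cmod w1 * Cmod w1 * Cmod w1))%R.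
Proof.
  intros Hh Hb J. destruct (schur1 _ _ _ _ _ Hh Hb J) as [H1 H2].
  split; [exact H1|]. split; [exact H2|].
  destruct (Rle_lt_or_eq_dec _ _ H1) as [L|E].
  - destruct (schur2 _ _ _ _ _ Hh Hb J L) as [x [y [Ex [Ey [Hx Hy]]]]].
    rewrite Ex, Ey. now apply third_coeff_le.
  - destruct (schur2_extreme _ _ _ _ _ Hh Hb J E) as [-> ->].
    replace (0 + RtoC (2 / 3) * w1 * 0 + RtoC (1 / 3) * (w1 * w1 * w1))%C with (RtoC (1 / 3) * (w1 * w1 * w1))%C by ring.
    rewrite !Cmod_mult, E, Cmod_R, Rabs_pos_eq; lra.
Qed.

Lemma sqrt46 : (sqrt 46 * sqrt 46 = 46 /\ 6 < sqrt 46 < 7)%R.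
Proof.
  assert (H : (sqrt 46 * sqrt 46 = 46)%R) by (apply sqrt_sqrt; lra).
  assert (K := sqrt_pos 46). split; [exact H|]. split; nra.
Qed.

(* The difference vanishes to second order at [t = (8 - sqrt 46) / 6]. *)
Lemma cubic_bound (t : R) : (0 <= t <= 1)%R ->
  (1 / 4 * (1 - 8 / 9 * (t * t) + 2 / 9 * (t * t * t)) + t / 12 <= 1 / 972 * (95 + 23 * sqrt 46))%R.
Proof.
  intros Ht. destruct sqrt46 as [Hq Hq']. set (q := sqrt 46) in *.
  assert (Hq2 : (q ^ 2 = 46)%R) by (rewrite <- Hq; ring).
  apply Rminus_le_0.
  (* The remaining root (4 + sqrt 46) / 3 lies beyond 1. *)
  match goal with |- (0 <= ?D)%R => replace D with
    (1 / 18 * ((t - (8 - q) / 6) * (t - (8 - q) / 6)) * ((4 + q) / 3 - t))%R end.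
  - apply Rmult_le_pos; [|lra]. apply Rmult_le_pos; [lra|apply Rle_0_sqr].
  - field [Hq2].
Qed.

Lemma cubic_bound_attained : let t := ((8 - sqrt 46) / 6)%R in
  (1 / 4 * (1 - 8 / 9 * (t * t) + 2 / 9 * (t * t * t)) + t / 12 = 1 / 972 * (95 + 23 * sqrt 46))%R.
Proof.
  destruct sqrt46 as [Hq _]. simpl. set (q := sqrt 46) in *.
  assert (Hq2 : (q ^ 2 = 46)%R) by (rewrite <- Hq; ring). field [Hq2].
Qed.

(** * Univalent functions and odd starlike functions *)

Lemma ccont_inv (f : C -> C) (z : C) : f z <> 0 -> ccont f z -> ccont (fun u => / f u) z.
Proof. apply Clim_inv. tc. Qed.

(** The mean of 1 / q over the circle is at most 1 / m in modulus. The exceptional radius r0 is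
    there for difference quotients, whose differentiability at the base point is not known. *)
Lemma min_modulus_center (q : C -> C) (rho r0 m : R) : (0 < rho)%R -> (r0 < rho)%R -> (0 < m)%R ->
  (forall z, (Cmod z <= rho)%R -> ccont q z /\ q z <> 0) ->
  (forall z, (0 < Cmod z <= rho)%R -> Cmod z <> r0 -> exists l, cder q z l) ->
  (forall t, (0 <= t <= 2 * PI)%R -> (m <= Cmod (q (rho * cis t)%C))%R) -> (m <= Cmod (q 0))%R.
Proof.
  intros Hr Hr0 Hm Hq Dq Hc. assert (P := TwoPI_pos).
  assert (Cq : forall z, (Cmod z <= rho)%R -> ccont (fun z => / q z) z).
  { intros z Hz. destruct (Hq z Hz). now apply ccont_inv. }
  assert (M := mean_value (fun z => / q z) rho r0 Hr Hr0 Cq).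
  assert (I := circle_int_correct (fun z => / q z) rho (Rlt_le _ _ Hr) (fun z Hz => Cq z (Req_le _ _ Hz))).
  rewrite M in I.
  2:{ intros z Hz Nz. destruct (Dq z Hz Nz) as [l Hl]. eexists. apply cder_inv; [|exact Hl]. apply Hq. lra. }
  apply (is_CI_le _ 0 (2 * PI) (/ m)) in I; [|lra|].
  - rewrite Cmod_mult, Cmod_R, Rabs_pos_eq, Rminus_0_r in I by lra.
    apply Rmult_le_reg_l in I; [|lra].
    destruct (Hq 0 ltac:(rewrite Cmod_0; lra)) as [_ N0].
    rewrite Cmod_inv in I by auto. apply Cmod_gt_0 in N0.
    rewrite <- (Rinv_inv m), <- (Rinv_inv (Cmod (q 0))).
    apply Rinv_le_contravar; [now apply Rinv_0_lt_compat|exact I].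
  - intros t Ht. specialize (Hc t Ht). rewrite Cmod_inv by (apply Cmod_gt_0; lra).
    now apply Rinv_le_contravar.
Qed.

(** A quantitative open mapping statement, used where one would invoke the argument principle:
    without a zero, [min_modulus_center] would apply. *)
Lemma zero_in_disk (u : C -> C) (rho m : R) : hol u -> (0 < rho < 1)%R -> (0 < m)%R ->
  (forall t, (0 <= t <= 2 * PI)%R -> (m <= Cmod (u (rho * cis t)%C))%R) -> (Cmod (u 0) < m)%R ->
  exists z, (Cmod z <= rho)%R /\ u z = 0.
Proof.
  intros Hu Hr Hm Hc H0. apply NNPP. intros N.
  assert (Nz : forall z, (Cmod z <= rho)%R -> u z <> 0).
  { intros z Hz E. apply N. now exists z. }
  assert (L : (m <= Cmod (u 0))%R); [|lra].
  apply (min_modulus_center u rho (-1)); try lra; auto.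
  - intros z Hz. split; auto. apply hol_cont; auto. unfold unit_disk. lra.
  - intros z Hz _. exists (C_derive u z). apply hol_cder; auto. unfold unit_disk. lra.
Qed.

Lemma const_of_zero_derive (f : C -> C) (b : C) :
  (forall s, (0 <= s <= 1)%R -> cder f (s * b) 0) -> f b = f 0.
Proof.
  intros H.
  assert (I : is_CI (fun _ => RtoC 0) 0 1 (f (1 * b) - f (0 * b))).
  { apply (is_CI_derive (fun s => f (s * b))); [lra| |intros s _; apply rcont_const].
    intros s Hs. eapply der_eq; [apply rder_comp; [now apply H|]|].
    - apply (@der_ext R_UniformSpace _ _ (fun s : R => 0 + s * b)); [intros; ring|apply rder_linear].
    - ring. }
  assert (J := is_CI_const 0 0 1). apply is_CI_unique in I. apply is_CI_unique in J.
  rewrite I in J. rewrite Cmult_1_l, Cmult_0_l, Cmult_0_r in J. now apply Ceq_minus.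
Qed.

Lemma circle_in_disk (rho t : R) : (0 <= rho < 1)%R -> unit_disk (rho * cis t).
Proof. intros H. unfold unit_disk. rewrite Cmod_circle; lra. Qed.

Lemma univalent_lower_bound (u : C -> C) (rho : R) : hol u -> univalent u -> (0 < rho < 1)%R ->
  exists m, (0 < m)%R /\ forall t, (0 <= t <= 2 * PI)%R -> (m <= Cmod (u (rho * cis t)%C - u 0))%R.
Proof.
  intros Hu Inj Hr. assert (P := TwoPI_pos).
  destruct (rcont_bounded_below (fun t => u (rho * cis t) - u 0) 0 (2 * PI)) as [m [Hm Hb]].
  - lra.
  - intros t _. apply rcont_minus; [apply ccont_hol_rcont; auto; lra|apply rcont_const].
  - intros t _ E. apply Ceq_minus in E. apply Inj in E; [|apply circle_in_disk; lra|apply unit_disk_0].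
    apply (f_equal Cmod) in E. rewrite Cmod_circle, Cmod_0 in E; lra.
  - exists m. split; [exact Hm|]. exact Hb.
Qed.

(** If [u'(0) = 0], the difference quotients of [u] at nearby points [b] with
    [u'(b) <> 0] have no zeros, so they are bounded below at [0], where they tend to [0]. *)
Lemma univalent_derive_0 (u : C -> C) : hol u -> univalent u -> C_derive u 0 <> 0.
Proof.
  intros Hu Inj D0.
  assert (Hhalf : (0 < 1 / 2 < 1)%R) by lra.
  destruct (univalent_lower_bound u (1 / 2) Hu Inj Hhalf) as [m [Hm Hb]].
  assert (C0 : cder u (RtoC 0) 0) by (eapply der_eq; [apply hol_cder; auto; apply unit_disk_0|exact D0]).
  assert (He1 : (0 < m / 4)%R) by lra.
  destruct (cder_lim u 0 0 C0 _ He1) as [d1 Hd1].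
  set (d := Rmin d1 (1 / 4)).
  assert (Hd : (0 < d)%R) by (apply Rmin_pos; [apply cond_pos|lra]).
  assert (Hdl : (d <= d1)%R) by apply Rmin_l. assert (Hdr : (d <= 1 / 4)%R) by apply Rmin_r.
  assert (Small : forall b, (Cmod b < d)%R -> (Cmod (u b - u 0) <= m / 4 * Cmod b)%R).
  { intros b Hb'. assert (L := Hd1 b).
    replace (b - 0) with b in L by ring. replace (u b - u 0 - b * 0) with (u b - u 0) in L by ring.
    apply L. change (Cmod (b - 0) < d1)%R. replace (b - 0) with b by ring. lra. }
  assert (Ex : exists b, (Cmod b < d)%R /\ C_derive u b <> 0).
  (* Otherwise u' vanishes near 0, u is constant on a segment, and injectivity fails. *)
  { apply NNPP. intros N.
    assert (Cb : Cmod (RtoC (d / 2)) = (d / 2)%R) by (rewrite Cmod_R; apply Rabs_pos_eq; lra).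
    assert (E : u (RtoC (d / 2)) = u 0).
    { apply const_of_zero_derive. intros s Hs.
      assert (Cs : (Cmod (s * RtoC (d / 2)) < d)%R).
      { rewrite Cmod_mult, Cb, Cmod_R, Rabs_pos_eq by lra. nra. }
      replace (RtoC 0) with (C_derive u (s * RtoC (d / 2))).
      - apply hol_cder; auto. unfold unit_disk. lra.
      - apply NNPP. intros N'. apply N. now exists (s * RtoC (d / 2)). }
    apply Inj in E; [|unfold unit_disk; lra|apply unit_disk_0].
    apply RtoC_inj in E. lra. }
  destruct Ex as [b [Hbd Nb]].
  assert (Nb0 : b <> 0) by (intros ->; contradiction).
  assert (Pb : (0 < Cmod b)%R) by now apply Cmod_gt_0.
  assert (Db : unit_disk b) by (unfold unit_disk; lra).
  destruct (hol_cder u b Hu Db) as [q [Hq [Hqb H]]].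
  assert (Nq : forall z, unit_disk z -> q z <> 0).
  { intros z Hz E. destruct (Ceq_dec z b) as [->|Nz]; [now rewrite Hqb in E|].
    apply Nz, Inj; auto. rewrite (H z), E. ring. }
  assert (Dq : forall z, unit_disk z -> z <> b -> exists l, cder q z l).
  { intros z Hz Nz. eexists.
    apply (cder_ext_loc (fun x => (u x - u b) / (x - b))).
    - apply Cminus_eq_contra in Nz.
      assert (L := Clim_neq0 (@locally CU z) (fun x => x - b) (z - b) Nz).
      generalize (L (Clim_minus _ _ _ _ _ (Clim_id z) (Clim_const _ b))). apply filter_imp.
      intros x Hx. rewrite (H x).
      assert (x - b <> 0).
      { apply Cmod_gt_0. assert (K' := Cmod_ge_0 (z - b)). lra. }
      field. auto.
    - apply cder_div; [now apply Cminus_eq_contra| |].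
      + apply cder_minus; [now apply hol_cder|apply cder_const].
      + apply cder_minus; [apply cder_id|apply cder_const]. }
  assert (L : (m / 2 <= Cmod (q (RtoC 0)))%R).
  { apply (min_modulus_center q (1 / 2) (Cmod b)); try lra.
    - intros z Hz. assert (Hz' : unit_disk z) by (unfold unit_disk; lra). split; [|now apply Nq].
      destruct (Ceq_dec z b) as [->|Nz]; [unfold ccont; now rewrite Hqb|].
      destruct (Dq z Hz' Nz) as [l Hl]. eapply cder_cont; eauto.
    - intros z Hz Nz. apply Dq; [unfold unit_disk; lra|]. now intros ->.
    - intros t Ht. set (z := (1 / 2)%R * cis t).
      assert (Cz : Cmod z = (1 / 2)%R) by (apply Cmod_circle; lra).
      assert (E : u z - u 0 = (z - b) * q z + (u b - u 0)) by (rewrite (H z); ring).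
      assert (L1 := Hb t Ht). fold z in L1. rewrite E in L1.
      assert (L2 := Cmod_triangle ((z - b) * q z) (u b - u 0)). rewrite Cmod_mult in L2.
      assert (L3 := Small b Hbd).
      assert (L4 : (Cmod (z - b) <= 1)%R).
      { eapply Rle_trans; [apply Cmod_triangle|]. rewrite Cmod_opp. lra. }
      assert (K := Cmod_ge_0 (q z)). nra. }
  (* The right side is at most (m / 4) |b|, against |q 0| >= m / 2. *)
  assert (E : b * q (RtoC 0) = u b - u 0) by (rewrite (H (RtoC 0)); ring).
  apply (f_equal Cmod) in E. rewrite Cmod_mult in E. assert (L3 := Small b Hbd). nra.
Qed.

(** The affine map sends 0 to a and the disc into itself; it reduces statements at a to statements
    at 0. *)
Lemma disk_rescale (a z : C) : unit_disk a -> unit_disk z -> unit_disk (a + (1 - Cmod a)%R * z).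
Proof.
  unfold unit_disk. intros Ha Hz. assert (K := Cmod_ge_0 a).
  eapply Rle_lt_trans; [apply Cmod_triangle|]. rewrite Cmod_mult, Cmod_R, Rabs_pos_eq by lra. nra.
Qed.

Lemma hol_rescale (f : C -> C) (a : C) : unit_disk a -> hol f ->
  hol (fun z => f (a + (1 - Cmod a)%R * z)).
Proof.
  intros Ha Hf. apply (hol_comp f (fun z => a + (1 - Cmod a)%R * z)); auto.
  - intros z Hz. now apply disk_rescale.
  - apply hol_plus; [apply hol_const|]. apply hol_mult; [apply hol_const|apply hol_id].
Qed.

Lemma univalent_rescale (f : C -> C) (a : C) : unit_disk a -> univalent f ->
  univalent (fun z => f (a + (1 - Cmod a)%R * z)).
Proof.
  intros Ha Inj z w Hz Hw E. apply Inj in E; try now apply disk_rescale.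
  apply (Cmult_reg_l (1 - Cmod a)%R); [apply RtoC_neq; unfold unit_disk in Ha; lra|].
  transitivity (a + (1 - Cmod a)%R * z - a); [ring|]. rewrite E. ring.
Qed.

Lemma univalent_derive (f : C -> C) (a : C) : hol f -> univalent f -> unit_disk a -> C_derive f a <> 0.
Proof.
  intros Hf Inj Ha E.
  apply (univalent_derive_0 _ (hol_rescale f a Ha Hf) (univalent_rescale f a Ha Inj)).
  apply cder_C_derive. eapply der_eq.
  - apply (cder_comp _ (fun z => a + (1 - Cmod a)%R * z) f).
    + replace (a + (1 - Cmod a)%R * 0) with a by ring. now apply hol_cder.
    + apply cder_plus; [apply cder_const|]. apply cder_mult; [apply cder_const|apply cder_id].
  - cbv beta. rewrite E. ring.
Qed.

(** Here phi is f^-1 composed with h. For z near z0, [zero_in_disk] finds a preimage of h z within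
    eps of phi z0, and injectivity identifies it with phi z. *)
Lemma univalent_inverse_cont (f phi h : C -> C) (z0 : C) : hol f -> univalent f -> unit_disk z0 ->
  (forall z, unit_disk z -> unit_disk (phi z) /\ f (phi z) = h z) -> ccont h z0 -> ccont phi z0.
Proof.
  intros Hf Inj Hz0 Hphi Hh eps He.
  set (a := phi z0). destruct (Hphi z0 Hz0) as [Da Ea]. fold a in Da, Ea.
  set (rho := Rmin (1 / 2) (eps / 2)).
  assert (Hr : (0 < rho)%R) by (apply Rmin_pos; lra).
  assert (Hr1 : (rho <= 1 / 2)%R) by apply Rmin_l. assert (Hr2 : (rho <= eps / 2)%R) by apply Rmin_r.
  set (u := fun z => f (a + (1 - Cmod a)%R * z)).
  assert (Hu : hol u) by now apply hol_rescale.
  assert (Iu : univalent u) by now apply univalent_rescale.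
  destruct (univalent_lower_bound u rho Hu Iu ltac:(lra)) as [m [Hm Hb]].
  assert (U0 : u 0 = h z0) by (unfold u; rewrite <- Ea; f_equal; ring).
  assert (Hm2 : (0 < m / 2)%R) by lra.
  generalize (filter_and _ _ (locally_disk z0 Hz0) (Hh _ Hm2)). apply filter_imp.
  intros z [Hz Hhz]. destruct (Hphi z Hz) as [Dp Ep].
  destruct (zero_in_disk (fun x => u x - h z) rho (m / 2)) as [x [Hx Ex]]; try lra.
  - apply hol_minus; [auto|apply hol_const].
  - intros t Ht. specialize (Hb t Ht).
    assert (L := Cmod_rev_triangle (u (rho * cis t) - u 0) (h z - h z0)).
    rewrite U0 in *.
    replace (u (rho * cis t) - h z0 - (h z - h z0)) with (u (rho * cis t) - h z) in L by ring. lra.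
  - rewrite U0, Cmod_minus_sym. exact Hhz.
  - apply Ceq_minus in Ex. rewrite <- Ep in Ex. unfold u in Ex.
    apply Inj in Ex; [|apply disk_rescale; auto; unfold unit_disk; lra|auto].
    rewrite <- Ex. replace (a + (1 - Cmod a)%R * x - a) with ((1 - Cmod a)%R * x) by ring.
    assert (K := Cmod_ge_0 a). assert (K' := Cmod_ge_0 x). unfold unit_disk in Da.
    rewrite Cmod_mult, Cmod_R, Rabs_pos_eq by lra. nra.
Qed.

(** With the quotients q of f at phi z0 and r of h at z0, (phi z - phi z0) q(phi z) = (z - z0) r(z).
    Continuity of phi and f' <> 0 then allow division by q(phi z). *)
Lemma univalent_lift_hol (f phi h : C -> C) : hol f -> univalent f -> hol h ->
  (forall z, unit_disk z -> unit_disk (phi z) /\ f (phi z) = h z) -> hol phi.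
Proof.
  intros Hf Inj Hh Hphi. apply hol_intro. intros z0 Hz0.
  assert (Cphi := univalent_inverse_cont f phi h z0 Hf Inj Hz0 Hphi (hol_cont h z0 Hh Hz0)).
  destruct (Hphi z0 Hz0) as [Da Ea].
  assert (Na := univalent_derive f (phi z0) Hf Inj Da).
  destruct (hol_cder f (phi z0) Hf Da) as [q [Hq [Hqa H]]].
  destruct (hol_cder h z0 Hh Hz0) as [r [Hr [Hrz K]]].
  assert (Cq : Clim (@locally CU z0) (fun z => q (phi z)) (C_derive f (phi z0))).
  { rewrite <- Hqa. apply (ccont_comp phi q z0 Cphi). unfold ccont. now rewrite Hqa. }
  exists (r z0 * / q (phi z0)).
  apply (cder_ext_loc (fun z => phi z0 + (z - z0) * (r z * / q (phi z)))).
  - generalize (filter_and _ _ (locally_disk z0 Hz0) (Clim_neq0 _ _ _ Na Cq)). apply filter_imp.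
    intros z [Hz Nz]. destruct (Hphi z Hz) as [_ Ez].
    assert (Nq : q (phi z) <> 0).
    { apply Cmod_gt_0. assert (X := Cmod_ge_0 (C_derive f (phi z0))). lra. }
    assert (E : (phi z - phi z0) * q (phi z) = (z - z0) * r z).
    { transitivity (f (phi z) - f (phi z0)); [rewrite (H (phi z)); ring|].
      rewrite Ez, Ea, (K z). ring. }
    transitivity (phi z0 + (z - z0) * r z * / q (phi z)); [ring|]. rewrite <- E. field. auto.
  - exists (fun z => r z * / q (phi z)). split; [|split; [reflexivity|]].
    + rewrite Hrz, Hqa. apply Clim_mult; [tc|exact Hr|]. apply Clim_inv; [tc|exact Na|exact Cq].
    + intros z. ring.
Qed.

Lemma jet3_reflect (f : C -> C) (a0 a1 a2 a3 : C) : jet3 f a0 a1 a2 a3 ->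
  jet3 (fun z => f (- z)) a0 (- a1) a2 (- a3).
Proof.
  intros [k [Hk Ek]].
  assert (Dn : forall z, unit_disk z -> unit_disk (- z)) by (intros z; unfold unit_disk; now rewrite Cmod_opp).
  exists (fun z => k (- z)). split.
  - apply (hol_comp k (fun z => - z)); auto. apply hol_opp, hol_id.
  - intros z Hz. rewrite Ek by auto. ring.
Qed.

Lemma odd_jet3 (g : C -> C) (a0 a1 a2 a3 : C) : jet3 g a0 a1 a2 a3 ->
  (forall z, unit_disk z -> g (- z) = - g z) -> a2 = 0.
Proof.
  intros J Odd.
  assert (J1 := jet3_reflect _ _ _ _ _ J).
  assert (J2 := jet3_scal (- (1)) _ _ _ _ _ J).
  apply (jet3_ext _ (fun z => g (- z))) in J2.
  - destruct (jet3_unique _ _ _ _ _ _ _ _ _ J1 J2) as [_ [_ [E _]]].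
    apply (Cmult_reg_l 2); [apply RtoC_neq; lra|].
    transitivity (a2 + a2); [ring|]. rewrite E at 1. ring.
  - intros z Hz. rewrite Odd by auto. ring.
Qed.

Lemma class_A_jet3 (g : C -> C) : class_A g -> exists b2 b3, jet3 g 0 1 b2 b3.
Proof.
  intros [Hg [G0 G1]]. exists (dqn 2 g 0), (dqn 3 g 0).
  assert (J := hol_jet3 g Hg). rewrite G0 in J.
  replace (dqn 1 g 0) with (RtoC 1) in J; [exact J|].
  simpl. unfold dq. destruct (Ceq_dec 0 0); [now symmetry|congruence].
Qed.

(** Schur's inequality for [g^-1 (t g z) / z = t + (t - t^3) b3 z^2 + ...], as [t -> 1]. *)
Lemma odd_starlike_coeff (g : C -> C) (b2 b3 : C) : odd_starlike g -> jet3 g 0 1 b2 b3 ->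
  b2 = 0 /\ (Cmod b3 <= 1)%R.
Proof.
  intros [[[[Hg [G0 G1]] Inj] Star] Odd] J.
  assert (B2 := odd_jet3 _ _ _ _ _ J Odd). split; [exact B2|].
  apply (le_of_scaled _ _ 0); [apply Cmod_ge_0|]. intros t Ht. rewrite Rmult_0_l, Rplus_0_r.
  (* Outside the disc 0 is a default value; the totality makes phi a function on all of [C]. *)
  assert (Ex : forall z, exists w, unit_disk z -> unit_disk w /\ g w = t * g z).
  { intros z. destruct (classic (unit_disk z)) as [Hz|Nz]; [|now exists 0].
    destruct (Star (g z) t) as [w Hw]; [now exists z|lra|]. now exists w. }
  set (phi z := proj1_sig (constructive_indefinite_description _ (Ex z))).
  assert (Hphi : forall z, unit_disk z -> unit_disk (phi z) /\ g (phi z) = t * g z).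
  { intros z. unfold phi. destruct (constructive_indefinite_description _ (Ex z)). auto. }
  assert (Hp : hol phi).
  { apply (univalent_lift_hol g phi (fun z => t * g z)); auto. apply hol_mult; [apply hol_const|auto]. }
  assert (P0 : phi 0 = 0).
  { destruct (Hphi 0 unit_disk_0) as [D E]. apply Inj; auto using unit_disk_0. rewrite E, G0. ring. }
  set (om := dq phi).
  assert (Ho : hol om) by now apply hol_dq.
  assert (Eo : forall z, phi z = z * om z).
  { intros z. rewrite (dq_eq phi z), P0. unfold om. ring. }
  assert (Bo : forall z, unit_disk z -> (Cmod (om z) <= 1)%R).
  { apply schwarz_quotient; auto. intros z Hz. rewrite <- Cmod_mult, <- Eo.
    left. now apply (Hphi z Hz). }
  destruct (hol_jet3_ex om Ho) as [o1 [o2 [o3 Jo]]]. set (o0 := om 0) in *.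
  assert (Jp : jet3 phi 0 o0 o1 o2).
  { apply (jet3_ext (fun z => z * om z)); [|eapply jet3_shift; exact Jo]. intros z _. now rewrite Eo. }
  destruct J as [k [Hk Ek]].
  assert (Jt : jet3 (fun z => t * g z) (t * 0) (t * 1) (t * b2) (t * b3)).
  { apply jet3_scal. now exists k. }
  (* The quartic remainder of g taken at phi z = z om z; it is divisible by z^4. *)
  assert (JK : jet3 (fun z => z ^ 4 * (om z ^ 4 * k (phi z))) 0 0 0 0).
  { exists (fun z => om z ^ 4 * k (phi z)). split.
    - apply hol_mult; [now apply hol_pow|]. apply hol_comp; auto. intros z Hz. now apply Hphi.
    - intros z _. ring. }
  assert (Jg := jet3_plus _ _ _ _ _ _ _ _ _ _ Jp (jet3_plus _ _ _ _ _ _ _ _ _ _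
     (jet3_scal b3 _ _ _ _ _ (jet3_mult _ _ _ _ _ _ _ _ _ _ Jp (jet3_mult _ _ _ _ _ _ _ _ _ _ Jp Jp))) JK)).
  apply (jet3_ext _ (fun z => t * g z)) in Jg.
  - destruct (jet3_unique _ _ _ _ _ _ _ _ _ Jg Jt) as [_ [F1 [F2 F3]]].
    rewrite B2 in F2.
    assert (E0 : o0 = t) by (rewrite <- (Cmult_1_r t), <- F1; ring).
    assert (E1 : o1 = 0) by (rewrite <- (Cmult_0_r t), <- F2; ring).
    assert (E2 : o2 = b3 * (t - t * (t * t))).
    { transitivity (t * b3 - b3 * (o0 * (o0 * o0))); [rewrite <- F3; ring|]. rewrite E0. ring. }
    assert (M0 : Cmod o0 = t) by (rewrite E0, Cmod_R; apply Rabs_pos_eq; lra).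
    destruct (schur2 om o0 o1 o2 o3 Ho Bo Jo ltac:(lra)) as [x [y [X [Y [_ Hy]]]]].
    rewrite M0, E1 in X. rewrite M0, E2 in Y.
    assert (Q : (0 < 1 - t * t)%R) by nra.
    assert (X0 : x = 0).
    { destruct (Cmult_integral _ _ (eq_sym X)) as [Z|]; [|auto]. apply RtoC_inj in Z. lra. }
    rewrite X0 in Y, Hy. rewrite Cmod_0 in Hy.
    apply (f_equal Cmod) in Y.
    replace (b3 * (t - t * (t * t))) with (RtoC (t * (1 - t * t)) * b3) in Y by (rewrite !RtoC_mult, RtoC_minus, RtoC_mult; ring).
    replace (y - Cconj o0 * (0 * 0)) with y in Y by ring.
    rewrite !Cmod_mult, !Cmod_R, !Rabs_pos_eq in Y by nra.
    (* [Y] reads t (1 - t^2) |b3| = (1 - t^2) |y| with |y| <= 1. *)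
    apply (Rmult_le_reg_l (1 - t * t)); [exact Q|]. nra.
  - intros z Hz. destruct (Hphi z Hz) as [Dp Ep]. rewrite <- Ep, (Ek _ Dp), B2.
    rewrite (Eo z) at 5. rewrite <- (Eo z) at 1. simpl. rewrite (Eo z). ring.
Qed.

(** * Logarithmic coefficients *)

Definition is_Cseries (a : nat -> C) (l : C) : Prop := @is_series C_AbsRing C_NormedModule a l.

Definition Csum (a : nat -> C) (n : nat) : C := @sum_n C_AbelianMonoid a n.

Lemma Csum_O (a : nat -> C) : Csum a 0 = a O.
Proof. exact (@sum_O C_AbelianMonoid a). Qed.

Lemma Csum_S (a : nat -> C) (n : nat) : Csum a (S n) = Csum a n + a (S n).
Proof. exact (@sum_Sn C_AbelianMonoid a n). Qed.

Lemma is_Cseries_lim (a : nat -> C) (l : C) : is_Cseries a l ->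
  forall eps, (0 < eps)%R -> exists N, forall n, (N <= n)%nat ->
    (Cmod (Csum a n - l) < eps)%R.
Proof.
  intros H eps He. assert (He2 : (0 < eps / 2)%R) by lra.
  destruct (proj1 (filterlim_locally (U := C_UniformSpace) (F := eventually) _ l) H (mkposreal _ He2)) as [N HN].
  exists N. intros n Hn. destruct (HN n Hn) as [H1 H2].
  change (Rabs (Re (Csum a n) - Re l) < eps / 2)%R in H1.
  change (Rabs (Im (Csum a n) - Im l) < eps / 2)%R in H2.
  eapply Rle_lt_trans; [apply Cmod_le_abs_parts|].
  change (Rabs (Re (Csum a n) - Re l) + Rabs (Im (Csum a n) - Im l) < eps)%R.
  lra.
Qed.

Lemma is_Cseries_bounded_terms (a : nat -> C) (l : C) : is_Cseries a l ->
  exists B, (0 < B)%R /\ forall n, (Cmod (a n) <= B)%R.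
Proof.
  intros H.
  assert (Bd : forall N, exists B, forall n, (n <= N)%nat -> (Cmod (a n) <= B)%R).
  { induction N as [|N [B HB]].
    - exists (Cmod (a O)). intros n Hn. replace n with O by lia. lra.
    - exists (Rmax B (Cmod (a (S N)))). intros n Hn. destruct (Nat.eq_dec n (S N)) as [->|Ne]; [apply Rmax_r|].
      eapply Rle_trans; [apply HB; lia|apply Rmax_l]. }
  destruct (is_Cseries_lim a l H 1 Rlt_0_1) as [N HN].
  destruct (Bd (S N)) as [B HB].
  exists (Rmax B 2). split; [eapply Rlt_le_trans; [|apply Rmax_r]; lra|]. intros n.
  destruct (Nat.le_gt_cases n (S N)) as [L|L]; [eapply Rle_trans; [apply HB, L|apply Rmax_l]|].
  destruct n as [|n]; [lia|].
  assert (H1 := HN n ltac:(lia)). assert (H2 := HN (S n) ltac:(lia)).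
  rewrite Csum_S in H2.
  eapply Rle_trans; [|apply Rmax_r].
  replace (a (S n)) with ((Csum a n + a (S n) - l) + - (Csum a n - l)) by ring.
  eapply Rle_trans; [apply Cmod_triangle|]. rewrite Cmod_opp.
  lra.
Qed.

(** Convergence at 1/2 bounds the terms, so at a small x > 0 the sum differs from c 0 by a geometric
    tail of order x. The point z = 0 is excluded so that the statement survives the division by z in
    [power_series_zero_shift]. *)
Lemma power_series_zero_head (c : nat -> C) :
  (forall z, unit_disk z -> z <> 0 -> is_Cseries (fun n => c n * z ^ n) 0) -> c O = 0.
Proof.
  intros H.
  assert (Dh : unit_disk (1 / 2)%R) by (unfold unit_disk; rewrite Cmod_R, Rabs_pos_eq; lra).
  destruct (is_Cseries_bounded_terms _ _ (H _ Dh ltac:(apply RtoC_neq; lra))) as [B [HB Hb]].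
  apply Cmod_eq_0. apply Rle_antisym; [|apply Cmod_ge_0].
  apply le_epsilon. intros eps He. rewrite Rplus_0_l.
  (* Makes the tail bound 4 B x at most eps / 2. *)
  set (x := Rmin (1 / 4) (eps / (8 * B))).
  assert (Hx : (0 < x)%R) by (apply Rmin_pos; [lra|apply Rdiv_lt_0_compat; lra]).
  assert (Hx1 : (x <= 1 / 4)%R) by apply Rmin_l.
  assert (Hx2 : (x <= eps / (8 * B))%R) by apply Rmin_r.
  assert (Hx3 : (4 * B * x <= eps / 2)%R).
  { apply (Rmult_le_compat_l (4 * B)) in Hx2; [|lra].
    replace (4 * B * (eps / (8 * B)))%R with (eps / 2)%R in Hx2 by (field; lra). exact Hx2. }
  assert (T : forall n, (Cmod (c n * RtoC x ^ n) <= B * (2 * x) ^ n)%R).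
  { intros n. specialize (Hb n). rewrite Cmod_mult, Cmod_pow, Cmod_R, Rabs_pos_eq in * by lra.
    assert (E : (Cmod (c n) * x ^ n = Cmod (c n) * (1 / 2) ^ n * (2 * x) ^ n)%R).
    { rewrite Rmult_assoc, <- Rpow_mult_distr. f_equal. f_equal. field. }
    rewrite E. apply Rmult_le_compat_r; [apply pow_le; lra|exact Hb]. }
  set (y := (2 * x)%R) in *. assert (Hy : (0 < y <= 1 / 2)%R) by (unfold y; lra).
  assert (S : forall N, (Cmod (Csum (fun n => c n * RtoC x ^ n)%C N - c O) <= B * (2 * y - 2 * y ^ (N + 1)))%R).
  { induction N as [|N IH].
    - rewrite Csum_O. simpl. replace (c O * 1 - c O) with (RtoC 0) by ring. rewrite Cmod_0. lra.
    - rewrite Csum_S.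
      replace (Csum (fun n => c n * RtoC x ^ n) N + c (S N) * RtoC x ^ S N - c O) with
        ((Csum (fun n => c n * RtoC x ^ n) N - c O) + c (S N) * RtoC x ^ S N) by ring.
      eapply Rle_trans; [apply Cmod_triangle|].
      assert (L := T (S N)).
      assert (Py : (0 <= y ^ (N + 1))%R) by (apply pow_le; lra).
      replace (S N) with (N + 1)%nat in L at 3 by lia.
      replace (S N + 1)%nat with (S (N + 1)) by lia. simpl pow.
      assert (y * y ^ (N + 1) <= 1 / 2 * y ^ (N + 1))%R by (apply Rmult_le_compat_r; lra).
      assert (B * (y * y ^ (N + 1)) <= B * (1 / 2 * y ^ (N + 1)))%R by (apply Rmult_le_compat_l; lra).
      lra. }
  assert (Dx : unit_disk x) by (unfold unit_disk; rewrite Cmod_R, Rabs_pos_eq; lra).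
  assert (He2 : (0 < eps / 2)%R) by lra.
  destruct (is_Cseries_lim _ _ (H (RtoC x) Dx ltac:(apply RtoC_neq; lra)) _ He2) as [N HN].
  specialize (HN N (Nat.le_refl N)). specialize (S N).
  set (s := Csum (fun n => c n * RtoC x ^ n) N) in *.
  replace (s - 0) with s in HN by ring.
  replace (c O) with (s + - (s - c O)) by ring.
  eapply Rle_trans; [apply Cmod_triangle|]. rewrite Cmod_opp.
  assert (Py : (0 <= B * y ^ (N + 1))%R) by (apply Rmult_le_pos; [lra|apply pow_le; lra]).
  unfold y in S at 1. lra.
Qed.

Lemma power_series_zero_shift (c : nat -> C) :
  (forall z, unit_disk z -> z <> 0 -> is_Cseries (fun n => c n * z ^ n) 0) ->
  forall z, unit_disk z -> z <> 0 -> is_Cseries (fun n => c (S n) * z ^ n) 0.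
Proof.
  intros H z Hz Nz. assert (C0 := power_series_zero_head c H).
  assert (K : is_Cseries (fun n => c (S n) * z ^ S n) 0).
  { apply (is_series_incr_1 (fun n => c n * z ^ n)).
    change (is_Cseries (fun n => c n * z ^ n) (0 + c O * z ^ 0)).
    rewrite C0. replace (0 + 0 * z ^ 0) with (RtoC 0) by ring. now apply H. }
  apply (is_series_scal (/ z)) in K.
  change (is_Cseries (fun n => / z * (c (S n) * z ^ S n)) (/ z * 0)) in K.
  rewrite Cmult_0_r in K. revert K. apply is_series_ext. intros n. simpl.
  change (/ z * (c (S n) * (z * z ^ n)) = c (S n) * z ^ n). field. auto.
Qed.

Lemma power_series_zero (n : nat) (c : nat -> C) :
  (forall z, unit_disk z -> z <> 0 -> is_Cseries (fun n => c n * z ^ n) 0) -> c n = 0.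
Proof.
  revert c. induction n as [|n IH]; intros c H; [now apply power_series_zero_head|].
  apply (IH (fun k => c (S k))). now apply power_series_zero_shift.
Qed.

Lemma log_coefficients_dqn (L : C -> C) (gamma : nat -> C) (n : nat) : hol L ->
  (forall z, unit_disk z -> exists s, is_Cseries (fun n => gamma (S n) * z ^ S n) s /\ L z = 2 * s) ->
  dqn (S n) L 0 = 2 * gamma (S n).
Proof.
  intros HL H.
  (* Index 0 carries L 0 alone, since the series of [gamma] starts at 1. *)
  set (c k := match k with O => dqn 0 L 0 | S _ => dqn k L 0 - 2 * gamma k end).
  enough (Z : c (S n) = 0) by (apply Ceq_minus; exact Z).
  apply power_series_zero. intros z Hz _. destruct (H z Hz) as [s [Hs E]].
  apply (is_series_decr_1 (fun n => c n * z ^ n)).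
  assert (T' : is_Cseries (fun n => dqn (S n) L 0 * z ^ S n) (L z + - (dqn 0 L 0 * z ^ 0))).
  { apply (is_series_incr_1 (fun n => dqn n L 0 * z ^ n)).
    change (is_Cseries (fun n => dqn n L 0 * z ^ n) (L z + - (dqn 0 L 0 * z ^ 0) + dqn 0 L 0 * z ^ 0)).
    replace (L z + - (dqn 0 L 0 * z ^ 0) + dqn 0 L 0 * z ^ 0) with (L z) by ring.
    now apply taylor_series. }
  assert (M := is_series_minus _ _ _ _ T' (is_series_scal (2 : C) _ _ Hs)).
  change (is_Cseries (fun n => dqn (S n) L 0 * z ^ S n + - (2 * (gamma (S n) * z ^ S n)))
     (L z + - (dqn 0 L 0 * z ^ 0) + - (2 * s))) in M.
  change (is_Cseries (fun n => (dqn (S n) L 0 - 2 * gamma (S n)) * z ^ S n) (0 + - (dqn 0 L 0 * z ^ 0))).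
  replace (0 + - (dqn 0 L 0 * z ^ 0)) with (L z + - (dqn 0 L 0 * z ^ 0) + - (2 * s)) by (rewrite E; ring).
  revert M. apply is_series_ext. intros k.
  change (dqn (S k) L 0 * z ^ S k + - (2 * (gamma (S k) * z ^ S k)) = (dqn (S k) L 0 - 2 * gamma (S k)) * z ^ S k).
  ring.
Qed.

Lemma log_branch_coefficients (f L : C -> C) : is_log_branch f L ->
  log_coefficients f (fun n => dqn n L 0 / 2).
Proof.
  intros HL. exists L. split; [exact HL|]. destruct HL as [HL [L0 _]]. intros z Hz. exists (L z / 2).
  split; [|field].
  apply (is_series_incr_1 (fun n => dqn n L 0 / 2 * z ^ n)).
  change (is_Cseries (fun n => dqn n L 0 / 2 * z ^ n) (L z / 2 + L 0 / 2 * z ^ 0)).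
  rewrite L0. replace (L z / 2 + 0 / 2 * z ^ 0) with (/ 2 * L z) by (simpl; field).
  assert (T := is_series_scal (/ 2 : C) _ _ (taylor_series L z HL Hz)).
  revert T. apply is_series_ext. intros n.
  change (/ 2 * (dqn n L 0 * z ^ n) = dqn n L 0 / 2 * z ^ n). field.
Qed.

(** The squares of |p + 1| and |p - 1| differ by 4 Re p. *)
Lemma Re_pos_cayley (p : C) : (0 < Re p)%R -> p + 1 <> 0 /\ (Cmod ((p - 1) / (p + 1)) < 1)%R.
Proof.
  intros H.
  assert (N : p + 1 <> 0).
  { intros E. apply (f_equal Re) in E. rewrite re_plus, !re_RtoC in E. lra. }
  split; [exact N|]. rewrite Cmod_div by exact N. assert (N' := N). apply Cmod_gt_0 in N'.
  apply (Rlt_div_l _ _ _ N'). rewrite Rmult_1_l.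
  assert (A := Cmod_sqr (p - 1)). assert (B := Cmod_sqr (p + 1)).
  destruct p as [x y]. unfold Cminus, Cplus, Copp, RtoC, Re, Im in *. simpl in *.
  set (a := Cmod (x + - (1), y + - 0)%R) in *. set (b := Cmod (x + 1, y + 0)%R) in *.
  assert (0 <= a)%R by apply Cmod_ge_0. nra.
Qed.

Lemma class_A_dq (g : C -> C) (z : C) : class_A g -> univalent g -> unit_disk z ->
  dq g z <> 0 /\ dq g 0 = 1 /\ g z = z * dq g z.
Proof.
  intros [Hg [G0 G1]] Inj Hz.
  assert (D0 : dq g 0 = 1) by (unfold dq; destruct (Ceq_dec 0 0); [exact G1|congruence]).
  assert (E : g z = z * dq g z) by (rewrite (dq_eq g z), G0 at 1; ring).
  split; [|now split]. intros Z. destruct (Ceq_dec z 0) as [->|Nz].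
  - rewrite D0 in Z. now apply C1_nz.
  - apply Nz. apply Inj; auto using unit_disk_0. rewrite E, Z, G0. ring.
Qed.

Lemma log_branch_factor (f L : C -> C) (z : C) : f 0 = 0 -> is_log_branch f L -> unit_disk z ->
  f z = z * Cexp (L z).
Proof.
  intros F0 [_ [_ H]] Hz. rewrite (H z Hz). unfold quot.
  destruct (Ceq_dec z 0) as [->|N]; [rewrite F0; ring|]. field. auto.
Qed.

(* Comparing coefficients in [E (1 + z L') (1 - w) = (g / z) (1 + w)], where [E = exp L = f / z]. *)
Lemma log_coefficient_relations (f g L h : C -> C) (b3 w1 w2 w3 w4 : C) :
  class_A f -> is_log_branch f L -> hol h -> jet3 h w1 w2 w3 w4 -> hol g -> g 0 = 0 -> jet3 g 0 1 0 b3 ->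
  (forall z, unit_disk z -> g (- z) = - g z) ->
  (forall z, unit_disk z -> C_derive f z * (1 - z * h z) = dq g z * (1 + z * h z)) ->
  dqn 1 L 0 = w1 /\ dqn 2 L 0 = (2 * w2 + w1 * w1 / 2 + b3) / 3 /\
  dqn 3 L 0 = (w3 + RtoC (2 / 3) * w1 * w2 + RtoC (1 / 3) * (w1 * w1 * w1)) / 2 + w1 * b3 / 6.
Proof.
  intros [Hf [F0 F1]] HLb Hh Jh Hg G0 Jg Odd Rel.
  assert (HL : hol L) by apply HLb. assert (L0 : L 0 = 0) by apply HLb.
  assert (JL := hol_jet3 L HL). rewrite L0 in JL.
  set (l1 := dqn 1 L 0) in *. set (l2 := dqn 2 L 0) in *. set (l3 := dqn 3 L 0) in *.
  set (E := fun z => Cexp (L z)).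
  assert (DE : forall z, unit_disk z -> cder E z (Cexp (L z) * C_derive L z)).
  { intros z Hz. apply (cder_comp z L Cexp); [apply cder_Cexp|now apply hol_cder]. }
  assert (HE : hol E) by (apply hol_intro; intros z Hz; eexists; now apply DE).
  assert (E0 : E 0 = 1) by (unfold E; rewrite L0; apply Cexp_0).
  assert (JE := hol_jet3 E HE). rewrite E0 in JE.
  set (e1 := dqn 1 E 0) in *. set (e2 := dqn 2 E 0) in *. set (e3 := dqn 3 E 0) in *.
  destruct (jet3_derive _ _ _ _ _ JL) as [l4 JL'].
  destruct (jet3_derive _ _ _ _ _ JE) as [e4 JE'].
  assert (X1 := jet3_mult _ _ _ _ _ _ _ _ _ _ JE JL').
  apply (jet3_ext _ (C_derive E)) in X1; [|intros z Hz; symmetry; apply cder_C_derive; now apply DE].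
  (* From E' = E L', the coefficients of E in terms of those of L. *)
  destruct (jet3_unique _ _ _ _ _ _ _ _ _ JE' X1) as [R1 [R2 [R3 _]]].
  assert (JA := jet3_mult _ _ _ _ _ _ _ _ _ _ JE (jet3_plus _ _ _ _ _ _ _ _ _ _ (jet3_const 1) (jet3_shift _ _ _ _ _ JL'))).
  assert (Jw := jet3_shift _ _ _ _ _ Jh).
  assert (JB := jet3_mult _ _ _ _ _ _ _ _ _ _ JA (jet3_plus _ _ _ _ _ _ _ _ _ _ (jet3_const 1) (jet3_scal (- (1)) _ _ _ _ _ Jw))).
  assert (JG := hol_jet3 (dq g) (hol_dq g Hg)).
  set (c0 := dq g 0) in *. set (c1 := dqn 1 (dq g) 0) in *. set (c2 := dqn 2 (dq g) 0) in *. set (c3 := dqn 3 (dq g) 0) in *.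
  assert (Jg' := jet3_shift _ _ _ _ _ JG).
  apply (jet3_ext _ g) in Jg'; [|intros z _; symmetry; rewrite (dq_eq g z), G0 at 1; ring].
  destruct (jet3_unique _ _ _ _ _ _ _ _ _ Jg' Jg) as [_ [C0 [C1 C2]]].
  assert (JC := jet3_mult _ _ _ _ _ _ _ _ _ _ JG (jet3_plus _ _ _ _ _ _ _ _ _ _ (jet3_const 1) Jw)).
  assert (Df : forall z, unit_disk z -> C_derive f z = E z * (1 + z * C_derive L z)).
  { intros z Hz. symmetry. rewrite (C_derive_ext_disk f (fun z => z * E z)); auto.
    - symmetry. apply cder_C_derive. eapply der_eq; [apply cder_mult; [apply cder_id|now apply DE]|].
      unfold E. cbv beta. ring.
    - intros x Hx. now apply log_branch_factor. }
  apply (jet3_ext _ (fun z => dq g z * (1 + z * h z))) in JB.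
  2:{ intros z Hz. rewrite <- Rel, Df by auto. ring. }
  destruct (jet3_unique _ _ _ _ _ _ _ _ _ JB JC) as [_ [Q1 [Q2 Q3]]].
  (* This is the fourth coefficient of g, beyond its jet; it vanishes because g / z is even. *)
  assert (C3 : c3 = 0).
  { assert (J := jet3_reflect _ _ _ _ _ JG).
    apply (jet3_ext _ (dq g)) in J.
    - destruct (jet3_unique _ _ _ _ _ _ _ _ _ J JG) as [_ [_ [_ E3]]].
      apply (Cmult_reg_l 2); [apply RtoC_neq; lra|].
      transitivity (c3 + c3); [ring|]. rewrite <- E3 at 1. ring.
    - intros z Hz. destruct (Ceq_dec z 0) as [->|Nz]; [f_equal; ring|].
      apply (Cmult_reg_l (- z)); [intros Z; apply Nz; replace z with (- - z) by ring; rewrite Z; ring|].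
      transitivity (g (- z)); [rewrite (dq_eq g (- z)), G0 at 1; ring|].
      rewrite (Odd z Hz), (dq_eq g z), G0 at 1. ring. }
  rewrite C0 in Q1, Q2, Q3. rewrite C1 in Q1, Q2, Q3. rewrite C2 in Q2, Q3. rewrite C3 in Q3.
  assert (N2 : RtoC 2 <> 0) by (apply RtoC_neq; lra).
  assert (N3 : RtoC 3 <> 0) by (apply RtoC_neq; lra).
  assert (N6 : RtoC 6 <> 0) by (apply RtoC_neq; lra).
  assert (E1 : e1 = l1) by (rewrite R1; ring).
  assert (S1 : l1 = w1).
  { apply (Cmult_reg_l 2); auto. apply Ceq_minus.
    match type of Q1 with ?a = ?b => transitivity (a - b); [rewrite E1; ring|rewrite Q1; ring] end. }
  assert (E2 : e2 = l2 + l1 * l1 / 2).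
  { apply (Cmult_reg_l 2); auto. rewrite R2, E1. field. }
  assert (S2 : l2 = (2 * w2 + w1 * w1 / 2 + b3) / 3).
  { apply (Cmult_reg_l 3); auto. apply Ceq_minus.
    match type of Q2 with ?a = ?b => transitivity (a - b); [rewrite E2, E1, S1; field|rewrite Q2; ring] end. }
  assert (E3 : e3 = l3 + 2 / 3 * l2 * l1 + l1 * e2 / 3).
  { apply (Cmult_reg_l 3); auto. rewrite R3, E1. field. }
  split; [exact S1|]. split; [exact S2|].
  rewrite !RtoC_div by lra.
  apply (Cmult_reg_l 4); [apply RtoC_neq; lra|]. apply Ceq_minus.
  match type of Q3 with ?a = ?b => transitivity (a - b); [rewrite E3, E2, E1, S1, S2; field|rewrite Q3; ring] end.
Qed.

(** * Bounds and extremal functions *)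

Lemma Cmod_half (a b : C) : a = 2 * b -> Cmod b = (Cmod a / 2)%R.
Proof. intros ->. rewrite Cmod_mult, Cmod_R, Rabs_pos_eq; lra. Qed.

Lemma coefficient_bounds (f : C -> C) (gamma : nat -> C) : class_F f -> log_coefficients f gamma ->
  (Cmod (gamma 1%nat) <= 1 / 2)%R /\ (Cmod (gamma 2%nat) <= 1 / 2)%R /\
  (Cmod (gamma 3%nat) <= 1 / 972 * (95 + 23 * sqrt 46))%R.
Proof.
  intros [HfA [g [Hgos Hre]]] [L [HLb Hser]].
  assert (HfA' := HfA). destruct HfA' as [Hf [F0 F1]].
  assert (Hgos' := Hgos). destruct Hgos' as [[[HgA Inj] Star] Odd].
  assert (HgA' := HgA). destruct HgA' as [Hg [G0 G1]].
  destruct (class_A_jet3 g HgA) as [b2 [b3 Jg]].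
  destruct (odd_starlike_coeff g b2 b3 Hgos Jg) as [-> Hb3].
  (* Cancelling z in z f' / g makes p holomorphic at 0 as well. *)
  set (p := fun z => C_derive f z / dq g z).
  assert (Ng : forall z, unit_disk z -> dq g z <> 0).
  { intros z Hz. now apply class_A_dq. }
  assert (Hp : hol p).
  { apply hol_div; auto; [now apply hol_C_derive|now apply hol_dq]. }
  assert (P0 : p 0 = 1).
  { unfold p. destruct (class_A_dq g 0 HgA Inj unit_disk_0) as [_ [-> _]]. rewrite F1. field. }
  assert (Rp : forall z, unit_disk z -> (0 < Re (p z))%R).
  { intros z Hz. specialize (Hre z Hz). unfold quot in Hre. destruct (Ceq_dec z 0) as [->|Nz].
    - rewrite P0. exact Hre.
    - destruct (class_A_dq g z HgA Inj Hz) as [Nd [_ E]]. rewrite E in Hre.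
      replace (p z) with (z * C_derive f z / (z * dq g z)); [exact Hre|]. unfold p. field. auto. }
  set (w := fun z => (p z - 1) / (p z + 1)).
  assert (Hw : hol w).
  { apply hol_div; [intros z Hz; now apply Re_pos_cayley, Rp| |].
    - apply (hol_minus p (fun _ => 1)); [auto|apply hol_const].
    - apply (hol_plus p (fun _ => 1)); [auto|apply hol_const]. }
  assert (W0 : w 0 = 0) by (unfold w; rewrite P0; field; apply RtoC_neq; lra).
  set (h := dq w).
  assert (Ew : forall z, w z = z * h z) by (intros z; rewrite (dq_eq w z), W0; unfold h; ring).
  assert (Hh : hol h) by now apply hol_dq.
  assert (Bh : forall z, unit_disk z -> (Cmod (h z) <= 1)%R).
  { apply schwarz_quotient; auto. intros z Hz. rewrite <- Cmod_mult, <- Ew. left. now apply Re_pos_cayley, Rp. }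
  destruct (hol_jet3_ex h Hh) as [w2 [w3 [w4 Jh]]]. set (w1 := h 0) in *.
  destruct (log_coefficient_relations f g L h b3 w1 w2 w3 w4) as [R1 [R2 R3]]; auto.
  { intros z Hz. rewrite <- Ew. unfold w. destruct (Re_pos_cayley _ (Rp z Hz)) as [N _].
    replace (C_derive f z) with (p z * dq g z) by (unfold p; field; auto). field. auto. }
  rewrite (log_coefficients_dqn L gamma 0) in R1 by (auto; apply HLb).
  rewrite (log_coefficients_dqn L gamma 1) in R2 by (auto; apply HLb).
  rewrite (log_coefficients_dqn L gamma 2) in R3 by (auto; apply HLb).
  destruct (schwarz_coeff_bounds h w1 w2 w3 w4 Hh Bh Jh) as [B1 [B2 B3]].
  assert (K := Cmod_ge_0 w1). set (t := Cmod w1) in *.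
  rewrite (Cmod_half _ _ (eq_sym R1)), (Cmod_half _ _ (eq_sym R2)), (Cmod_half _ _ (eq_sym R3)).
  split; [fold t; lra|]. split.
  - rewrite Cmod_div, Cmod_R, Rabs_pos_eq by (try apply RtoC_neq; lra).
    (* The numerator is at most 2 (1 - t^2) + t^2 / 2 + 1 <= 3. *)
    assert (T1 := Cmod_triangle (2 * w2 + w1 * w1 / 2) b3).
    assert (T2 := Cmod_triangle (2 * w2) (w1 * w1 / 2)).
    rewrite Cmod_div, !Cmod_mult, !Cmod_R, !Rabs_pos_eq in T2 by (try apply RtoC_neq; lra).
    fold t in T2. nra.
  - assert (T := Cmod_triangle ((w3 + RtoC (2 / 3) * w1 * w2 + RtoC (1 / 3) * (w1 * w1 * w1)) / 2) (w1 * b3 / 6)).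
    rewrite !Cmod_div, (Cmod_mult w1 b3), !Cmod_R, !Rabs_pos_eq in T by (try apply RtoC_neq; lra).
    fold t in T. assert (Cb := cubic_bound t ltac:(lra)).
    assert (t * Cmod b3 <= t * 1)%R by (apply Rmult_le_compat_l; lra). lra.
Qed.

(** * Logarithms and the odd Koebe function *)

Lemma log_branch_exists (E : C -> C) : hol E -> (forall z, unit_disk z -> E z <> 0) -> E 0 = 1 ->
  exists L, hol L /\ L 0 = 0 /\ forall z, unit_disk z -> Cexp (L z) = E z.
Proof.
  intros HE NE E0.
  destruct (hol_primitive (fun z => C_derive E z / E z)) as [L [L0 DL]].
  { apply hol_div; auto. now apply hol_C_derive. }
  exists L. split; [apply hol_intro; intros z Hz; eexists; now apply DL|]. split; [exact L0|].
  intros z Hz.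
  (* L is a primitive of E' / E, so Q has derivative 0. *)
  set (Q := fun z => E z * Cexp (- L z)).
  assert (Ez : Q z = Q 0).
  { apply const_of_zero_derive. intros s Hs.
    assert (Ds := disk_scale s z Hs Hz). eapply der_eq.
    - apply cder_mult; [now apply hol_cder|].
      apply (cder_comp _ (fun z => - L z) Cexp); [apply cder_Cexp|]. apply cder_opp. now apply DL.
    - cbv beta. field. now apply NE. }
  unfold Q in Ez. rewrite L0, E0 in Ez.
  replace (- 0) with (RtoC 0) in Ez by ring. rewrite Cexp_0 in Ez.
  assert (X := Cexp_plus (L z) (- L z)). replace (L z + - L z) with (RtoC 0) in X by ring. rewrite Cexp_0 in X.
  apply (Cmult_reg_l (Cexp (- L z))); [apply Cexp_nz|].
  rewrite Cmult_comm, <- X, (Cmult_comm _ (E z)), Ez. ring.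
Qed.

(** The bound on Im c keeps s c in the strip |Im| < PI / 2 for 0 <= s <= 1, so that exp (s c) stays
    in the right half-plane. *)
Lemma log_right_half_plane (v : C) : (0 < Re v)%R ->
  exists c, Cexp c = v /\ (- PI / 2 < Im c < PI / 2)%R.
Proof.
  intros Hv. exists (ln (Cmod v), atan (Im v / Re v)). split; [|apply atan_bound].
  assert (Nv : (0 < Cmod v)%R) by (eapply Rlt_le_trans; [exact Hv|apply Re_le_Cmod]).
  unfold Cexp. simpl. rewrite exp_ln by exact Nv. rewrite cos_atan, sin_atan.
  assert (S : (Cmod v = Re v * sqrt (1 + Rsqr (Im v / Re v)))%R).
  { rewrite <- (sqrt_pow2 (Re v)) at 1 by lra. rewrite <- sqrt_mult_alt by apply pow2_ge_0.
    unfold Cmod. f_equal. unfold Rsqr, Re, Im in *. field. lra. }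
  assert (P : (0 < sqrt (1 + Rsqr (Im v / Re v)))%R).
  { apply sqrt_lt_R0. assert (0 <= Rsqr (Im v / Re v))%R by apply Rle_0_sqr. lra. }
  rewrite S. set (r := sqrt _) in *.
  apply injective_projections; simpl; fold (Re v) (Im v); field; lra.
Qed.

Lemma one_minus_sqr_nz (z : C) : unit_disk z -> 1 - z * z <> 0.
Proof.
  intros Hz E. apply Ceq_minus in E. apply (f_equal Cmod) in E. rewrite Cmod_1, Cmod_mult in E.
  unfold unit_disk in Hz. assert (K := Cmod_ge_0 z). nra.
Qed.

Lemma cayley_Re_pos (w : C) : (Cmod w < 1)%R -> 1 - w <> 0 /\ (0 < Re ((1 + w) / (1 - w)))%R.
Proof.
  intros H.
  assert (N : 1 - w <> 0).
  { intros E. apply Ceq_minus in E. apply (f_equal Cmod) in E. rewrite Cmod_1 in E. lra. }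
  split; [exact N|].
  assert (M : (0 < Cmod (1 - w))%R) by now apply Cmod_gt_0.
  assert (M2 := Cmod_sqr (1 - w)). assert (W2 := Cmod_sqr w). assert (K := Cmod_ge_0 w).
  assert (NC : Cconj (1 - w) <> 0) by (apply Cmod_gt_0; now rewrite Cmod_conj).
  assert (Q : (0 < Cmod (1 - w) * Cmod (1 - w))%R) by nra.
  replace ((1 + w) / (1 - w)) with (RtoC (/ (Cmod (1 - w) * Cmod (1 - w))) * ((1 + w) * Cconj (1 - w))).
  - rewrite re_scal_l. apply Rmult_lt_0_compat; [now apply Rinv_0_lt_compat|].
    destruct w as [x y]. unfold Cminus, Cplus, Copp, Cconj, Cmult, RtoC, Re, Im in *. simpl in *. nra.
  - rewrite RtoC_inv by lra. rewrite <- conj_mult_self. field. auto.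
Qed.

(** The square-root transform of the Koebe function k(z) = z / (1 - z)^2: its square is k(z^2). Its
    third coefficient attains |b3| = 1. *)
Definition koebe2 (z : C) : C := z / (1 - z * z).

Lemma hol_koebe2 : hol koebe2.
Proof.
  apply hol_div; [apply one_minus_sqr_nz|apply hol_id|].
  apply hol_minus; [apply hol_const|]. apply hol_mult; apply hol_id.
Qed.

Lemma koebe2_jet3 : jet3 koebe2 0 1 0 1.
Proof.
  exists (fun z => z * / (1 - z * z)). split.
  - apply (hol_ext koebe2); [reflexivity|exact hol_koebe2].
  - intros z Hz. unfold koebe2. assert (N := one_minus_sqr_nz z Hz). field. auto.
Qed.

Lemma koebe2_class_A : class_A koebe2.
Proof.
  split; [exact hol_koebe2|].
  assert (K0 : koebe2 0 = 0) by (unfold koebe2; field; apply one_minus_sqr_nz, unit_disk_0).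
  split; [exact K0|].
  destruct (jet3_unique _ _ _ _ _ _ _ _ _ koebe2_jet3 (hol_jet3 _ hol_koebe2)) as [_ [E _]].
  rewrite E. simpl. unfold dq. destruct (Ceq_dec 0 0); [reflexivity|congruence].
Qed.

Lemma koebe2_univalent : univalent koebe2.
Proof.
  intros z u Hz Hu E. unfold koebe2 in E.
  assert (Nz := one_minus_sqr_nz z Hz). assert (Nu := one_minus_sqr_nz u Hu).
  assert (F : (z - u) * (1 + z * u) = 0).
  { transitivity ((z / (1 - z * z) - u / (1 - u * u)) * ((1 - z * z) * (1 - u * u))); [field; auto|].
    rewrite E. ring. }
  destruct (Cmult_integral _ _ F) as [Z|Z]; [now apply Ceq_minus|exfalso].
  assert (E1 : z * u = - (1)) by (transitivity (1 + z * u - 1); [ring|rewrite Z; ring]).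
  apply (f_equal Cmod) in E1. rewrite Cmod_m1, Cmod_mult in E1. unfold unit_disk in *.
  assert (K := Cmod_ge_0 z). assert (K' := Cmod_ge_0 u). nra.
Qed.

Lemma sqrt_right_half_plane (v : C) : ~ (Im v = 0 /\ (Re v <= 0)%R) ->
  exists s, s * s = v /\ (0 < Re s)%R.
Proof.
  intros H. assert (M := Cmod_sqr v). assert (K := Cmod_ge_0 v).
  assert (P : (0 < Cmod v + Re v)%R).
  { destruct (Rlt_or_le 0 (Cmod v + Re v)) as [|N]; [assumption|exfalso]. apply H.
    assert (B := Re_le_Cmod (- v)). rewrite Cmod_opp in B. change (Re (- v)) with (- Re v)%R in B.
    split; [|lra]. assert (E : (Cmod v = - Re v)%R) by lra. rewrite E in M. nra. }
  set (a := sqrt ((Cmod v + Re v) / 2)).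
  assert (Pa : (0 < a)%R) by (apply sqrt_lt_R0; lra).
  assert (Sa : (a * a = (Cmod v + Re v) / 2)%R) by (apply sqrt_sqrt; lra).
  exists (a, (Im v / (2 * a))%R). split; [|exact Pa].
  assert (Ei : (Im v / (2 * a) * (Im v / (2 * a)) = (Cmod v - Re v) / 2)%R).
  { replace (Im v / (2 * a) * (Im v / (2 * a)))%R with (Im v * Im v / (4 * (a * a)))%R by (field; lra).
    rewrite Sa. replace (Im v * Im v)%R with ((Cmod v - Re v) * (Cmod v + Re v))%R by lra. field. lra. }
  apply injective_projections; simpl.
  - rewrite Sa, Ei. unfold Re. field.
  - unfold Im. field. lra.
Qed.

(* For [w] in the image, [1 + 4 w^2] is the square of [(1 + z^2) / (1 - z^2)], hence off
   [(-oo, 0]]; this persists for [t w], and [z = 2 w / (1 + sqrt (1 + 4 w^2))] inverts. *)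
Lemma koebe2_starlike : starlike_wrt_origin (disk_image koebe2).
Proof.
  intros w t [z [Hz Ew]] Ht.
  destruct (Req_dec t 0) as [->|Nt].
  { exists 0. split; [apply unit_disk_0|]. rewrite Cmult_0_l. apply koebe2_class_A. }
  assert (Nz := one_minus_sqr_nz z Hz).
  assert (Hzz : (Cmod (z * z) < 1)%R).
  { rewrite Cmod_mult. unfold unit_disk in Hz. assert (K := Cmod_ge_0 z). nra. }
  destruct (cayley_Re_pos (z * z) Hzz) as [_ Rq]. set (q := (1 + z * z) / (1 - z * z)) in *.
  assert (Eq : 1 + 4 * (w * w) = q * q).
  { rewrite <- Ew. unfold koebe2, q. field. auto. }
  destruct (sqrt_right_half_plane (1 + RtoC (4 * (t * t)) * (w * w))) as [s [Es Rs]].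
  { intros [Hi Hr].
    assert (Eqr : (Re q * Re q - Im q * Im q = 1 + 4 * Re (w * w))%R).
    { apply (f_equal Re) in Eq. destruct q as [x y].
      rewrite re_plus, re_RtoC, re_scal_l in Eq. simpl in *. unfold Re, Im in *. simpl in *. lra. }
    assert (Eqi : (2 * Re q * Im q = 4 * Im (w * w))%R).
    { apply (f_equal Im) in Eq. destruct q as [x y].
      rewrite im_plus, im_RtoC, im_scal_l in Eq. unfold Re, Im in *. simpl in *. lra. }
    rewrite re_plus, re_RtoC, re_scal_l in Hr. rewrite im_plus, im_RtoC, im_scal_l in Hi.
    assert (T : (0 < t * t <= 1)%R) by nra.
    assert (Wi : Im (w * w) = 0%R) by (apply (Rmult_eq_reg_l (4 * (t * t))); lra).
    rewrite Wi in Eqi. assert (Qi : Im q = 0%R) by nra. rewrite Qi in Eqr.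
    set (r := Re (w * w)) in *. assert (0 < Re q * Re q)%R by nra.
    destruct (Rle_or_lt 0 r); nra. }
  assert (N1 : 1 + s <> 0).
  { intros E. apply (f_equal Re) in E. rewrite re_plus, !re_RtoC in E. lra. }
  assert (N2 : s + 1 <> 0) by (rewrite Cplus_comm; auto).
  exists (2 * (t * w) / (1 + s)).
  (* The square of the candidate is the Cayley image of s, hence in the disc because Re s > 0. *)
  assert (Zz : 2 * (t * w) / (1 + s) * (2 * (t * w) / (1 + s)) = (s - 1) / (s + 1)).
  { transitivity ((s * s - 1) / ((1 + s) * (1 + s))).
    - rewrite Es, !RtoC_mult. field. auto.
    - field. auto. }
  assert (D : unit_disk (2 * (t * w) / (1 + s))).
  { destruct (Re_pos_cayley s Rs) as [_ B]. rewrite <- Zz, Cmod_mult in B. unfold unit_disk.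
    assert (K := Cmod_ge_0 (2 * (t * w) / (1 + s))). nra. }
  split; [exact D|]. unfold koebe2. rewrite Zz.
  field. repeat split; auto.
  intros E. apply (RtoC_neq 2 0); [lra|]. rewrite <- E. ring.
Qed.

Lemma koebe2_odd_starlike : odd_starlike koebe2.
Proof.
  split; [split; [split; [exact koebe2_class_A|exact koebe2_univalent]|exact koebe2_starlike]|].
  intros z Hz. unfold koebe2. assert (N := one_minus_sqr_nz z Hz). field. exact N.
Qed.

(* Along the preimage of the segment [[0, artanh z]] under artanh, the derivative of
   [2 f / c], where [c = 2 artanh z], is [p]. *)
Lemma close_to_convex_nonzero (f p : C -> C) (z : C) : f 0 = 0 -> hol p ->
  (forall z, unit_disk z -> cder f z (p z / (1 - z * z))) ->
  (forall z, unit_disk z -> (0 < Re (p z))%R) -> unit_disk z -> z <> 0 -> f z <> 0.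
Proof.
  intros F0 Hp Df Rp Hz Nz E.
  destruct (cayley_Re_pos z Hz) as [N1 Rv].
  destruct (log_right_half_plane _ Rv) as [c [Ec Ic]].
  assert (Nc : c <> 0).
  { intros ->. rewrite Cexp_0 in Ec. apply Nz.
    apply (Cmult_reg_l 2); [apply RtoC_neq; lra|].
    transitivity ((1 + z) / (1 - z) * (1 - z) - (1 - z)); [field; auto|]. rewrite <- Ec. ring. }
  set (e := fun s : R => Cexp (s * c)).
  assert (Re_e : forall s, (0 <= s <= 1)%R -> (0 < Re (e s))%R).
  { intros s Hs. change (Re (e s)) with (exp (Re (s * c)) * cos (Im (s * c)))%R.
    apply Rmult_lt_0_compat; [apply exp_pos|]. rewrite im_scal_l. apply cos_gt_0; nra. }
  (* This is tanh (s c / 2). Its derivative is (c / 2) (1 - zeta^2), which cancels the denominator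
     of f'. *)
  set (zeta := fun s : R => (e s - 1) / (e s + 1)).
  assert (Dz : forall s, (0 <= s <= 1)%R -> unit_disk (zeta s)).
  { intros s Hs. apply Re_pos_cayley. now apply Re_e. }
  assert (De : forall s, rder e s (e s * c)).
  { intros s. unfold e. eapply der_eq; [apply (rder_comp _ (fun s : R => s * c) Cexp); [apply cder_Cexp|]|reflexivity].
    apply (@der_ext R_UniformSpace _ _ (fun s : R => 0 + s * c)); [intros; ring|apply rder_linear]. }
  assert (Dzeta : forall s, (0 <= s <= 1)%R -> rder zeta s (2 * c * e s / ((e s + 1) * (e s + 1)))).
  { intros s Hs. destruct (Re_pos_cayley _ (Re_e s Hs)) as [N _].
    eapply der_eq.
    - apply (rder_comp _ e (fun x => (x - 1) / (x + 1))); [|apply De].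
      apply cder_div; [exact N| |].
      + apply cder_minus; [apply cder_id|apply cder_const].
      + apply cder_plus; [apply cder_id|apply cder_const].
    - cbv beta. field. auto. }
  assert (Cp : rcont_on (fun s => p (zeta s)) 0 1).
  { intros s Hs. apply rcont_comp; [eapply rder_cont; now apply Dzeta|]. apply hol_cont; auto. }
  assert (I : is_CI (fun s => p (zeta s)) 0 1 (2 / c * f (zeta 1) - 2 / c * f (zeta 0))).
  { apply (is_CI_derive (fun s => 2 / c * f (zeta s))); auto; [lra|].
    intros s Hs. destruct (Re_pos_cayley _ (Re_e s Hs)) as [N _].
    assert (Ns := one_minus_sqr_nz _ (Dz s Hs)).
    eapply der_eq.
    - apply rder_scal. apply (rder_comp _ zeta f); [apply Df; auto|now apply Dzeta].
    - assert (E4 : 1 - zeta s * zeta s = 4 * e s / ((e s + 1) * (e s + 1))) by (unfold zeta; field; auto).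
      rewrite E4. assert (Ne : e s <> 0) by apply Cexp_nz. field.
      repeat split; auto; apply RtoC_neq; lra. }
  assert (Z0 : zeta 0 = 0).
  { unfold zeta, e. rewrite Cmult_0_l, Cexp_0. field. }
  assert (Z1 : zeta 1 = z).
  { unfold zeta, e. rewrite Cmult_1_l, Ec. field. split; [exact N1|].
    intros X. apply (RtoC_neq 2 0); [lra|]. rewrite <- X. ring. }
  rewrite Z0, Z1, E, F0 in I.
  replace (2 / c * 0 - 2 / c * 0) with (RtoC 0) in I by ring. destruct I as [I _].
  apply (is_RInt_unique (V := R_CompleteNormedModule)) in I. change (Re 0) with 0%R in I.
  assert (Pos : (0 < RInt (fun t => Re (p (zeta t))) 0 1)%R).
  { apply RInt_gt_0; [lra| |].
    - intros s Hs. apply Rp, Dz. lra.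
    - intros s Hs. destruct (Clim_ReIm _ _ _ (Cp s Hs)) as [H1 _]. exact H1. }
  lra.
Qed.

(** Here g is [koebe2], so b3 = 1, and f is the primitive of p / (1 - z^2) with p = (1 + z h) / (1 -
    z h). *)
Lemma extremal_function (h : C -> C) (w1 w2 w3 w4 : C) : hol h ->
  (forall z, unit_disk z -> (Cmod (h z) <= 1)%R) -> jet3 h w1 w2 w3 w4 ->
  exists f gamma, class_F f /\ log_coefficients f gamma /\
    2 * gamma 1%nat = w1 /\ 2 * gamma 2%nat = (2 * w2 + w1 * w1 / 2 + 1) / 3 /\
    2 * gamma 3%nat = (w3 + RtoC (2 / 3) * w1 * w2 + RtoC (1 / 3) * (w1 * w1 * w1)) / 2 + w1 * 1 / 6.
Proof.
  intros Hh Bh Jh.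
  assert (Bw : forall z, unit_disk z -> (Cmod (z * h z) < 1)%R).
  { intros z Hz. rewrite Cmod_mult. specialize (Bh z Hz). unfold unit_disk in Hz.
    assert (K := Cmod_ge_0 z). assert (K' := Cmod_ge_0 (h z)). nra. }
  set (p := fun z => (1 + z * h z) / (1 - z * h z)).
  assert (Hzh : hol (fun z => z * h z)) by (apply hol_mult; [apply hol_id|auto]).
  assert (Hp : hol p).
  { apply hol_div; [intros z Hz; now apply cayley_Re_pos, Bw| |].
    - apply (hol_plus (fun _ => 1)); [apply hol_const|auto].
    - apply (hol_minus (fun _ => 1)); [apply hol_const|auto]. }
  assert (Rp : forall z, unit_disk z -> (0 < Re (p z))%R) by (intros z Hz; now apply cayley_Re_pos, Bw).
  assert (P0 : p 0 = 1).
  { unfold p. rewrite Cmult_0_l. field. }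
  destruct (hol_primitive (fun z => p z / (1 - z * z))) as [f [F0 Df]].
  { apply hol_div; [apply one_minus_sqr_nz|auto|].
    apply (hol_minus (fun _ => 1)); [apply hol_const|]. apply hol_mult; apply hol_id. }
  assert (Hf : hol f) by (apply hol_intro; intros z Hz; eexists; now apply Df).
  assert (Df' : forall z, unit_disk z -> C_derive f z = p z / (1 - z * z)) by (intros z Hz; apply cder_C_derive; now apply Df).
  assert (F1 : C_derive f 0 = 1).
  { rewrite Df' by apply unit_disk_0. rewrite P0. field. }
  assert (HfA : class_A f) by (split; [exact Hf|split; [exact F0|exact F1]]).
  assert (Hq : forall z : C, z <> 0 -> dq f z = f z / z).
  { intros z Nz. unfold dq. destruct (Ceq_dec z 0); [contradiction|]. rewrite F0. field. auto. }
  assert (Q0 : dq f 0 = 1) by (unfold dq; destruct (Ceq_dec 0 0); [exact F1|congruence]).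
  destruct (log_branch_exists (dq f)) as [L [HL [L0 EL]]]; [now apply hol_dq| |exact Q0|].
  { intros z Hz E. destruct (Ceq_dec z 0) as [->|Nz]; [rewrite Q0 in E; now apply C1_nz|].
    rewrite (Hq z Nz) in E. apply (close_to_convex_nonzero f p z F0 Hp Df Rp Hz Nz).
    replace (f z) with (z * (f z / z)) by (field; auto). rewrite E. ring. }
  assert (HLb : is_log_branch f L).
  { split; [exact HL|]. split; [exact L0|]. intros z Hz. rewrite EL by auto. unfold quot.
    destruct (Ceq_dec z 0) as [->|Nz]; [exact Q0|now apply Hq]. }
  exists f, (fun n => dqn n L 0 / 2).
  split; [|split].
  - split; [exact HfA|]. exists koebe2. split; [exact koebe2_odd_starlike|]. intros z Hz.
    unfold quot. destruct (Ceq_dec z 0) as [->|Nz]; [simpl; lra|].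
    replace (z * C_derive f z / koebe2 z) with (p z); [now apply Rp|].
    rewrite Df' by auto. unfold koebe2. assert (N := one_minus_sqr_nz z Hz). field. auto.
  - now apply log_branch_coefficients.
  - assert (N2 : RtoC 2 <> 0) by (apply RtoC_neq; lra).
    destruct (log_coefficient_relations f koebe2 L h 1 w1 w2 w3 w4) as [R1 [R2 R3]]; auto.
    + exact hol_koebe2.
    + apply koebe2_class_A.
    + exact koebe2_jet3.
    + apply koebe2_odd_starlike.
    + intros z Hz. rewrite Df' by auto.
      destruct (class_A_dq koebe2 z koebe2_class_A koebe2_univalent Hz) as [_ [K0 Ek]].
      assert (N := one_minus_sqr_nz z Hz). destruct (cayley_Re_pos _ (Bw z Hz)) as [Nw _].
      replace (dq koebe2 z) with (/ (1 - z * z)).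
      * unfold p. field. auto.
      * destruct (Ceq_dec z 0) as [->|Nz]; [rewrite K0; field; auto|].
        apply (Cmult_reg_l z); [auto|]. rewrite <- Ek. reflexivity.
    + split; [|split]; [rewrite <- R1|rewrite <- R2|rewrite <- R3]; field; auto.
Qed.

(** The squares differ by (1 - t^2) (|a|^2 - |b|^2): a disc automorphism applied to b / a, without
    the division. *)
Lemma Cmod_swap_le (t : R) (a b : C) : (0 <= t <= 1)%R -> (Cmod b <= Cmod a)%R ->
  (Cmod (t * a + b) <= Cmod (a + t * b))%R.
Proof.
  intros Ht H. apply Cmod_le_sqr.
  assert (A := Cmod_sqr a). assert (B := Cmod_sqr b). rewrite !Cmod_sqr.
  assert (Kb := Cmod_ge_0 b).
  destruct a as [a1 a2], b as [b1 b2]. unfold Cplus, Cmult, RtoC, Re, Im in *. simpl in *.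
  assert (0 <= (1 - t * t) * (Cmod (a1, a2) * Cmod (a1, a2) - Cmod (b1, b2) * Cmod (b1, b2)))%R.
  { apply Rmult_le_pos; nra. }
  rewrite A, B in H0. lra.
Qed.

(* A product of two disk automorphisms; with [r = t / (3 (1 + t))] it attains equality in [schwarz_coeff_bounds]. *)
Lemma schwarz_extremal (t : R) : (0 <= t < 1)%R -> exists h, hol h /\
  (forall z, unit_disk z -> (Cmod (h z) <= 1)%R) /\
  exists w4, jet3 h t (t * (1 - t) / 3)%R (1 - t * t * (1 - t) / 9 - t * t)%R w4.
Proof.
  intros Ht. set (r := (t / (3 * (1 + t)))%R).
  assert (Hr : (0 <= r < 1)%R).
  { unfold r. split; [apply Rmult_le_pos; [lra|left; apply Rinv_0_lt_compat; lra]|].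
    apply Rlt_div_l; lra. }
  assert (Er : (r * (1 + t) = t / 3)%R) by (unfold r; field; lra).
  (* b / a is the Blaschke product z (r + z) / (1 + r z). The form r * 1 + z matches
     [Cmod_swap_le]. *)
  set (a := fun z : C => 1 + r * z). set (b := fun z : C => z * (r * 1 + z)).
  assert (Hab : forall z, unit_disk z -> (Cmod (b z) <= Cmod (a z))%R).
  { intros z Hz. unfold unit_disk in Hz. unfold a, b.
    assert (S := Cmod_swap_le r 1 z ltac:(lra) ltac:(rewrite Cmod_1; lra)).
    rewrite Cmod_mult. assert (K := Cmod_ge_0 z). assert (K' := Cmod_ge_0 (r * 1 + z)). nra. }
  assert (Na : forall z, unit_disk z -> a z <> 0).
  { intros z Hz E. unfold a in E. assert (X : RtoC r * z = - (1)) by (transitivity (1 + r * z - 1); [ring|rewrite E; ring]).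
    apply (f_equal Cmod) in X. rewrite Cmod_m1, Cmod_mult, Cmod_R, Rabs_pos_eq in X by lra.
    unfold unit_disk in Hz. assert (K := Cmod_ge_0 z). nra. }
  assert (Nd : forall z, unit_disk z -> a z + t * b z <> 0).
  { intros z Hz E. assert (X : a z = - (t * b z)) by (transitivity (a z + t * b z - t * b z); [ring|rewrite E; ring]).
    apply (f_equal Cmod) in X. rewrite Cmod_opp, Cmod_mult, Cmod_R, Rabs_pos_eq in X by lra.
    assert (L := Hab z Hz). assert (P := proj1 (Cmod_gt_0 _) (Na z Hz)). nra. }
  assert (Ja : jet3 a (1 + r * 0) (0 + r * 1) (0 + r * 0) (0 + r * 0)).
  { apply (jet3_plus (fun _ => RtoC 1)); [apply jet3_const|]. apply jet3_scal, jet3_id. }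
  assert (Jb : jet3 b 0 (r + 0) (0 + 1) (0 + 0)).
  { apply (jet3_shift (fun z => r * 1 + z) _ _ _ 0). eapply jet3_eq; [apply (jet3_plus (fun _ => r * 1) (fun z => z)); [apply jet3_const|apply jet3_id]| | | |]; ring. }
  assert (JN := jet3_plus _ _ _ _ _ _ _ _ _ _ (jet3_scal t _ _ _ _ _ Ja) Jb).
  assert (JD := jet3_plus _ _ _ _ _ _ _ _ _ _ Ja (jet3_scal t _ _ _ _ _ Jb)).
  assert (Ha : hol a).
  { apply (hol_plus (fun _ => 1)); [apply hol_const|]. apply hol_mult; [apply hol_const|apply hol_id]. }
  assert (Hb : hol b).
  { apply hol_mult; [apply hol_id|]. apply (hol_plus (fun _ => r * 1)); [apply hol_const|apply hol_id]. }
  set (h := fun z => (t * a z + b z) / (a z + t * b z)).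
  assert (Hh : hol h).
  { apply hol_div; auto.
    - apply (hol_plus (fun z => t * a z)); [|auto]. apply hol_mult; [apply hol_const|auto].
    - apply (hol_plus a); [auto|]. apply hol_mult; [apply hol_const|auto]. }
  exists h. split; [exact Hh|]. split.
  - intros z Hz. unfold h. rewrite Cmod_div by auto. assert (P := proj1 (Cmod_gt_0 _) (Nd z Hz)).
    apply Rle_div_l; [lra|]. rewrite Rmult_1_l. apply Cmod_swap_le; [lra|auto].
  - destruct (hol_jet3_ex h Hh) as [w2 [w3 [w4 Jh]]]. exists w4. set (w1 := h 0) in *.
    assert (JP := jet3_mult _ _ _ _ _ _ _ _ _ _ JD Jh).
    apply (jet3_ext _ (fun z => t * a z + b z)) in JP.
    2:{ intros z Hz. unfold h. field. auto. }
    destruct (jet3_unique _ _ _ _ _ _ _ _ _ JP JN) as [Q1 [Q2 [Q3 _]]].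
    assert (Er' : r + t * r = t / 3).
    { rewrite <- RtoC_div by lra. rewrite <- Er, RtoC_mult, RtoC_plus. ring. }
    assert (E1 : w1 = t) by (transitivity ((1 + r * 0 + t * 0) * w1); [ring|rewrite Q1; ring]).
    assert (E2 : w2 = t / 3 - t / 3 * t).
    { rewrite <- Er'. match type of Q2 with ?x = ?y => transitivity (w2 - x + y); [rewrite Q2; ring|rewrite E1; ring] end. }
    assert (E3 : w3 = 1 - t / 3 * w2 - t * t).
    { rewrite <- Er'. match type of Q3 with ?x = ?y => transitivity (w3 - x + y); [rewrite Q3; ring|rewrite E1; ring] end. }
    eapply jet3_eq; [exact Jh|exact E1| | |reflexivity].
    + rewrite E2. apply injective_projections; simpl; field.
    + rewrite E3, E2. apply injective_projections; simpl; field.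
Qed.

Open Scope R_scope.

Theorem theorem2p1 :
  (forall (f : C -> C) (gamma : nat -> C),
      class_F f -> log_coefficients f gamma ->
      Cmod (gamma 1%nat) <= 1 / 2 /\
      Cmod (gamma 2%nat) <= 1 / 2 /\
      Cmod (gamma 3%nat) <= 1 / 972 * (95 + 23 * sqrt 46)) /\
  (exists (f : C -> C) (gamma : nat -> C),
      class_F f /\ log_coefficients f gamma /\
      Cmod (gamma 1%nat) = 1 / 2) /\
  (exists (f : C -> C) (gamma : nat -> C),
      class_F f /\ log_coefficients f gamma /\
      Cmod (gamma 2%nat) = 1 / 2) /\
  (exists (f : C -> C) (gamma : nat -> C),
      class_F f /\ log_coefficients f gamma /\
      Cmod (gamma 3%nat) = 1 / 972 * (95 + 23 * sqrt 46)).
Proof.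
  split; [exact coefficient_bounds|]. split; [|split].
  - assert (B : forall z : C, unit_disk z -> Cmod 1 <= 1) by (intros z _; rewrite Cmod_1; lra).
    destruct (extremal_function _ _ _ _ _ (hol_const 1) B (jet3_const 1)) as [f [gamma [Hf [Hg [E _]]]]].
    exists f, gamma. split; [exact Hf|]. split; [exact Hg|].
    rewrite (Cmod_half _ _ (eq_sym E)), Cmod_1. reflexivity.
  - assert (B : forall z : C, unit_disk z -> Cmod z <= 1) by (intros z Hz; left; exact Hz).
    destruct (extremal_function _ _ _ _ _ hol_id B jet3_id) as [f [gamma [Hf [Hg [_ [E _]]]]]].
    exists f, gamma. split; [exact Hf|]. split; [exact Hg|].
    rewrite (Cmod_half _ _ (eq_sym E)).
    replace ((2 * 1 + 0 * 0 / 2 + 1) / 3)%C with (RtoC 1) by (field; apply RtoC_neq; lra).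
    rewrite Cmod_1. reflexivity.
  - destruct sqrt46 as [_ Hq]. assert (Hatt := cubic_bound_attained). cbv zeta in Hatt.
    set (t := (8 - sqrt 46) / 6) in *. assert (Ht : 0 < t < 1) by (unfold t; lra).
    destruct (schwarz_extremal t) as [h [Hh [Bh [w4 Jh]]]]; [lra|].
    destruct (extremal_function h _ _ _ _ Hh Bh Jh) as [f [gamma [Hf [Hg [_ [_ E]]]]]].
    exists f, gamma. split; [exact Hf|]. split; [exact Hg|].
    rewrite (Cmod_half _ _ (eq_sym E)), <- Hatt.
    set (s := 1 / 4 * (1 - 8 / 9 * (t * t) + 2 / 9 * (t * t * t)) + t / 12).
    assert (Hs : 0 <= s).
    { unfold s. assert (0 <= t * t * t) by (repeat apply Rmult_le_pos; lra). nra. }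
    (* All the coefficients are real, so 2 gamma_3 is the nonnegative number 2 s itself. *)
    match goal with |- Cmod ?x / 2 = _ => replace x with (RtoC (2 * s)) end.
    + rewrite Cmod_R, Rabs_pos_eq by lra. field.
    + unfold s. apply injective_projections; simpl; field.
Qed.
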